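(* Let $\{H_i\}_{i\in\mathcal I}$ be a countable family of discrete groups and let $P$ be the second nilpotent product of the family. If every $H_i$ is amenable, then $P$ is amenable. If every $H_i$ has the Haagerup property, then $P$ has the Haagerup property. If every $H_i$ is exact, then $P$ is exact.
   Context: Commutators are $[a,b]=aba^{-1}b^{-1}$. For a family of groups $\{H_i\}_{i\in\mathcal I}$ with free product $F=\ast_{i\in\mathcal I}H_i$, the second nilpotent product of the family is the quotient $F/N$, where $N$ is the normal subgroup of $F$ generated by all elements $[x,[h_j,h_k]]$ with $x\in F$, $h_j\in H_j$, $h_k\in H_k$, $j\neq k$ in $\mathcal I$. *)

(* Defs.v *)
From HB Require Import structures.
From mathcomp Require Import all_boot all_order all_algebra.
From mathcomp Require Import finmap generic_quotient complex.
From mathcomp Require Import all_classical all_reals.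
From mathcomp Require Import ereal topology normedtype esum.
From mathcomp Require summability.
From mathcomp Require Import ring.

Set Implicit Arguments.
Unset Strict Implicit.
Unset Printing Implicit Defensive.

Import Order.TTheory GRing.Theory Num.Theory.
Import numFieldNormedType.Exports Normc.

Local Open Scope classical_set_scope.
Local Open Scope quotient_scope.

Section NormalClosure.
Local Open Scope group_scope.
Variable G : groupType.

Definition normal_subgroup (N : set G) : Prop :=
  [/\ N 1, forall x y, N x -> N y -> N (x * y), forall x, N x -> N x^-1
    & forall g x, N x -> N (g * x * g^-1)].

Definition normal_closure (S : set G) : set G := smallest normal_subgroup S.

Lemma normal_closureP (S : set G) : normal_subgroup (normal_closure S).
Proof.
split=> [N [[]]//|x y Nx Ny N NS|x Nx N NS|g x Nx N NS];
  have [[N1 NM NV NJ] _] := NS.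
- by apply: NM; [apply: Nx|apply: Ny].
- by apply: NV; apply: Nx.
- by apply: NJ; apply: Nx.
Qed.

Variable S : set G.

Definition coset_rel (x y : G) : bool := `[< normal_closure S (x^-1 * y) >].

Lemma coset_rel_equiv : equiv_class_of coset_rel.
Proof.
have [N1 NM NV NJ] := normal_closureP S.
have sym x y : coset_rel x y -> coset_rel y x.
  by move=> /asboolP/NV; rewrite invgM invgK => h; apply/asboolP.
split=> [x|x y|y x z].
- by apply/asboolP; rewrite mulVg.
- by apply/idP/idP; apply: sym.
- move=> /asboolP xy /asboolP yz; apply/asboolP.
  by move: (NM _ _ xy yz); rewrite mulgA mulgK.
Qed.

Canonical coset_equiv := EquivRelPack coset_rel_equiv.

(* The group G / <<S>>^G, where <<S>>^G is the normal closure of S in G. *)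
Definition quotient_ncl := {eq_quot coset_equiv}.

HB.instance Definition _ := Choice.on quotient_ncl.
HB.instance Definition _ := EqQuotient.on quotient_ncl.

Definition quotient_pi (x : G) : quotient_ncl := \pi_quotient_ncl x.

Lemma quotient_piP x y :
  reflect (normal_closure S (x^-1 * y)) (quotient_pi x == quotient_pi y).
Proof.
apply: (iffP eqP) => [/eqmodP/asboolP//|h].
by apply/eqmodP/asboolP.
Qed.

Definition quotient_mul (x y : quotient_ncl) := quotient_pi (repr x * repr y).
Definition quotient_inv (x : quotient_ncl) := quotient_pi (repr x)^-1.

Lemma quotient_repr x : quotient_pi (repr x) = x.
Proof. exact: reprK. Qed.

Lemma quotient_mulE x y :
  quotient_mul (quotient_pi x) (quotient_pi y) = quotient_pi (x * y).
Proof.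
have [N1 NM NV NJ] := normal_closureP S.
rewrite /quotient_mul; set x' := repr _; set y' := repr _.
have /eqP/quotient_piP hx : quotient_pi x' = quotient_pi x by exact: reprK.
have /eqP/quotient_piP hy : quotient_pi y' = quotient_pi y by exact: reprK.
apply/eqP/quotient_piP; rewrite invgM.
have := NM _ _ (NJ y'^-1 _ hx) hy.
by rewrite invgK !mulgA mulgK.
Qed.

Lemma quotient_invE x : quotient_inv (quotient_pi x) = quotient_pi x^-1.
Proof.
have [N1 NM NV NJ] := normal_closureP S.
rewrite /quotient_inv; set x' := repr _.
have /eqP/quotient_piP hx : quotient_pi x' = quotient_pi x by exact: reprK.
apply/eqP/quotient_piP; rewrite invgK.
have := NJ x' _ (NV _ hx).
by rewrite invgM invgK !mulgA mulgK.
Qed.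

Fact quotient_mulA : associative quotient_mul.
Proof.
move=> x y z; rewrite -(quotient_repr x) -(quotient_repr y) -(quotient_repr z).
by rewrite !quotient_mulE mulgA.
Qed.

Fact quotient_mul1 : left_id (quotient_pi 1) quotient_mul.
Proof. by move=> x; rewrite -(quotient_repr x) quotient_mulE mul1g. Qed.

Fact quotient_mul1r : right_id (quotient_pi 1) quotient_mul.
Proof. by move=> x; rewrite -(quotient_repr x) quotient_mulE mulg1. Qed.

Fact quotient_mulV : left_inverse (quotient_pi 1) quotient_inv quotient_mul.
Proof.
by move=> x; rewrite -(quotient_repr x) quotient_invE quotient_mulE mulVg.
Qed.

Fact quotient_mulVr : right_inverse (quotient_pi 1) quotient_inv quotient_mul.
Proof.
by move=> x; rewrite -(quotient_repr x) quotient_invE quotient_mulE mulgV.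
Qed.

HB.instance Definition _ := isGroup.Build quotient_ncl
  quotient_mulA quotient_mul1 quotient_mul1r quotient_mulV quotient_mulVr.

End NormalClosure.

Section FreeProduct.
Local Open Scope group_scope.
Variables (I : choiceType) (H : I -> groupType).

Definition letter := {i : I & H i}.
HB.instance Definition _ := Choice.on letter.

(* Words in the disjoint union of the groups H i, up to the congruence generated
   by erasing an identity letter and multiplying adjacent letters of one H i. *)
Inductive word_eq : seq letter -> seq letter -> Prop :=
| word_eq_refl w : word_eq w w
| word_eq_sym v w : word_eq v w -> word_eq w v
| word_eq_trans u v w : word_eq u v -> word_eq v w -> word_eq u w
| word_eq_cat v v' w w' :
    word_eq v v' -> word_eq w w' -> word_eq (v ++ w) (v' ++ w')
| word_eq_one i : word_eq [:: existT H i 1] [::]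
| word_eq_mul i (h k : H i) :
    word_eq [:: existT H i h; existT H i k] [:: existT H i (h * k)].

Definition word_rel (v w : seq letter) : bool := `[< word_eq v w >].

Lemma word_rel_equiv : equiv_class_of word_rel.
Proof.
split=> [w|v w|v u w].
- exact/asboolP/word_eq_refl.
- by apply/asboolP/asboolP; apply: word_eq_sym.
- by move=> /asboolP uv /asboolP vw; apply/asboolP/(word_eq_trans uv vw).
Qed.

Canonical word_equiv := EquivRelPack word_rel_equiv.

Definition free_product := {eq_quot word_equiv}.

HB.instance Definition _ := Choice.on free_product.
HB.instance Definition _ := EqQuotient.on free_product.

Definition fp_class (w : seq letter) : free_product := \pi_free_product w.

Lemma fp_classP v w : fp_class v = fp_class w <-> word_eq v w.
Proof. by split=> [/eqmodP/asboolP//|h]; apply/eqmodP/asboolP. Qed.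

Definition word_inv (w : seq letter) : seq letter :=
  rev [seq existT H (tag l) (tagged l)^-1 | l <- w].

Lemma word_inv_cat v w : word_inv (v ++ w) = word_inv w ++ word_inv v.
Proof. by rewrite /word_inv map_cat rev_cat. Qed.

Lemma word_invK : involutive word_inv.
Proof.
move=> w; rewrite /word_inv map_rev revK -map_comp.
by rewrite -[RHS]map_id; apply: eq_map => -[i h] /=; rewrite invgK.
Qed.

Lemma word_eq_inv v w : word_eq v w -> word_eq (word_inv v) (word_inv w).
Proof.
elim=> {v w} [w|v w _|u v w _ uv _ vw|v v' w w' _ vv' _ ww'|i|i h k].
- exact: word_eq_refl.
- exact: word_eq_sym.
- exact: word_eq_trans uv vw.
- by rewrite !word_inv_cat; apply: word_eq_cat.
- by rewrite /word_inv /= invg1; apply: word_eq_one.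
- by rewrite /word_inv /= invgM; apply: word_eq_mul.
Qed.

Lemma word_eq_catV w : word_eq (w ++ word_inv w) [::].
Proof.
elim: w => [|[i h] w IH]; first by rewrite /word_inv /=; apply: word_eq_refl.
rewrite -cat1s word_inv_cat catA -(catA [:: _]).
set l := [:: _]; apply: (@word_eq_trans _ (l ++ word_inv l)).
  apply: word_eq_cat; last exact: word_eq_refl.
  rewrite -[X in word_eq _ X]cats0.
  exact: word_eq_cat (word_eq_refl _) IH.
apply: word_eq_trans (word_eq_mul _ _) _.
by rewrite mulgV; apply: word_eq_one.
Qed.

Definition fp_mul (x y : free_product) := fp_class (repr x ++ repr y).
Definition fp_inv (x : free_product) := fp_class (word_inv (repr x)).

Lemma fp_repr x : fp_class (repr x) = x.
Proof. exact: reprK. Qed.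

Lemma fp_mulE v w : fp_mul (fp_class v) (fp_class w) = fp_class (v ++ w).
Proof. by apply/fp_classP/word_eq_cat; apply/fp_classP/reprK. Qed.

Lemma fp_invE w : fp_inv (fp_class w) = fp_class (word_inv w).
Proof. by apply/fp_classP/word_eq_inv/fp_classP/reprK. Qed.

Fact fp_mulA : associative fp_mul.
Proof.
by move=> x y z; rewrite -(fp_repr x) -(fp_repr y) -(fp_repr z) !fp_mulE catA.
Qed.

Fact fp_mul1 : left_id (fp_class [::]) fp_mul.
Proof. by move=> x; rewrite -(fp_repr x) fp_mulE. Qed.

Fact fp_mul1r : right_id (fp_class [::]) fp_mul.
Proof. by move=> x; rewrite -(fp_repr x) fp_mulE cats0. Qed.

Fact fp_mulVr : right_inverse (fp_class [::]) fp_inv fp_mul.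
Proof.
move=> x; rewrite -(fp_repr x) fp_invE fp_mulE.
exact/fp_classP/word_eq_catV.
Qed.

Fact fp_mulV : left_inverse (fp_class [::]) fp_inv fp_mul.
Proof.
move=> x; rewrite -(fp_repr x) fp_invE fp_mulE.
by apply/fp_classP; rewrite -{2}(word_invK (repr x)); apply: word_eq_catV.
Qed.

HB.instance Definition _ := isGroup.Build free_product
  fp_mulA fp_mul1 fp_mul1r fp_mulV fp_mulVr.

Definition fp_inj (i : I) (h : H i) : free_product := fp_class [:: existT H i h].

(* Not [~ a, b], which is a^-1 * b^-1 * a * b. *)
Definition commutator (G : groupType) (a b : G) : G := a * b * a^-1 * b^-1.

Definition nilpotent2_relators : set free_product :=
  [set r | exists (x : free_product) (j k : I) (hj : H j) (hk : H k),
     j <> k /\ r = commutator x (commutator (fp_inj hj) (fp_inj hk))].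

Definition second_nilpotent_product := quotient_ncl nilpotent2_relators.
HB.instance Definition _ := Group.on second_nilpotent_product.

End FreeProduct.

Local Open Scope ring_scope.

(* m is a left-invariant mean on the bounded functions; its values on unbounded
   functions are irrelevant. *)
Definition amenable (R : realType) (G : groupType) : Prop :=
  exists m : (G -> R) -> R,
  [/\ forall (a : R) (f g : G -> R), bounded_fun f -> bounded_fun g ->
        m (fun x => a * f x + g x) = a * m f + m g,
      forall f : G -> R, bounded_fun f -> (forall x, 0 <= f x) -> 0 <= m f,
      m (fun=> 1) = 1
    & forall (g : G) (f : G -> R), bounded_fun f ->
        m (fun x => f (g^-1 * x)%g) = m f].

(* R[i] with the topology of its modulus, as a normed space over itself. *)
HB.instance Definition _ (R : realType) :=
  NormedModule.copy R[i] (R[i] : numFieldType)^o.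

Section Haagerup.
Variables (R : realType) (G : groupType).

Definition positive_definite (phi : G -> R[i]) : Prop :=
  forall n (c : 'I_n -> R[i]) (g : 'I_n -> G),
    0 <= \sum_i \sum_j (c i)^*%C * c j * phi ((g i)^-1 * g j)%g.

Definition vanishes_at_infinity (phi : G -> R[i]) : Prop :=
  forall e : R, 0 < e -> finite_set [set g | e <= normc (phi g)].

(* A family indexed by J together with a proper filter F on J stands for a net;
   sequences would not suffice, as G may be uncountable. *)
Definition haagerup : Prop :=
  exists (J : Type) (F : set_system J) (phi : J -> G -> R[i]),
  [/\ ProperFilter F,
      forall j, [/\ positive_definite (phi j), phi j 1%g = 1
                  & vanishes_at_infinity (phi j)]
    & forall g, phi j g @[j --> F] --> (1 : R[i])].

End Haagerup.

Section L2.
Variables (R : realType) (X : choiceType).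

Definition square_summable : {pred X -> R[i]} := [pred f : X -> R[i] |
  `[< (\esum_(x in [set: X]) (normc (f x) ^+ 2)%:E < +oo)%E >]].

Fact square_summable_submod : submod_closed square_summable.
Proof.
split=> [|a f g /asboolP ff /asboolP gg]; apply/asboolP.
  rewrite esum1 ?ltry// => x _.
  by rewrite [X in normc X](_ : _ = 0)// normc0 expr0n.
have sq2 (u v : R) : (u + v) ^+ 2 <= 2 * u ^+ 2 + 2 * v ^+ 2.
  rewrite -subr_ge0 (_ : _ - _ = (u - v) ^+ 2) ?sqr_ge0//; ring.
pose c : R := 2 * normc a ^+ 2.
have c0 : 0 <= c by rewrite mulr_ge0 ?sqr_ge0.
have le x : normc ((a *: f + g) x) ^+ 2 <=
    c * normc (f x) ^+ 2 + 2 * normc (g x) ^+ 2.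
  rewrite [X in normc X](_ : _ = a * f x + g x)//.
  have n0 (z : R[i]) : 0 <= normc z by case: z => u v; apply: sqrtr_ge0.
  have h : normc (a * f x + g x) <= normc a * normc (f x) + normc (g x).
    by rewrite -normcM le_normcD.
  rewrite (@le_trans _ _ ((normc a * normc (f x) + normc (g x)) ^+ 2))//.
    by rewrite lerXn2r ?nnegrE ?n0 ?addr_ge0 ?mulr_ge0 ?n0.
  rewrite /c -mulrA -exprMn; exact: sq2.
rewrite (@le_lt_trans _ _ (\esum_(x in [set: X])
    ((c%:E * (normc (f x) ^+ 2)%:E) + (2%:E * (normc (g x) ^+ 2)%:E)))%E)//.
  by apply: le_esum => x _; rewrite -!EFinM -EFinD lee_fin.
have ge0 k (h : X -> R[i]) x : 0 <= k -> (0 <= k%:E * (normc (h x) ^+ 2)%:E)%E.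
  by move=> k0; rewrite -EFinM lee_fin mulr_ge0 ?sqr_ge0.
have scal k (h : X -> R[i]) : 0 <= k ->
    (\esum_(x in [set: X]) (normc (h x) ^+ 2)%:E < +oo)%E ->
    (\esum_(x in [set: X]) (k%:E * (normc (h x) ^+ 2)%:E) < +oo)%E.
  move=> k0 hh; set S := (\esum_(x in _) _)%E in hh.
  rewrite (@le_lt_trans _ _ (k%:E * S)%E)//; last first.
    have : (0 <= S)%E by apply: esum_ge0 => x _; rewrite lee_fin sqr_ge0.
    by case: S hh => [s| |]//= _ _; rewrite -EFinM ltry.
  apply: ge_ereal_sup => _ [A [fA _] <-].
  rewrite -ge0_mule_fsumr; last by move=> x; rewrite lee_fin sqr_ge0.
  rewrite lee_wpmul2l ?lee_fin//.
  by apply: ereal_sup_ubound; exists A.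
rewrite esumD; [|by move=> x _; exact: ge0|by move=> x _; exact: ge0].
by rewrite lte_add_pinfty ?scal.
Qed.

HB.instance Definition _ :=
  GRing.isSubmodClosed.Build R[i] (X -> R[i]) square_summable
    square_summable_submod.

Record l2 := L2 { l2_fun :> X -> R[i]; l2P : l2_fun \in square_summable }.

HB.instance Definition _ := [isSub for l2_fun].
HB.instance Definition _ := [Choice of l2 by <:].
HB.instance Definition _ := [SubChoice_isSubZmodule of l2 by <:].
HB.instance Definition _ := [SubZmodule_isSubLmodule of l2 by <:].

Definition l2_norm (f : l2) : R :=
  Num.sqrt (fine (\esum_(x in [set: X]) (normc (f x) ^+ 2)%:E)).

(* The unconditional sum: the limit of the partial sums over the finite subsets
   of X. *)
Definition l2_dot (f g : l2) : R[i] :=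
  summability.sum (fun x => f x * (g x)^*%C).

End L2.

Section Operators.
Variables (R : realType).

Definition bounded_op (X : choiceType) : set (l2 R X -> l2 R X) :=
  [set T | linear T /\
    exists M : R, forall f, l2_norm (T f) <= M * l2_norm f].

Definition op_norm (X : choiceType) (T : l2 R X -> l2 R X) : R :=
  inf [set M : R | 0 <= M /\ forall f, l2_norm (T f) <= M * l2_norm f].

(* T, acting on the direct sum of n copies of l2 R X, is a positive operator. *)
Definition positive_op_matrix (X : choiceType) n
    (T : 'I_n -> 'I_n -> l2 R X -> l2 R X) : Prop :=
  forall f : 'I_n -> l2 R X, 0 <= \sum_i \sum_j l2_dot (T i j (f j)) (f i).

(* theta is a contractive completely positive map from the operator space A to
   the bounded operators on l2 R Y; its values outside A are irrelevant. *)
Definition contractive_cp (X Y : choiceType) (A : set (l2 R X -> l2 R X))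
    (theta : (l2 R X -> l2 R X) -> (l2 R Y -> l2 R Y)) : Prop :=
  [/\ forall T, A T -> bounded_op (theta T),
      forall a S T, A S -> A T -> theta (a *: S + T) = a *: theta S + theta T,
      forall n (T : 'I_n -> 'I_n -> l2 R X -> l2 R X),
        (forall i j, A (T i j)) -> positive_op_matrix T ->
        positive_op_matrix (fun i j => theta (T i j))
    & forall T, A T -> op_norm (theta T) <= op_norm T].

(* The net phi, psi factors theta approximately, in the point-norm topology,
   through matrix algebras. Since l2 R 'I_k is the Hilbert space C^k, its algebra
   of bounded operators is M_k(C). *)
Definition nuclear (X Y : choiceType) (A : set (l2 R X -> l2 R X))
    (theta : (l2 R X -> l2 R X) -> (l2 R Y -> l2 R Y)) : Prop :=
  exists (J : Type) (F : set_system J) (k : J -> nat)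
    (phi : forall j, (l2 R X -> l2 R X) -> (l2 R 'I_(k j) -> l2 R 'I_(k j)))
    (psi : forall j, (l2 R 'I_(k j) -> l2 R 'I_(k j)) -> (l2 R Y -> l2 R Y)),
  [/\ ProperFilter F,
      forall j, contractive_cp A (phi j),
      forall j, contractive_cp (@bounded_op 'I_(k j)) (psi j)
    & forall T, A T ->
        op_norm (psi j (phi j T) - theta T) @[j --> F] --> (0 : R)].

End Operators.

Section ReducedCstar.
Variables (R : realType) (G : groupType).

Fact left_translate_subproof (g : G) (f : l2 R G) :
  (fun x => f (g^-1 * x)%g) \in @square_summable R G.
Proof.
have /asboolP h := l2P f; apply/asboolP.
rewrite -(reindex_esum [set: G] [set: G] (fun x => (g^-1 * x)%g)
  (fun x => (normc (f x) ^+ 2)%:E))//.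
split=> //= [x y _ _|x _]; first exact: mulgI.
by exists (g * x)%g; rewrite ?mulKg.
Qed.

Definition left_regular (g : G) (f : l2 R G) : l2 R G :=
  L2 (left_translate_subproof g f).

(* The operator-norm closure of the linear span of the left translations. *)
Definition reduced_cstar : set (l2 R G -> l2 R G) :=
  [set T | bounded_op T /\ forall e : R, 0 < e ->
    exists (s : seq G) (a : G -> R[i]),
      op_norm (T - \sum_(g <- s) a g *: left_regular g) < e].

(* The reduced C*-algebra is exact: its inclusion in the algebra of all bounded
   operators on l2 R G is nuclear. By Arveson's extension theorem any other
   faithful representation gives the same notion. *)
Definition exact_group : Prop := nuclear reduced_cstar id.

End ReducedCstar.

(* Main.v *)
Require Import Defs.
From mathcomp Require Import all_boot all_order all_algebra.
From mathcomp Require spectral.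
From mathcomp Require Import finmap complex.
From mathcomp Require Import all_classical all_reals.
From mathcomp Require Import ereal topology normedtype esum.
From mathcomp Require summability.
From mathcomp Require Import zify ring lra.

Set Implicit Arguments.
Unset Strict Implicit.
Unset Printing Implicit Defensive.

Import Order.TTheory GRing.Theory Num.Theory.
Import numFieldNormedType.Exports Normc.

Local Open Scope classical_set_scope.

(** Write P for the second nilpotent product, p_i : P -> H_i for the coordinate
maps and D for the common kernel of the p_i.  The relators make every
commutator [h_j, h_k] with j <> k central, so D is central, and all three
properties are obtained from the same picture of P.

Let q : P -> N be the quotient of P by the commutators of elements of a single
factor.  In N all commutators of generators are central, so finitely generated
subgroups of N have polynomial growth and N has Folner sets ([folner],
[folner_quotient]).  The family (p_i)_i together with q separates the points of
P ([joint_faithful]): an element of the kernel of q is a product of letters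
each of which commutes with all the factors other than its own; such a product
can be sorted by factor, and is then determined by its coordinates.  A given
finite subset of P has only finitely many nontrivial coordinates.  Hence P
embeds in (direct sum of the H_i) x N, and a property that is local in this
sense passes to P.

Amenability.  The center carries an invariant mean, again by Folner sets.
Average a bounded function over the center, and then over the factors H_i
one after the other: since factors commute modulo the center, each average
preserves the invariance already achieved ([average_over_fixed]).  This handles
finitely many factors, and a limit along an ultrafilter does the rest
([mean_of_approximate]).

Haagerup property.  Positive definite functions are multiplied: one function of
p_i for each of finitely many coordinates, the indicator of the subgroup on
which the other coordinates are trivial, and a finitely supported function of q
coming from a Folner set ([haagerup_approx]).

Exactness.  Nuclearity of the inclusion of the reduced C*-algebra is equivalent
to the existence, for every finite S and e > 0, of vectors zeta_s, s in G, with
zeta_s almost equal to zeta_t when s t^-1 is in S and orthogonal to it unless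
s t^-1 lies in a fixed finite set ([exact_approx]).  These vectors are
tensored exactly as positive definite functions are multiplied.  Given the
vectors, one compresses operators to a finite subset of G and spreads the
resulting matrices back over G with the vectors as weights ([assemble_cp],
[exact_of_approximable]).  Conversely, a completely positive map from the
reduced C*-algebra to matrices is approximated on finitely many translations by
sums of vector functionals with finitely supported vectors; this is a
separation argument for a convex cone ([vector_approximation]).  Composing with
the map back to operators gives a kernel that is a sum of positive semidefinite
kernels with small support, and their Gram vectors are the required zeta_s
([kernel_gram], [approximable_of_exact]). *)

(** * Central commutators *)

Lemma mul_morph1 (G Q : groupType) (p : G -> Q) :
  {morph p : x y / (x * y)%g} -> p 1%g = 1%g.
Proof. by move=> pM; apply: (mulgI (p 1%g)); rewrite -pM !mulg1. Qed.

Lemma mul_morphV (G Q : groupType) (p : G -> Q) :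
  {morph p : x y / (x * y)%g} -> {morph p : x / (x^-1)%g}.
Proof.
by move=> pM x; apply: (mulgI (p x)); rewrite -pM !mulgV mul_morph1.
Qed.

Section CentralCommutators.
Local Open Scope group_scope.
Variable G : groupType.

Definition central (z : G) : Prop := forall x, z * x = x * z.

Lemma commutator_eq (a b : G) : a * b = commutator a b * (b * a).
Proof. by rewrite /commutator !mulgA !mulgVK. Qed.

Lemma commutator_eq1 (a b : G) : a * b = b * a <-> commutator a b = 1.
Proof.
split=> [ab|ab]; first by rewrite /commutator ab mulgK mulgV.
by rewrite commutator_eq ab mul1g.
Qed.

Lemma central1 : central 1.
Proof. by move=> x; rewrite mul1g mulg1. Qed.

Lemma centralM (x y : G) : central x -> central y -> central (x * y).
Proof. by move=> cx cy z; rewrite -mulgA (cy z) mulgA (cx z) mulgA. Qed.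

Lemma centralV (x : G) : central x -> central x^-1.
Proof.
by move=> cx z; apply: (mulgI x); rewrite mulVKg mulgA cx mulgK.
Qed.

(** Modulo central elements both a and b commute with k, and the central factors
that they produce cancel in the commutator of a and b. *)
Lemma commutator_centralizes (a b k : G) :
  central (commutator a k) -> central (commutator b k) ->
  commutator a b * k = k * commutator a b.
Proof.
move: (commutator_eq a k) (commutator_eq b k).
move: (commutator a k) (commutator b k) => u v ak bk cu cv.
have abk : a * b * k = u * v * k * (a * b).
  by rewrite -mulgA bk mulgA -(cv a) -mulgA (mulgA a k) ak !mulgA (cu v).
have bak : b * a * k = u * v * k * (b * a).
  by rewrite -mulgA ak mulgA -(cu b) -mulgA (mulgA b k) bk !mulgA.
have comm : commutator a b = a * b * (b * a)^-1.
  by rewrite /commutator invgM !mulgA.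
have bak' : (b * a)^-1 * (u * v * k) = k * (b * a)^-1.
  by apply: (mulgI (b * a)); rewrite mulVKg mulgA bak mulgK.
have cuv := centralM cu cv.
rewrite comm -[LHS]mulgA; apply: (mulgI (u * v)).
transitivity (a * b * ((b * a)^-1 * (u * v * k))).
  by rewrite (mulgA (a * b)) mulgA (cuv (_ * _)) !mulgA.
by rewrite bak' mulgA abk !mulgA.
Qed.

End CentralCommutators.

(** * The second nilpotent product and its quotients *)

Section SecondNilpotentProduct.
Local Open Scope group_scope.
Variables (I : choiceType) (H : I -> groupType).
Notation P := (second_nilpotent_product H).
Notation letter := (letter H).

Definition word_val (w : seq letter) : P :=
  quotient_pi (@nilpotent2_relators I H) (fp_class w).

Definition letter_val (l : letter) : P := word_val [:: l].

Definition factor i (h : H i) : P := letter_val (existT H i h).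

Lemma quotient_piM (G : groupType) (S : set G) (x y : G) :
  quotient_pi S (x * y) = quotient_pi S x * quotient_pi S y :> quotient_ncl S.
Proof. by rewrite -quotient_mulE. Qed.

Lemma quotient_piV (G : groupType) (S : set G) (x : G) :
  quotient_pi S x^-1 = (quotient_pi S x)^-1 :> quotient_ncl S.
Proof. by rewrite -quotient_invE. Qed.

Lemma quotient_pi1 (G : groupType) (S : set G) :
  quotient_pi S 1 = 1 :> quotient_ncl S.
Proof. by []. Qed.

Lemma quotient_pi_eq1 (G : groupType) (S : set G) (x : G) :
  quotient_pi S x = 1 :> quotient_ncl S <-> normal_closure S x.
Proof.
rewrite -quotient_pi1; split=> [/esym/eqP/quotient_piP|h].
  by rewrite invg1 mul1g.
by apply/esym/eqP/quotient_piP; rewrite invg1 mul1g.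
Qed.

Lemma normal_closure_incl (G : groupType) (S : set G) : S `<=` normal_closure S.
Proof. exact: sub_gen_smallest. Qed.

Lemma word_val_nil : word_val [::] = 1.
Proof. by []. Qed.

Lemma word_val_cat v w : word_val (v ++ w) = word_val v * word_val w.
Proof. by rewrite /word_val -quotient_piM; congr quotient_pi; rewrite -fp_mulE. Qed.

Lemma word_val_cons l w : word_val (l :: w) = letter_val l * word_val w.
Proof. by rewrite -cat1s word_val_cat. Qed.

Lemma word_val_inv w : word_val (word_inv w) = (word_val w)^-1.
Proof. by rewrite /word_val -quotient_piV; congr quotient_pi; rewrite -fp_invE. Qed.

Lemma word_val_surj (x : P) : exists w, x = word_val w.
Proof. by exists (repr (repr x)); rewrite /word_val fp_repr quotient_repr. Qed.

Lemma factorM i (h k : H i) : factor (h * k) = factor h * factor k.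
Proof.
rewrite /factor /letter_val -word_val_cat /word_val; congr quotient_pi.
by apply/fp_classP/word_eq_sym/word_eq_mul.
Qed.

Lemma factor1 i : factor (1 : H i) = 1.
Proof. by rewrite /factor /letter_val /word_val; congr quotient_pi; apply/fp_classP/word_eq_one. Qed.

Lemma factorV i (h : H i) : factor h^-1 = (factor h)^-1.
Proof. by apply: (mulgI (factor h)); rewrite -factorM !mulgV factor1. Qed.

Lemma commutator_factor_central i j (h : H i) (k : H j) :
  i <> j -> central (commutator (factor h) (factor k)).
Proof.
move=> ij x; rewrite -(quotient_repr x).
have piC (G : groupType) (S : set G) (a b : G) : quotient_pi S (commutator a b)
    = commutator (quotient_pi S a) (quotient_pi S b) :> quotient_ncl S.
  by rewrite /commutator !quotient_piM !quotient_piV.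
rewrite /factor /letter_val /word_val.
rewrite -[commutator _ _]piC; apply/esym/commutator_eq1.
rewrite -[commutator _ _]piC; apply/quotient_pi_eq1; apply: normal_closure_incl.
by exists (repr x), i, j, h, k.
Qed.

(** The default 1 of [tagged_as] is taken at the letters of the other factors. *)
Definition letter_proj i (l : letter) : H i := tagged_as (existT H i 1) l.

Lemma letter_proj_eq i (h : H i) : letter_proj i (existT H i h) = h.
Proof.
by rewrite /letter_proj /tagged_as /=; case: eqP => // e; rewrite [e]eq_axiomK.
Qed.

Lemma letter_proj_neq i (l : letter) : tag l != i -> letter_proj i l = 1.
Proof.
rewrite /letter_proj /tagged_as eq_sym /= => /negPf li.
by case: eqP => //= e; rewrite {1}e eqxx in li.
Qed.

Fixpoint word_proj i (w : seq letter) : H i :=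
  if w is l :: w' then letter_proj i l * word_proj i w' else 1.

Lemma word_proj_cat i v w : word_proj i (v ++ w) = word_proj i v * word_proj i w.
Proof. by elim: v => [|l v IH] /=; rewrite ?mul1g// IH mulgA. Qed.

Lemma word_proj_inv i w : word_proj i (word_inv w) = (word_proj i w)^-1.
Proof.
elim: w => [|[j h] w IH]; first by rewrite /= invg1.
rewrite -cat1s word_inv_cat !word_proj_cat IH invgM; congr (_ * _).
rewrite /word_inv /= !mulg1; case: (eqVneq j i) => [e|ji].
  by move: h; rewrite e => h; rewrite !letter_proj_eq.
by rewrite !letter_proj_neq ?invg1.
Qed.

Lemma word_proj_eq i v w : word_eq v w -> word_proj i v = word_proj i w.
Proof.
elim=> {v w} [w|v w _|u v w _ uv _ vw|v v' w w' _ vv' _ ww'|j|j h k] //.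
- by rewrite uv.
- by rewrite !word_proj_cat vv' ww'.
- rewrite /= mulg1; case: (eqVneq j i) => [->|ji]; first by rewrite letter_proj_eq.
  by rewrite letter_proj_neq.
- rewrite /= !mulg1; case: (eqVneq j i) => [e|ji].
    by move: h k; rewrite e => h k; rewrite !letter_proj_eq.
  by rewrite !letter_proj_neq ?mulg1.
Qed.

Definition proj i (x : P) : H i := word_proj i (repr (repr x)).

(** A relator is a commutator with an argument [h_j, h_k]; since j <> k, at least
one of h_j, h_k has trivial i-th coordinate, so the relators, and with them
their normal closure, are killed by the i-th coordinate. *)
Lemma proj_word_val i w : proj i (word_val w) = word_proj i w.
Proof.
rewrite /proj /word_val.
pose f (x : free_product H) := word_proj i (repr x).
have fE v : f (fp_class v) = word_proj i v.
  by apply: word_proj_eq; apply/fp_classP; rewrite fp_repr.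
have fM x y : f (x * y) = f x * f y.
  by rewrite -(fp_repr x) -(fp_repr y) [_ * _]fp_mulE !fE word_proj_cat.
have fV x : f x^-1 = (f x)^-1.
  by rewrite -(fp_repr x) [_^-1]fp_invE !fE word_proj_inv.
have f1 : f 1 = 1 by rewrite [1]/(fp_class [::]) fE.
have ker : normal_closure (@nilpotent2_relators I H) `<=` [set x | f x = 1].
  apply: smallest_sub.
    split=> [//|x y /= fx fy|x /= fx|g x /= fx].
    - by rewrite fM fx fy mulg1.
    - by rewrite fV fx invg1.
    - by rewrite !fM fV fx mulg1 mulgV.
  move=> _ [x [j [k [h [h' [jk ->]]]]]] /=.
  suff c1 : f (commutator (fp_inj h) (fp_inj h')) = 1.
    move: (commutator (fp_inj h) _) c1 => c c1.
    by rewrite /commutator !fM !fV c1 mulg1 mulgV invg1 mulg1.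
  rewrite /commutator !fM !fV /fp_inj !fE /= !mulg1.
  have [ji|ji] := eqVneq j i; last first.
    by rewrite (@letter_proj_neq _ (existT H j h))// invg1 mul1g mulg1 mulgV.
  have ki : k != i by apply/eqP => ki; apply: jk; rewrite ji ki.
  by rewrite (@letter_proj_neq _ (existT H k h'))// invg1 !mulg1 mulgV.
rewrite -[LHS]/(f (repr _)) -fE; set x := fp_class w.
have : quotient_pi (@nilpotent2_relators I H) (repr (quotient_pi (@nilpotent2_relators I H) x))
   == quotient_pi (@nilpotent2_relators I H) x by rewrite quotient_repr.
move=> /quotient_piP/ker; rewrite /= fM fV => h.
by rewrite -[LHS]mulg1 -h mulVKg.
Qed.

Lemma projM i x y : proj i (x * y) = proj i x * proj i y.
Proof.
have [v ->] := word_val_surj x; have [w ->] := word_val_surj y.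
by rewrite -word_val_cat !proj_word_val word_proj_cat.
Qed.

Lemma proj_one i : proj i 1 = 1.
Proof. by rewrite -word_val_nil proj_word_val. Qed.

Lemma projV i x : proj i x^-1 = (proj i x)^-1.
Proof. by apply: (mulgI (proj i x)); rewrite -projM !mulgV proj_one. Qed.

Lemma proj_support (x : P) : exists s : seq I, forall i, i \notin s -> proj i x = 1.
Proof.
have [w ->] := word_val_surj x; exists [seq tag l | l <- w] => i.
rewrite proj_word_val; elim: w => //= l w IH; rewrite in_cons negb_or => /andP[li iw].
by rewrite letter_proj_neq 1?eq_sym// IH// mul1g.
Qed.

Definition same_factor_commutators : set P :=
  [set r | exists i (a b : H i), r = commutator (factor a) (factor b)].

Notation N := (quotient_ncl same_factor_commutators).

(** Two letters of one factor commute in the quotient by construction; the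
commutator of letters of different factors is already central in P. *)
Lemma quotient_commutator_central (l l' : letter) :
  central (commutator (quotient_pi same_factor_commutators (letter_val l) : N)
                      (quotient_pi same_factor_commutators (letter_val l') : N)).
Proof.
have -> : commutator (quotient_pi same_factor_commutators (letter_val l) : N)
    (quotient_pi same_factor_commutators (letter_val l') : N)
   = quotient_pi same_factor_commutators (commutator (letter_val l) (letter_val l')).
  by rewrite /commutator !quotient_piM !quotient_piV.
case: l l' => [i h] [j k] x; have [e|ij] := eqVneq i j.
  move: h; rewrite e => h; rewrite (_ : quotient_pi _ _ = 1).
    by rewrite mul1g mulg1.
  by apply/quotient_pi_eq1; apply: normal_closure_incl; exists j, h, k.
rewrite -(quotient_repr x) -[LHS]quotient_piM -[RHS]quotient_piM.
congr quotient_pi; apply: commutator_factor_central; exact/eqP.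
Qed.

(** A letter commuting with all the factors other than its own.  Commutators of
elements of one factor are such letters, by [commutator_centralizes]. *)
Definition good_letter (l : letter) : Prop :=
  forall j (h : H j), tag l != j ->
    letter_val l * factor h = factor h * letter_val l.

Definition good_word (w : seq letter) : Prop := forall l, l \in w -> good_letter l.

Definition good_products : set P := [set x | exists2 w, good_word w & x = word_val w].

(** Stability under conjugation is checked on the conjugating letters: conjugation
by k in H_j fixes a good letter of another factor and, up to central elements,
preserves the property of commuting with the other factors for a letter of
H_j. *)
Lemma good_products_normal : normal_subgroup good_products.
Proof.
have goodV i (h : H i) :
    good_letter (existT H i h) -> good_letter (existT H i h^-1).
  move=> gh j k ij; have /= := gh j k ij.
  rewrite -!/(factor _) factorV => e.
  by apply: (mulgI (factor h)); rewrite mulVKg !mulgA e mulgK.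
split.
- by exists [::].
- move=> _ _ [v gv ->] [w gw ->]; exists (v ++ w); last by rewrite word_val_cat.
  by move=> l; rewrite mem_cat => /orP[/gv|/gw].
- move=> _ [w gw ->]; exists (word_inv w); last by rewrite word_val_inv.
  move=> l; rewrite /word_inv mem_rev => /mapP[[i h] /gw gl ->] /=.
  exact: goodV.
- move=> g _ [w gw ->]; have [v ->] := word_val_surj g.
  elim: v => [|[j k] v [v' gv' IH]].
    by exists w; rewrite // word_val_nil invg1 mul1g mulg1.
  have -> : word_val (existT H j k :: v) * word_val w
      * (word_val (existT H j k :: v))^-1
      = factor k * (word_val v * word_val w * (word_val v)^-1) * (factor k)^-1.
    by rewrite word_val_cons invgM !mulgA.
  rewrite IH; elim: v' gv' {w gw v IH} => [|[i h] w IH] gw.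
    by exists [::]; rewrite // word_val_nil mulg1 mulgV.
  case: IH => [l lw|w' gw' IH]; first by apply: gw; rewrite in_cons lw orbT.
  have gl := gw _ (mem_head _ _).
  suff [l' gl' cl'] : exists2 l', good_letter l' &
      factor k * factor h * (factor k)^-1 = letter_val l'.
    exists (l' :: w').
      by move=> l; rewrite in_cons => /predU1P[->//|/gw'].
    by rewrite !word_val_cons -IH -cl' !mulgA mulgVK.
  move=> {IH}; case: (eqVneq i j) => ij; last first.
    exists (existT H i h) => //; have /= := gl j k ij.
    by rewrite -!/(factor _) => <-; rewrite mulgK.
  move: k; rewrite -ij => k {j ij}.
  exists (existT H i (k * h * k^-1)); last by rewrite -[RHS]/(factor _) !factorM factorV.
  move=> j m ij /=; rewrite -!/(factor _) !factorM factorV.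
  have /commutator_factor_central cz : i <> j by exact/eqP.
  set K := factor k; set A := factor h; set M := factor m.
  have cAM : A * M = M * A by exact: (gl j m ij).
  have : central (commutator K^-1 M) by rewrite /K -factorV; exact: cz.
  move: (commutator_eq K^-1 M); move: (commutator K^-1 M) => c KM cc.
  have MK : M * K = c * (K * M).
    by apply: (mulgI K^-1); rewrite mulgA KM -mulgA mulgVK mulgA -(cc K^-1) -mulgA mulKg.
  by rewrite -mulgA KM mulgA -(cc (K * A)) !mulgA MK -!mulgA (mulgA A) cAM !mulgA.
Qed.

(** All the letters of the factor H_i can be moved to the front, as they commute
with the other letters of the word. *)
Lemma good_word_sort i w : good_word w ->
  word_val w = factor (word_proj i w) * word_val [seq l <- w | tag l != i].
Proof.
elim: w => [|[j h] w IH] gw; first by rewrite /= factor1 mul1g.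
have {}IH := IH (fun l lw => gw l (mem_behead (s := existT H j h :: w) lw)).
have gl := gw _ (mem_head _ _).
rewrite word_val_cons IH /=; have [e|ji] /= := eqVneq j i.
  by move: h gl {gw}; rewrite e => h gl; rewrite letter_proj_eq factorM mulgA.
by rewrite letter_proj_neq// mul1g word_val_cons !mulgA gl.
Qed.

Lemma good_word_trivial w : good_word w ->
  (forall i, word_proj i w = 1) -> word_val w = 1.
Proof.
have [n wn] := ubnP (size w); elim: n w wn => [|n IH] [|l w] //= wn gw w1.
set i := tag l; have w1i : word_proj i (l :: w) = 1 := w1 i.
rewrite (good_word_sort i gw) w1i factor1 mul1g.
apply: IH => [|l'|j].
- by rewrite /= eqxx /= size_filter; apply: (leq_ltn_trans (count_size _ w)).
- by rewrite mem_filter => /andP[_ /gw].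
- have [ji|ji] := eqVneq j i; last first.
    rewrite -(w1 j) -[in RHS]/(word_proj j (l :: w)).
    elim: (l :: w) => //= l' w' IHw; have [li|li] /= := eqVneq (tag l') i.
      by rewrite IHw [letter_proj _ _]letter_proj_neq ?mul1g// li eq_sym.
    by rewrite IHw.
  rewrite ji; elim: (l :: w) => //= l' w' IHw; have [li//|li] /= := eqVneq (tag l') i.
  by rewrite IHw letter_proj_neq// mulg1.
Qed.

(** The good products form a normal subgroup containing the commutators inside the
factors, so the kernel of the quotient map consists of good products, and a
good product is determined by its coordinates. *)
Lemma joint_faithful (x : P) : (forall i, proj i x = 1) ->
  quotient_pi same_factor_commutators x = 1 :> N -> x = 1.
Proof.
move=> x1 /quotient_pi_eq1; have sub : normal_closure same_factor_commutators `<=` good_products.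
  apply: smallest_sub; first exact: good_products_normal.
  move=> _ [i [a [b ->]]]; exists [:: existT H i (commutator a b)].
    move=> _ /[!inE]/eqP-> j h /= ij; rewrite -!/(factor _) /commutator !factorM !factorV.
    have /commutator_factor_central cz : i <> j by exact/eqP.
    by rewrite -/(commutator _ _); apply: commutator_centralizes; exact: cz.
  by rewrite -[RHS]/(factor _) /commutator !factorM !factorV.
move=> /sub[w gw xw]; rewrite xw; apply: good_word_trivial => // i.
by rewrite -proj_word_val -xw.
Qed.

End SecondNilpotentProduct.

(** * Groups with central commutators have Folner sets *)

Section PolynomialGrowth.

Lemma leq_expr e (m n : nat) : (m <= n)%N -> (m ^ e <= n ^ e)%N.
Proof. by case: e => // e mn; rewrite leq_exp2r. Qed.

(** Otherwise f would be multiplied by at least (n + 1) / n over each step of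
length m, hence by 2 over n such steps, and would grow exponentially. *)
Lemma poly_growth_almost_stable (f : nat -> nat) p n m :
  (forall k, 0 < f k <= k.+1 ^ p)%N -> (0 < n)%N ->
  exists k, (n * f (k + m) <= n.+1 * f k)%N.
Proof.
move=> fP n0; apply/not_existsP => grow.
have {}grow k : (n.+1 * f k <= n * f (k + m))%N.
  by have /negP := grow k; rewrite -ltnNge => /ltnW.
have iter j k : (n.+1 ^ j * f k <= n ^ j * f (k + j * m))%N.
  elim: j k => [|j IH] k; first by rewrite mul0n addn0.
  rewrite !expnS mulnAC (leq_trans (leq_mul (grow k) (leqnn _)))//.
  rewrite -mulnA (mulnC (f _)) -mulnA leq_mul2l; apply/orP; right.
  by rewrite (leq_trans (IH (k + m)))// mulSn addnA.
have bern : (2 * n ^ n <= n.+1 ^ n)%N.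
  have bin j : (n ^ j.+1 + j.+1 * n ^ j <= n.+1 ^ j.+1)%N.
    elim: j => [|j IH]; first by rewrite expn0 !expn1 muln1 addn1.
    rewrite (expnS n.+1) (leq_trans _ (leq_mul (leqnn n.+1) IH))// !expnS.
    by move: (n ^ j)%N => a; nia.
  case: n n0 bin {fP grow iter} => // n _ bin.
  by rewrite mul2n -addnn (leq_trans _ (bin n))// -expnS.
have double k : (2 * f k <= f (k + n * m))%N.
  have nn : (0 < n ^ n)%N by rewrite expn_gt0 n0.
  rewrite -(leq_pmul2l nn) (leq_trans _ (iter n k))// mulnA leq_mul2r.
  by rewrite mulnC bern orbT.
have two s : (2 ^ s <= f (s * (n * m)))%N.
  elim: s => [|s IH]; first by case/andP: (fP (0 * (n * m))%N).
  rewrite expnS (leq_trans _ (leq_trans (double (s * (n * m))%N) _))//.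
    by rewrite leq_mul2l IH orbT.
  by rewrite mulSn addnC.
have [r rE] : exists r, r = ((n * m).+1 ^ p * p.+1 ^ p)%N by eexists.
have := two (p.+1 * r)%N; rewrite leqNgt => /negP; apply.
case/andP: (fP (p.+1 * r * (n * m))%N) => _ /leq_ltn_trans; apply.
have b1 : ((p.+1 * r * (n * m)).+1 <= (n * m).+1 * (p.+1 * r.+1))%N.
  by move: (n * m)%N => q; nia.
(* With p + 1 times r doublings, 2 ^ (p r) absorbs the power (r + 1) ^ p and the
   last 2 ^ r exceeds the constant r. *)
rewrite (leq_ltn_trans (leq_expr p b1))// !expnMn mulnA -rE mulSn expnD.
apply: (@leq_ltn_trans (r * 2 ^ (p * r))%N).
  by rewrite leq_mul2l (mulnC p) expnM leq_expr ?orbT// ltn_expl.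
by rewrite ltn_mul2r expn_gt0 /= ltn_expl.
Qed.

End PolynomialGrowth.

Section Folner.
Local Open Scope group_scope.
Variable G : groupType.

Definition gprod (w : seq G) : G := foldr *%g 1 w.

Lemma gprod_cat v w : gprod (v ++ w) = gprod v * gprod w.
Proof. by elim: v => [|x v IH]; rewrite /= ?mul1g// IH mulgA. Qed.

Lemma gprod_nseq n x : gprod (nseq n x) = x ^+ n.
Proof. by elim: n => [|n IH] //=; rewrite expgS IH. Qed.

Lemma centralX (c : G) n : central c -> central (c ^+ n).
Proof.
move=> cc; elim: n => [|n IH]; first exact: central1.
by rewrite expgS; apply: centralM.
Qed.

(** A word in central letters is determined by the multiplicities of its letters. *)
Lemma central_words_cover (T : seq G) k : (forall c, c \in T -> central c) ->
  exists2 L : seq G, (size L <= k.+1 ^ size T)%N &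
    forall w, {subset w <= T} -> (size w <= k)%N -> gprod w \in L.
Proof.
elim: T => [|c T IH] cT.
  exists [:: 1] => // -[|x w] wT _; first exact: mem_head.
  by have := wT x (mem_head _ _).
have [x xT|L sL LP] := IH; first by apply: cT; rewrite in_cons xT orbT.
have cc : central c by apply: cT; exact: mem_head.
exists [seq c ^+ a * y | a <- iota 0 k.+1, y <- L].
  by rewrite size_allpairs size_iota expnS leq_mul.
move=> w wT wk; rewrite (_ : gprod w = c ^+ count_mem c w * gprod [seq x <- w | x != c]).
  apply: allpairs_f.
    by rewrite mem_iota /= add0n ltnS (leq_trans (count_size _ _)).
  apply: LP => [x|]; last by rewrite size_filter (leq_trans (count_size _ _)).
  by rewrite mem_filter => /andP[xc /wT]; rewrite in_cons (negPf xc).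
elim: w {wT wk} => [|x w IHw] /=; first by rewrite mulg1.
rewrite IHw; have [->|xc] /= := eqVneq x c; first by rewrite expgS mulgA.
by rewrite mulgA -(centralX _ cc) !mulgA.
Qed.

(** Moving each occurrence of t to the front across the previous letters creates
central commutators, at most one for each pair of positions of the word. *)
Lemma collect_letter (t : G) (T w : seq G) :
  (forall s, s \in T -> central (commutator s t)) -> {subset w <= t :: T} ->
  exists v, [/\ {subset v <= [seq commutator s t | s <- T]},
    (size v <= size w ^ 2)%N &
    gprod w = t ^+ count_mem t w * gprod [seq x <- w | x != t] * gprod v].
Proof.
move=> cT; elim: w => [|x w IH] wT.
  by exists [::]; split=> //; rewrite /= !mulg1.
have [y yw|v [vT sv wv]] := IH; first by apply: wT; rewrite in_cons yw orbT.
have [e|xt] := eqVneq x t.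
  exists v; split=> //; first by rewrite (leq_trans sv)// leq_exp2r.
  by rewrite /= wv e eqxx /= add1n expgS !mulgA.
set a := count_mem t w; have xT : x \in T.
  by have := wT x (mem_head _ _); rewrite in_cons (negPf xt).
exists (nseq a (commutator x t) ++ v); split.
- move=> y; rewrite mem_cat mem_nseq => /orP[/andP[_ /eqP->]|/vT//].
  exact: map_f.
- rewrite size_cat size_nseq /=; have := count_size (pred1 t) w; rewrite -/a.
  by move: (a) (size w) (size v) sv; nia.
- rewrite /= wv (negPf xt) /= add0n gprod_cat gprod_nseq.
  have cc := cT _ xT; have := commutator_eq x t.
  move: (commutator x t) cc => c cc xtc.
  have xta : x * t ^+ a = c ^+ a * (t ^+ a * x).
    elim: (a) => [|b IHb]; first by rewrite mulg1 !mul1g.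
    rewrite !expgS mulgA xtc -mulgA -(mulgA t x) IHb !mulgA; congr (_ * _ * _).
    by rewrite -!mulgA -(centralX b cc).
  rewrite !mulgA xta -!mulgA (centralX a cc) -!mulgA; congr (_ * (_ * (_ * _))).
  by rewrite (centralX a cc).
Qed.

(** Induction on the list of letters: collect the first letter t, and cover
separately the power of t, the word in the other letters, and the word of
length at most k ^ 2 in the central commutators. *)
Lemma class2_words_cover (T : seq G) :
  (forall a b, a \in T -> b \in T -> central (commutator a b)) ->
  exists p, forall k, exists2 L : seq G, (size L <= k.+1 ^ p)%N &
    forall w, {subset w <= T} -> (size w <= k)%N -> gprod w \in L.
Proof.
elim: T => [|t T IH] cT.
  exists 0 => k; exists [:: 1] => // -[|x w] wT _; first exact: mem_head.
  by have := wT x (mem_head _ _).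
have [a b aT bT|p IHp] := IH; first by apply: cT; rewrite in_cons ?aT ?bT orbT.
exists (1 + p + 2 * size T)%N => k.
have [L sL LP] := IHp k.
have cC c : c \in [seq commutator s t | s <- T] -> central c.
  by move=> /mapP[s sT ->]; apply: cT; rewrite ?mem_head// in_cons sT orbT.
have [Z sZ ZP] := central_words_cover (k ^ 2)%N cC.
exists [seq u * z | u <- [seq t ^+ a * y | a <- iota 0 k.+1, y <- L], z <- Z].
  rewrite !size_allpairs size_iota (expnD _ (1 + p)) (expnD _ 1) expn1.
  apply: leq_mul; first by apply: leq_mul.
  rewrite (leq_trans sZ)// size_map expnM leq_expr//.
  by rewrite -[X in (_ <= X ^ 2)%N]addn1 sqrnD; nia.
move=> w wT wk.
have [v [vT sv ->]] := collect_letter (fun s sT => cT _ _ (mem_behead (s := t :: T) sT) (mem_head _ _)) wT.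
apply: allpairs_f; last first.
  by apply: ZP => //; rewrite (leq_trans sv)// leq_exp2r.
apply: allpairs_f.
  by rewrite mem_iota /= add0n ltnS (leq_trans (count_size _ _)).
apply: LP => [x|]; last by rewrite size_filter (leq_trans (count_size _ _)).
by rewrite mem_filter => /andP[xc /wT]; rewrite in_cons (negPf xc).
Qed.

Fixpoint ball (T : seq G) (k : nat) : seq G :=
  if k is k'.+1 then undup ([seq t * x | t <- T, x <- ball T k'] ++ ball T k')
  else [:: 1].

Lemma ball_uniq T k : uniq (ball T k).
Proof. by case: k => //= k; apply: undup_uniq. Qed.

Lemma ballP T k x : reflect
  (exists w, [/\ {subset w <= T}, (size w <= k)%N & x = gprod w]) (x \in ball T k).
Proof.
elim: k x => [|k IH] x.
  apply: (iffP idP) => [/[!inE]/eqP->|[[|y w] [_ //= _ ->]]]; first by exists [::].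
  exact: mem_head.
rewrite /= mem_undup mem_cat; apply: (iffP orP).
  case=> [/allpairsP[[t y] [tT /IH[w [wT wk yw]] ->]]|/IH[w [wT wk ->]]].
    exists (t :: w); split=> //; last by move: yw => /= ->.
    by move=> z; rewrite in_cons => /predU1P[->//|/wT].
  by exists w; split=> //; apply: leqW.
move=> [[|t w] [wT wk ->]].
  by right; apply/IH; exists [::].
left; apply: allpairs_f; first by apply: wT; apply: mem_head.
by apply/IH; exists w; split=> // y yw; apply: wT; rewrite in_cons yw orbT.
Qed.

(** The Folner set is a ball of a radius k at which the growth over the next m
steps is small: multiplication by a word of length at most m sends the ball of
radius k injectively into the ball of radius k + m. *)
Lemma folner (T : seq G) (m n : nat) :
  (forall a b, a \in T -> b \in T -> central (commutator a b)) -> (0 < n)%N ->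
  exists F : seq G, [/\ uniq F, (0 < size F)%N,
    forall x, x \in F -> exists2 w, {subset w <= T} & x = gprod w &
    forall w, {subset w <= T} -> (size w <= m)%N ->
      (n * count (fun x => (gprod w * x)%g \notin F) F <= size F)%N].
Proof.
move=> cT n0; have [p pP] := class2_words_cover cT.
have [k|k kP] := @poly_growth_almost_stable (fun k => size (ball T k)) p n m _ n0.
  apply/andP; split.
    have : 1 \in ball T k by apply/ballP; exists [::].
    by case: (ball T k).
  have [L sL LP] := pP k; apply: leq_trans sL; apply: uniq_leq_size.
    exact: ball_uniq.
  by move=> x /ballP[w [wT wk ->]]; apply: LP.
exists (ball T k); split; first exact: ball_uniq.
- have : 1 \in ball T k by apply/ballP; exists [::].
  by case: (ball T k).
- by move=> x /ballP[w [wT _ ->]]; exists w.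
move=> w wT wm; set A := [seq x <- ball T k | gprod w * x \notin ball T k].
have sub : (size A + size (ball T k) <= size (ball T (k + m)))%N.
  rewrite -(size_map [eta *%g (gprod w)] A) -size_cat; apply: uniq_leq_size.
    rewrite cat_uniq ball_uniq andbT map_inj_uniq; last exact: mulgI.
    rewrite filter_uniq ?ball_uniq//=; apply/hasPn => x xB; apply/negP.
    by move=> /mapP[y]; rewrite mem_filter => /andP[/negP yB _] xy; apply: yB; rewrite -xy.
  move=> x; rewrite mem_cat => /orP[/mapP[y]|].
    rewrite mem_filter => /andP[_ /ballP[v [vT vk ->]]] ->; apply/ballP.
    exists (w ++ v); split; last by rewrite gprod_cat.
      by move=> z; rewrite mem_cat => /orP[/wT|/vT].
    by rewrite size_cat addnC leq_add.
  move=> /ballP[v [vT vk ->]]; apply/ballP; exists v; split=> //.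
  exact: (leq_trans vk (leq_addr _ _)).
rewrite -size_filter -/A -(leq_add2r (n * size (ball T k))) -mulnDr.
by rewrite -mulSn (leq_trans _ kP)// leq_mul2l sub orbT.
Qed.

End Folner.

(** * Invariant means *)

Section FiniteNet.
Variable T : eqType.

(** The filter of tails of the directed set of pairs (finite set, precision). *)
Definition fin_net : set_system (seq T * nat) :=
  filter_from setT (fun a : seq T * nat => [set b : seq T * nat | {subset a.1 <= b.1} /\ (a.2 <= b.2)%N]).

#[global] Instance fin_net_proper : ProperFilter fin_net.
Proof.
apply: filter_from_proper; last by move=> a _; exists a; split.
apply: filter_fromT_filter; first by exists ([::], 0%N).
move=> a b; exists (a.1 ++ b.1, maxn a.2 b.2) => c /= [sub le]; split; split.
- by move=> x xa; apply: sub; rewrite /= mem_cat xa.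
- exact: leq_trans (leq_maxl _ _) le.
- by move=> x xb; apply: sub; rewrite /= mem_cat xb orbT.
- exact: leq_trans (leq_maxr _ _) le.
Qed.

Lemma fin_net_near (x : T) n (A : set (seq T * nat)) :
  (forall s k, x \in s -> (n <= k)%N -> A (s, k)) -> fin_net A.
Proof.
move=> h; exists ([:: x], n) => // -[s k] /= [sub nk]; apply: h => //.
by apply: sub; apply: mem_head.
Qed.

End FiniteNet.

Section Means.
Local Open Scope ring_scope.
Variable R : realType.

Lemma bounded_funP T (f : T -> R) :
  bounded_fun f <-> exists M, forall x, `|f x| <= M.
Proof.
split=> [[M [_ h]]|[M h]].
  by exists (M + 1) => x; apply: (h (M + 1)) => //; rewrite ltrDl.
by exists M; split=> [|N MN x _ /=]; [exact: num_real|exact: le_trans (h x) (ltW MN)].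
Qed.

Lemma bounded_fun_lin T (a : R) (f g : T -> R) :
  bounded_fun f -> bounded_fun g -> bounded_fun (fun x => a * f x + g x).
Proof.
move=> /bounded_funP[M h] /bounded_funP[M' h'].
apply/bounded_funP; exists (`|a| * M + M') => x.
by rewrite (le_trans (ler_normD _ _))// lerD// normrM ler_wpM2l.
Qed.

Lemma bounded_fun_cst T (a : R) : bounded_fun (fun _ : T => a).
Proof. by apply/bounded_funP; exists `|a|. Qed.

(** The image of the ultrafilter is an ultrafilter on a compact segment. *)
Lemma ultra_bounded_cvg J (U : set_system J) (u : J -> R) :
  UltraFilter U -> bounded_fun u -> cvg (u @ U).
Proof.
move=> UU /bounded_funP[M h].
have FU : UltraFilter (u @ U).
  apply: Build_UltraFilter => G GG sub; apply/seteqP; split=> // A GA.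
  have [//|nA] := in_ultra_setVsetC (u @^-1` A) UU.
  have GnA : G (~` A) by apply: sub.
  case: (filter_not_empty G); rewrite -(setICr A).
  exact: (@filterI _ G _ _ _ GA GnA).
have := @segment_compact R (- M) M; rewrite compact_ultra => /(_ _ FU)[].
  by apply: (@filterE _ U) => j /=; rewrite in_itv /= -ler_norml; exact: h.
by move=> p [_ up]; apply/cvg_ex; exists p.
Qed.

Variable G : groupType.

Definition is_mean (m : (G -> R) -> R) : Prop :=
  [/\ forall (a : R) (f g : G -> R), bounded_fun f -> bounded_fun g ->
        m (fun x => a * f x + g x) = a * m f + m g,
      forall f : G -> R, bounded_fun f -> (forall x, 0 <= f x) -> 0 <= m f
    & m (fun=> 1) = 1].

Lemma mean_cst m (a : R) : is_mean m -> m (fun=> a) = a.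
Proof.
case=> lin _ m1; have m0 : m (fun=> 0) = 0.
  have := lin 1 (fun=> 0) (fun=> 0) (bounded_fun_cst _ _) (bounded_fun_cst _ _).
  rewrite (_ : (fun=> _) = (fun=> 0)) ?mul1r; last by apply/funext => x; rewrite ?mulr0 addr0.
  by move=> /(congr1 (fun y => y - m (fun=> 0))); rewrite addrK subrr.
have -> : (fun=> a) = (fun _ : G => a * 1 + 0).
  by apply/funext => x; rewrite mulr1 addr0.
by rewrite lin ?m1 ?m0 ?mulr1 ?addr0//; exact: bounded_fun_cst.
Qed.

Lemma mean_le m f M : is_mean m -> (forall x, `|f x| <= M) -> `|m f| <= M.
Proof.
move=> mm fM; have [lin pos _] := mm.
have bf : bounded_fun f by apply/bounded_funP; exists M.
rewrite ler_norml; apply/andP; split.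
  rewrite -subr_ge0 opprK -(mean_cst M mm) -(mul1r (m f)) -lin//; last exact: bounded_fun_cst.
  apply: pos; first by apply: bounded_fun_lin => //; exact: bounded_fun_cst.
  by move=> x; have := fM x; rewrite ler_norml mul1r => /andP[+ _]; lra.
rewrite -subr_ge0 -(mean_cst M mm) -mulN1r addrC -lin//; last exact: bounded_fun_cst.
apply: pos; first by apply: bounded_fun_lin => //; exact: bounded_fun_cst.
by move=> x; have := fM x; rewrite ler_norml mulN1r => /andP[_]; lra.
Qed.

Definition mean_invariant (m : (G -> R) -> R) (g : G) : Prop :=
  forall f : G -> R, bounded_fun f -> m (fun x => f (g^-1 * x)%g) = m f.

(** The limit of approximately invariant means along an ultrafilter finer than
the filter of finite sets and precisions is exactly invariant. *)
Lemma mean_of_approximate (Q : set G) :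
  (forall (s : seq G) (n : nat), (forall g, g \in s -> Q g) ->
    exists2 m, is_mean m & forall g f (M : R), g \in s -> (forall x, `|f x| <= M) ->
      `|m (fun x => f (g^-1 * x)%g) - m f| <= M / n.+1%:R) ->
  exists2 m, is_mean m & forall g, Q g -> mean_invariant m g.
Proof.
move=> appr.
have /choice[mn mnP] : forall sn : seq G * nat, exists m : (G -> R) -> R,
    is_mean m /\ forall g f (M : R), g \in sn.1 -> Q g -> (forall x, `|f x| <= M) ->
      `|m (fun x => f (g^-1 * x)%g) - m f| <= M / sn.2.+1%:R.
  move=> [s n].
  have [g|m mm h] := appr [seq g <- s | `[< Q g >]] n.
    by rewrite mem_filter => /andP[/asboolP].
  exists m; split=> // g f M gs Qg fM; apply: h => //.
  by rewrite mem_filter gs andbT; apply/asboolP.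
have [U [UU FU]] := ultraFilterLemma (fin_net_proper G).
have mean sn : is_mean (mn sn) by case: (mnP sn).
have bnd f : bounded_fun f -> bounded_fun (fun sn => mn sn f).
  by move=> /bounded_funP[M fM]; apply/bounded_funP; exists M => sn; apply: mean_le.
have cv f : bounded_fun f -> cvg ((fun sn => mn sn f) @ U).
  by move=> bf; apply: ultra_bounded_cvg => //; exact: bnd.
exists (fun f => lim ((fun sn => mn sn f) @ U)).
  split=> [a f g bf bg|f bf f0|].
  - rewrite (_ : (fun sn => _) = (fun sn => a * mn sn f + mn sn g)); last first.
      by apply/funext => sn; case: (mean sn) => ->.
    apply: cvg_lim => //; apply: cvgD; last exact: cv.
    by apply: cvgM; [exact: cvg_cst|exact: cv].
  - apply: limr_ge; first exact: cv.
    by apply: filterE => sn; case: (mean sn) => _ + _; exact.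
  - rewrite (_ : (fun sn => _) = (fun=> 1)); first exact: lim_cst.
    by apply/funext => sn; case: (mean sn).
move=> g Qg f bf; have /bounded_funP[M fM] := bf.
have M0 : 0 <= M by rewrite (le_trans _ (fM 1%g)).
have bg : bounded_fun (fun x => f (g^-1 * x)%g) by apply/bounded_funP; exists M.
apply/eqP; rewrite -subr_eq0 -normr_le0; apply/ler_addgt0Pr => e e0; rewrite add0r.
have cd : `|mn sn (fun x => f (g^-1 * x)%g) - mn sn f| @[sn --> U] -->
    `|lim (mn sn (fun x => f (g^-1 * x)%g) @[sn --> U]) - lim (mn sn f @[sn --> U])|.
  by apply: cvg_norm; apply: cvgB; exact: cv.
rewrite -(cvg_lim _ cd)//; apply: limr_le; first by apply/cvg_ex; eexists; exact: cd.
apply: FU; apply: (@fin_net_near _ g (Num.truncn (M / e))) => s k gs nk.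
have [_ /(_ g f M gs Qg fM)] := mnP (s, k).
move=> /le_trans; apply; rewrite /= ler_pdivrMr ?ltr0n// mulrC -ler_pdivrMr//.
rewrite (le_trans (ltW (truncnS_gt _)))// ler_nat ltnS//.
Qed.

(** The two sums share the terms whose arguments lie in F and in its translate;
as many terms remain on either side as there are points of F leaving F. *)
Lemma folner_sum (F : seq G) (u : G) (f : G -> R) (M : R) : uniq F ->
  (forall x, `|f x| <= M) ->
  `|\sum_(x <- F) f (u * x)%g - \sum_(x <- F) f x| <=
    2 * M * (count (fun x => (u * x)%g \notin F) F)%:R.
Proof.
move=> uF fM; set A := [seq (u * x)%g | x <- F & (u * x)%g \in F].
have uA : uniq A by rewrite map_inj_uniq ?filter_uniq//; exact: mulgI.
have AF x : x \in A -> x \in F.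
  by move=> /mapP[y]; rewrite mem_filter => /andP[+ _] ->.
have pF : perm_eq F (A ++ [seq x <- F | x \notin A]).
  apply: uniq_perm => //; first rewrite cat_uniq uA filter_uniq// andbT /=.
    by apply/hasPn => x; rewrite mem_filter => /andP[].
  move=> x; rewrite mem_cat mem_filter; case: (boolP (x \in A)) => //= /AF ->//.
set c := count _ F.
have szA : (size A + c = size F)%N.
  by rewrite size_map size_filter -(count_predC (fun x => (u * x)%g \in F)).
have szC : size [seq x <- F | x \notin A] = c.
  by have /perm_size := pF; rewrite size_cat -szA => /addnI.
rewrite [X in _ - X](perm_big _ pF) /= [X in _ - X]big_cat /= big_map.
rewrite [X in X - _](bigID (fun x => (u * x)%g \in F)) /=.
rewrite -[X in X + _ - _]big_filter -[X in _ + X - _]big_filter.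
set S := \sum_(i <- _) _; set S1 := \sum_(i <- _) _; set S2 := \sum_(i <- _) _.
rewrite (_ : _ - _ = S1 - S2); last by rewrite opprD addrACA subrr add0r.
have sumle (s : seq G) (h : G -> R) : (forall x, `|h x| <= M) -> `|\sum_(x <- s) h x| <= M * (size s)%:R.
  move=> hM; elim: s => [|x s IH]; first by rewrite big_nil normr0 mulr0.
  rewrite big_cons (le_trans (ler_normD _ _))//= -natr1 mulrDr mulr1 addrC.
  exact: lerD.
rewrite (le_trans (ler_normB _ _))// -mulrA mulr_natl mulr2n lerD//.
  by rewrite (le_trans (sumle _ _ _))// size_filter.
by rewrite (le_trans (sumle _ _ _))// szC.
Qed.

End Means.

(** * Amenability of the product *)

Section AmenableProduct.
Local Open Scope ring_scope.
Variable R : realType.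

(** Elements of the center commute, so [folner] applies to every finite set of
them. *)
Lemma center_mean (G : groupType) :
  exists2 m : (G -> R) -> R, is_mean m &
    forall z, central z -> mean_invariant m z.
Proof.
apply: mean_of_approximate => s n sQ.
have [a b|F [uF F0 FP FT]] := @folner G [seq g^-1%g | g <- s] 1 (2 * n.+1) _ isT.
  move=> /mapP[x xs ->] /mapP[y ys ->]; rewrite (_ : commutator _ _ = 1%g).
    exact: central1.
  by apply/commutator_eq1; apply: (centralV (sQ _ xs)).
have sF : (size F)%:R != 0 :> R by rewrite pnatr_eq0 -lt0n.
exists (fun f => (size F)%:R^-1 * \sum_(x <- F) f x).
  split=> [a f g _ _|f _ f0|].
  - by rewrite big_split /= -mulr_sumr mulrDr mulrCA.
  - by rewrite mulr_ge0 ?invr_ge0// sumr_ge0.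
  - rewrite (_ : \sum_(x <- F) 1 = (size F)%:R) ?mulVf//.
    elim: (F) => [|x F' IH]; first by rewrite big_nil.
    by rewrite big_cons IH /= -natr1 addrC.
move=> g f M gs fM; have M0 : 0 <= M by rewrite (le_trans _ (fM 1%g)).
have gF : (2 * n.+1 * count (fun x => (g^-1 * x)%g \notin F) F <= size F)%N.
  have := FT [:: g^-1%g]; rewrite /= mulg1; apply=> //.
  by move=> x /[!inE]/eqP->; apply: map_f.
rewrite -mulrBr normrM ger0_norm ?invr_ge0// mulrC ler_pdivrMr ?ltr0n//.
rewrite (le_trans (folner_sum _ uF fM))// [leRHS]mulrAC ler_pdivlMr ?ltr0n//.
rewrite [leLHS](_ : _ = M * (2 * n.+1 * count (fun x => (g^-1 * x)%g \notin F) F)%:R).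
  by rewrite ler_wpM2l// ler_nat.
by rewrite !natrM; ring.
Qed.

Variables (I : choiceType) (H : I -> groupType).
Hypothesis amH : forall i, amenable R (H i).
Notation P := (second_nilpotent_product H).

Let mH i := projT1 (cid (amH i)).
Arguments mH : clear implicits.

Let mH_mean i : is_mean (mH i).
Proof. by rewrite /mH; case: cid => m []. Qed.

Let mH_inv i (h : H i) : mean_invariant (mH i) h.
Proof. by rewrite /mH; case: cid => m [] /= _ _ _; apply. Qed.

(** Averages are taken over right translates, so that they commute with left
translations, and the invariance they produce is invariance on the right. *)
Definition right_fixed (F : P -> R) (k : P) : Prop := forall x, F (x * k)%g = F x.

Definition factor_average i (F : P -> R) : P -> R :=
  fun x => mH i (fun h => F (x * factor h)%g).

Lemma factor_average_le i F (M : R) :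
  (forall x, `|F x| <= M) -> forall x, `|factor_average i F x| <= M.
Proof. by move=> FM x; apply: mean_le. Qed.

Lemma factor_average_central i F z : central z -> right_fixed F z ->
  right_fixed (factor_average i F) z.
Proof.
move=> cz Fz x; rewrite /factor_average; congr (mH _ _); apply/funext => h.
by rewrite -mulgA cz mulgA Fz.
Qed.

(** For j = i this is the invariance of the mean of H_i.  For j <> i the element k
is exchanged with the averaging variable at the cost of a central element,
which F does not see. *)
Lemma factor_average_factor i j (F : P -> R) (k : H j) : bounded_fun F ->
  (forall z, central z -> right_fixed F z) ->
  (j != i -> right_fixed F (factor k)) ->
  right_fixed (factor_average i F) (factor k).
Proof.
move=> /bounded_funP[M FM] Fz Fk x; rewrite /factor_average.
case: (eqVneq j i) => [e|ji].
  case: _ / e (FM) => _.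
  rewrite -(@mH_inv j k^-1%g (fun h => F (x * factor h)%g)); last first.
    by apply/bounded_funP; exists M.
  by congr (mH _ _); apply/funext => h; rewrite invgK factorM mulgA.
congr (mH _ _); apply/funext => h; have kh := commutator_eq (factor k) (factor h).
have := commutator_factor_central k h (elimN eqP ji).
move: (commutator _ _) kh => c kh cc.
have -> : (x * factor k * factor h = x * factor h * factor k * c)%g.
  by rewrite -mulgA kh cc !mulgA.
by rewrite Fz// Fk.
Qed.

Definition average_over (J : seq I) (F : P -> R) : P -> R :=
  foldr factor_average F J.

Lemma average_over_bounded J (F : P -> R) : bounded_fun F -> bounded_fun (average_over J F).
Proof.
move=> /bounded_funP[M FM]; apply/bounded_funP; exists M.
by elim: J => //= i J; apply: factor_average_le.
Qed.

Lemma average_over_fixed J (F : P -> R) : bounded_fun F ->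
  (forall z, central z -> right_fixed F z) ->
  (forall z, central z -> right_fixed (average_over J F) z) /\
  (forall j (k : H j), j \in J -> right_fixed (average_over J F) (factor k)).
Proof.
move=> bF Fz; elim: J => [|i J [IHz IHk]] //; split=> [z cz|j k].
  by apply: factor_average_central => //; apply: IHz.
rewrite in_cons => jJ; apply: factor_average_factor => //.
  exact: average_over_bounded.
by move=> ji; apply: IHk; move: jJ; rewrite (negPf ji).
Qed.

Lemma average_over_lin J (a : R) (F F' : P -> R) : bounded_fun F -> bounded_fun F' ->
  average_over J (fun x => a * F x + F' x) =
  (fun x => a * average_over J F x + average_over J F' x).
Proof.
move=> bF bF'; elim: J => //= i J ->; apply/funext => x; rewrite /factor_average.
have bc (F0 : P -> R) : bounded_fun F0 -> bounded_fun (fun h : H i => average_over J F0 (x * factor h)%g).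
  move=> /(average_over_bounded J)/bounded_funP[M h].
  by apply/bounded_funP; exists M.
by case: (mH_mean i) => lin _ _; rewrite -lin//; apply: bc.
Qed.

Lemma average_over_ge0 J (F : P -> R) : bounded_fun F -> (forall x, 0 <= F x) ->
  forall x, 0 <= average_over J F x.
Proof.
move=> bF F0; elim: J => //= i J IH x; case: (mH_mean i) => _ pos _; apply: pos => //.
have /bounded_funP[M h] := average_over_bounded J bF.
by apply/bounded_funP; exists M.
Qed.

Lemma average_over_cst J (a : R) : average_over J (fun=> a) = (fun=> a).
Proof.
by elim: J => //= i J ->; apply/funext => x; rewrite /factor_average mean_cst.
Qed.

Lemma average_over_translate J F g :
  average_over J (fun x => F (g * x)%g) = (fun x => average_over J F (g * x)%g).
Proof.
elim: J => //= i J ->; apply/funext => x; rewrite /factor_average; congr mH.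
by apply/funext => h; rewrite mulgA.
Qed.

(** After averaging over the center and the factors occurring in words for the
given finite set s, the function is right-invariant under these factors, so its
values at 1 and at the inverses of the elements of s agree.  The functional
evaluating the average at 1 is thus a mean invariant under s. *)
Theorem amenable_second_nilpotent_product : amenable R P.
Proof.
have [mD [linD posD oneD] invD] := center_mean P.
have mDm : is_mean mD by split.
pose A (f : P -> R) x := mD (fun z => f (x * z)%g).
have bA (f : P -> R) : bounded_fun f -> bounded_fun (A f).
  by move=> /bounded_funP[M fM]; apply/bounded_funP; exists M => x; apply: mean_le.
have bt (f : P -> R) x : bounded_fun f -> bounded_fun (fun z => f (x * z)%g).
  by move=> /bounded_funP[M fM]; apply/bounded_funP; exists M.
have Az (f : P -> R) z : bounded_fun f -> central z -> right_fixed (A f) z.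
  move=> bf cz x; rewrite /A -(invD z^-1%g (centralV cz) (fun y => f (x * y)%g)).
    by congr mD; apply/funext => y; rewrite invgK mulgA.
  exact: bt.
have [m [lin pos one] inv] : exists2 m : (P -> R) -> R, is_mean m &
    forall g, [set: P] g -> mean_invariant m g.
  apply: mean_of_approximate => s n _.
  have [J JP] : exists J : seq I, forall g, g \in s ->
      exists2 w, g^-1%g = word_val w & {subset [seq tag l | l <- w] <= J}.
    elim: s => [|g s [J JP]]; first by exists [::].
    have [w wP] := word_val_surj g^-1%g; exists ([seq tag l | l <- w] ++ J) => x.
    rewrite in_cons => /predU1P[->|/JP[v vP vJ]].
      by exists w => // i iw; rewrite mem_cat iw.
    by exists v => // i /vJ iJ; rewrite mem_cat iJ orbT.
  exists (fun f => average_over J (A f) 1%g).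
    split=> [a f g bf bg|f bf f0|].
    - rewrite (_ : A _ = (fun x => a * A f x + A g x)).
        by rewrite average_over_lin//; apply: bA.
      by apply/funext => x; rewrite /A linD//; apply: bt.
    - apply: average_over_ge0 => [|x]; first exact: bA.
      by apply: posD => //; apply: bt.
    - rewrite (_ : A _ = fun=> 1) ?average_over_cst//.
      by apply/funext => x.
  move=> g f M gs fM; have M0 : 0 <= M by rewrite (le_trans _ (fM 1%g)).
  rewrite (_ : _ - _ = 0) ?normr0 ?divr_ge0//; apply/eqP; rewrite subr_eq0; apply/eqP.
  have bf : bounded_fun f by apply/bounded_funP; exists M.
  rewrite (_ : A _ = (fun x => A f (g^-1 * x)%g)); last first.
    by apply/funext => x; rewrite /A; congr mD; apply/funext => z; rewrite mulgA.
  rewrite average_over_translate mulg1.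
  have [w -> wJ] := JP _ gs; rewrite -[word_val w]mul1g; move: 1%g => x.
  have [_ fixk] := average_over_fixed J (bA _ bf) (fun z => Az f z bf).
  elim: w wJ x => [|[i h] w IH] wJ x; first by rewrite mulg1.
  rewrite word_val_cons mulgA IH; last by move=> j jw; apply: wJ; rewrite in_cons jw orbT.
  by apply: fixk; apply: wJ; apply: mem_head.
by exists m; split=> // g f bf; apply: inv.
Qed.

End AmenableProduct.

(** * Positive semidefinite kernels *)

Section PositiveSemidefinite.
Local Open Scope ring_scope.
Variable R : realType.
Notation C := R[i].

Lemma normc_ge0 (z : C) : 0 <= normc z.
Proof. by case: z => a b; apply: sqrtr_ge0. Qed.

Lemma conjcE (z : C) : z^*%C = z^*.
Proof. by []. Qed.

Lemma normc_zero : normc (0 : C) = 0.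
Proof. exact: normc0. Qed.

Lemma normc_one : normc (1 : C) = 1.
Proof. exact: normc1. Qed.

Lemma conjC_real (a : R) : (a%:C%C : C)^* = a%:C%C.
Proof. exact: conjc_real. Qed.

Lemma conj_mul_ge0 (z : C) : 0 <= z^* * z.
Proof. by rewrite mulrC mul_conjC_ge0. Qed.

Lemma conj_mul (z : C) : z^* * z = (normc z ^+ 2)%:C%C.
Proof. by rewrite mulrC -conjcE -sqr_normc rmorphXn. Qed.

Lemma normc_conj (z : C) : normc z^* = normc z.
Proof. by apply: complexI; exact: (normcJ z). Qed.

Lemma normc_sum I (r : seq I) (F : I -> C) :
  normc (\sum_(i <- r) F i) <= \sum_(i <- r) normc (F i).
Proof.
elim: r => [|i r IH]; first by rewrite !big_nil normc_zero.
by rewrite !big_cons (le_trans (le_normcD _ _))// lerD2l.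
Qed.

Lemma normc_real (a : R) : normc (a%:C%C) = `|a|.
Proof. by rewrite /normc /= expr0n addr0 sqrtr_sqr. Qed.

Definition psd n (w : 'I_n -> 'I_n -> C) : Prop :=
  forall c : 'I_n -> C, 0 <= \sum_i \sum_j (c i)^* * c j * w i j.

Lemma psd_rank1 n (v : 'I_n -> C) : psd (fun i j => (v i)^* * v j).
Proof.
move=> c; rewrite (_ : \sum_i _ = (\sum_i c i * v i)^* * (\sum_i c i * v i)).
  exact: conj_mul_ge0.
rewrite rmorph_sum /= mulr_suml; apply: eq_bigr => i _.
by rewrite mulr_sumr; apply: eq_bigr => j _; rewrite rmorphM /=; ring.
Qed.

Lemma psd_sum n (K : Type) (s : seq K) (w : K -> 'I_n -> 'I_n -> C) :
  (forall k, psd (w k)) -> psd (fun i j => \sum_(k <- s) w k i j).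
Proof.
move=> pw c; rewrite (_ : \sum_i _ = \sum_(k <- s) \sum_i \sum_j (c i)^* * c j * w k i j).
  by apply: sumr_ge0 => k _; apply: pw.
rewrite [RHS]exchange_big /=; apply: eq_bigr => i _.
rewrite [RHS]exchange_big /=; apply: eq_bigr => j _.
by rewrite mulr_sumr.
Qed.

Lemma psd_scale n (a : C) (w : 'I_n -> 'I_n -> C) : 0 <= a -> psd w ->
  psd (fun i j => a * w i j).
Proof.
move=> a0 pw c; rewrite (_ : \sum_i _ = a * \sum_i \sum_j (c i)^* * c j * w i j).
  by rewrite mulr_ge0// pw.
rewrite mulr_sumr; apply: eq_bigr => i _.
by rewrite mulr_sumr; apply: eq_bigr => j _; ring.
Qed.

(** Polarization: the values of the form at the combinations of two basis vectors
with coefficients (1, 0), (0, 1), (1, 1) and (1, i) are real. *)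
Lemma psd_hermitian n (w : 'I_n -> 'I_n -> C) i j : psd w -> w i j = (w j i)^*.
Proof.
move=> pw.
have two (a b : C) : 0 <= a^* * a * w i i + a^* * b * w i j + b^* * a * w j i + b^* * b * w j j.
  pose c k := (if k == i then a else 0) + (if k == j then b else 0).
  have := pw c; congr (0 <= _).
  have lin (f : 'I_n -> C) : \sum_k c k * f k = a * f i + b * f j.
    rewrite (eq_bigr (fun k => (if k == i then a * f k else 0) + (if k == j then b * f k else 0))).
      by rewrite big_split /= -!big_mkcond !big_pred1_eq.
    by move=> k _; rewrite /c; do 2!case: ifP => _; rewrite ?mul0r ?add0r ?addr0 ?mulrDl ?mul0r ?addr0.
  have lin' (f : 'I_n -> C) : \sum_k (c k)^* * f k = a^* * f i + b^* * f j.
    rewrite (eq_bigr (fun k => (if k == i then a^* * f k else 0) + (if k == j then b^* * f k else 0))).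
      by rewrite big_split /= -!big_mkcond !big_pred1_eq.
    by move=> k _; rewrite /c; do 2!case: ifP => _;
       rewrite ?(addr0, add0r) ?conjC0 ?rmorphD/= ?mulrDl ?mul0r ?addr0.
  rewrite (eq_bigr (fun k => (c k)^* * (a * w k i + b * w k j))); last first.
    by move=> k _; rewrite -lin mulr_sumr; apply: eq_bigr => l _; ring.
  by rewrite lin'; ring.
have := ger0_Im (two 1 0); have := ger0_Im (two 0 1).
have := ger0_Im (two 1 1); have := ger0_Im (two 1 'i%C).
case: (w i j) (w j i) (w i i) (w j j) => a b [a' b'] [a1 b1] [a2 b2] /=.
move=> h1 h2 h3 h4; apply/eqP; rewrite eq_complex /=; apply/andP.
by split; apply/eqP; lra.
Qed.

(** Diagonalize w by a unitary matrix; the eigenvalues are nonnegative, and their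
square roots rescale the eigenvectors to Gram vectors. *)
Lemma psd_gram n (w : 'I_n -> 'I_n -> C) : psd w ->
  exists v : 'I_n -> 'I_n -> C, forall i j, w i j = \sum_k (v k i)^* * v k j.
Proof.
move=> pw; pose A : 'M[C]_n := \matrix_(i, j) w i j.
have AA : (map_mx Num.conj A^T) = A.
  by apply/matrixP => i j; rewrite !mxE -psd_hermitian.
have /spectral.orthomx_spectralP : A \is spectral.normalmx.
  by apply/spectral.normalmxP; rewrite AA.
set U := spectral.spectralmx A; set D := spectral.spectral_diag A => AE.
have unU : U \is spectral.unitarymx by exact: spectral.spectral_unitarymx.
rewrite (spectral.invmx_unitary unU) in AE.
have D0 k : 0 <= D 0 k.
  have -> : D 0 k = (U *m A *m (map_mx Num.conj U^T)) k k.
    have UU := spectral.unitarymxP unU.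
    rewrite AE !mulmxA UU mul1mx -mulmxA UU mulmx1.
    by rewrite mxE eqxx mulr1n.
  rewrite !mxE (eq_bigr (fun j => \sum_i U k i * w i j * (U k j)^*)); last first.
    move=> j _; rewrite !mxE mulr_suml; apply: eq_bigr => i _.
    by rewrite !mxE.
  rewrite exchange_big /=; have := pw (fun i => (U k i)^*).
  congr (0 <= _); apply: eq_bigr => i _; apply: eq_bigr => j _.
  by rewrite conjCK; ring.
exists (fun k j => sqrtC (D 0 k) * U k j) => i j.
have -> : w i j = A i j by rewrite mxE.
rewrite [in LHS]AE mxE; apply: eq_bigr => k _; rewrite mul_mx_diag !mxE.
rewrite rmorphM /=.
have : (sqrtC (D 0 k))^* * sqrtC (D 0 k) = D 0 k.
  rewrite mulrC -normCK ger0_norm ?sqrtC_ge0//.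
  by rewrite sqrtCK.
by move=> {1}<-; ring.
Qed.

(** By [psd_gram] the first factor is a sum of kernels of rank one, and the
entrywise product with a kernel of rank one only rescales the coefficients. *)
Lemma psd_schur n (w1 w2 : 'I_n -> 'I_n -> C) : psd w1 -> psd w2 ->
  psd (fun i j => w1 i j * w2 i j).
Proof.
move=> /psd_gram[v vP] p2.
rewrite (_ : (fun i j => _) = (fun i j => \sum_(k <- index_enum _) (v k i)^* * v k j * w2 i j)).
  apply: psd_sum => k c; have := p2 (fun i => c i * v k i).
  congr (0 <= _); apply: eq_bigr => i _; apply: eq_bigr => j _.
  by rewrite rmorphM /=; ring.
by apply/funext => i; apply/funext => j; rewrite vP mulr_suml.
Qed.

(** The kernel is the sum of the squares of the indicators of the classes; a class
is represented by its least index. *)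
Lemma psd_same_class n Z (r : 'I_n -> Z) :
  psd (fun i j => if `[<r i = r j>] then 1 else 0).
Proof.
pose e i j : C := if `[<r i = r j>] then 1 else 0.
pose first (k : 'I_n) := [forall j : 'I_n, (j < k)%N ==> ~~ `[<r j = r k>]].
rewrite (_ : (fun i j => _) = (fun i j => \sum_(k <- index_enum _ | first k) (e k i)^* * e k j)).
  rewrite (_ : (fun i j => _) = (fun i j => \sum_(k <- [seq k <- index_enum _ | first k]) (e k i)^* * e k j)).
    by apply: psd_sum => k; apply: psd_rank1.
  by apply/funext => i; apply/funext => j; rewrite big_filter.
apply/funext => i; apply/funext => j.
have [k0 k0i k0f] : exists2 k, r k = r i & first k.
  have [k /asboolP ki kmin] := @arg_minnP _ i (fun k => `[<r k = r i>])
    (@nat_of_ord n) (introT (asboolP _) erefl).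
  exists k => //; apply/forallP => j'; apply/implyP => jk; apply/negP => /asboolP jE.
  have := kmin j'; rewrite leqNgt jk => h; have : `[<r j' = r i>] by apply/asboolP; rewrite jE.
  by move=> /h.
rewrite (bigD1 k0)//= big1 ?addr0 => [|k /andP[kf kk0]].
  rewrite /e; case: asboolP => [ij|ij]; case: asboolP => [ki|ki]; case: asboolP => [kj|kj];
    rewrite ?conjC1 ?conjC0 ?mul1r ?mul0r ?mulr1//.
  - by case: kj; rewrite k0i.
  - by case: ij; rewrite -ki.
rewrite /e; case: asboolP => [ki|ki]; last by rewrite conjC0 mul0r.
have kk : r k = r k0 by rewrite ki.
move: kk0; rewrite neq_ltn => /orP[lt|lt].
  by have /forallP/(_ k)/implyP/(_ lt)/negP[] := k0f; apply/asboolP.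
by have /forallP/(_ k0)/implyP/(_ lt)/negP[] := kf; apply/asboolP.
Qed.

End PositiveSemidefinite.

(** * Finite sets and Folner sets for the product *)

Section FolnerQuotient.
Local Open Scope group_scope.
Variables (I : choiceType) (H : I -> groupType).
Notation P := (second_nilpotent_product H).
Notation N := (quotient_ncl (@same_factor_commutators I H)).
Notation q := (quotient_pi (@same_factor_commutators I H) : P -> N).

Lemma folner_quotient (S : seq P) n : (0 < n)%N ->
  exists F : seq N, [/\ uniq F, (0 < size F)%N &
    forall g, g \in S -> (n * count (fun x => (q g * x)%g \notin F) F <= size F)%N].
Proof.
move=> n0; have [T [m TP]] : exists (T : seq (letter H)) m, forall g, g \in S ->
    exists w, [/\ g = word_val w, {subset w <= T} & (size w <= m)%N].
  elim: S => [|g S [T [m TP]]]; first by exists [::], 0%N.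
  have [w gw] := word_val_surj g; exists (w ++ T), (size w + m)%N => h.
  rewrite in_cons => /predU1P[->|/TP[v [hv vT vm]]].
    by exists w; split=> //; [move=> l lw; rewrite mem_cat lw|rewrite leq_addr].
  exists v; split=> //; first by move=> l /vT lT; rewrite mem_cat lT orbT.
  by rewrite (leq_trans vm)// leq_addl.
have [a b|F [uF F0 _ FP]] := @folner N [seq q (letter_val l) | l <- T] m n _ n0.
  by move=> /mapP[l _ ->] /mapP[l' _ ->]; apply: quotient_commutator_central.
exists F; split=> // g /TP[w [-> wT wm]].
have -> : q (word_val w) = gprod [seq q (letter_val l) | l <- w].
  elim: (w) => [|l v IH]; first by rewrite word_val_nil quotient_pi1.
  by rewrite word_val_cons [LHS]quotient_piM IH.
apply: FP; last by rewrite size_map.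
by move=> x /mapP[l /wT lT ->]; apply: map_f.
Qed.

Lemma finite_fibers (T U : Type) (f : T -> U) (B : set T) :
  finite_set (f @` B) -> (forall y, finite_set (B `&` f @^-1` [set y])) ->
  finite_set B.
Proof.
move=> fB fib.
have /sub_finite_set : B `<=` \bigcup_(y in f @` B) (B `&` f @^-1` [set y]).
  by move=> x Bx; exists (f x) => //; exists x.
by apply; apply: bigcup_finite.
Qed.

(** One coordinate in J at a time, B splits into finitely many fibers; once all
the coordinates are fixed, the quotient map is injective by
[joint_faithful]. *)
Lemma finite_in_product (J : seq I) (B : set P) :
  (forall i, i \in J -> finite_set (@proj I H i @` B)) ->
  finite_set (q @` B) ->
  (forall x y, B x -> B y -> forall i, i \notin J -> proj i x = proj i y) ->
  finite_set B.
Proof.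
elim: J B => [|i J IH] B fJ fq eqB.
  apply: finite_fibers fq _ => y.
  have [->|/set0P[x [Bx /= qx]]] := eqVneq (B `&` q @^-1` [set y]) set0.
    exact: finite_set0.
  apply: (@sub_finite_set _ _ [set x]); last exact: finite_set1.
  move=> x' [Bx' /= qx']; apply/esym; rewrite -[x']mul1g -[x in LHS](mulgVK x').
  congr (_ * _); apply: joint_faithful => [i|].
    by rewrite projM projV (eqB x x')// mulgV.
  by rewrite [LHS]quotient_piM quotient_piV qx qx' mulgV.
apply: (@finite_fibers _ _ (@proj I H i)); first by apply: fJ; apply: mem_head.
move=> y; apply: IH => [j jJ||x x' [Bx /= xy] [Bx' /= x'y] j jJ].
- apply: sub_finite_set (fJ j _); last by rewrite in_cons jJ orbT.
  by apply: image_subset => x [].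
- by apply: sub_finite_set fq; apply: image_subset => x [].
- have [->|ji] := eqVneq j i; first by rewrite xy x'y.
  by apply: eqB => //; rewrite in_cons negb_or ji.
Qed.

Lemma common_support (S : seq P) :
  exists J : seq I, forall g, g \in S -> forall i, i \notin J -> proj i g = 1.
Proof.
elim: S => [|g S [J JP]]; first by exists [::].
have [K KP] := proj_support g; exists (K ++ J) => h.
rewrite in_cons => /predU1P[->|hS] i; rewrite mem_cat negb_or => /andP[iK iJ].
  exact: KP.
exact: JP.
Qed.

End FolnerQuotient.

(** * The Haagerup property *)

Section Haagerup.
Local Open Scope ring_scope.
Variable R : realType.
Notation C := R[i].

(** The Haagerup property at a fixed finite set and precision.  The set B d is any
set containing the points at which phi is at least d: recording it, instead of
asking for finiteness, allows functions that decay in some directions only, and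
finiteness is recovered from the intersection over all the directions. *)
Definition haagerup_approx (G : groupType) (S : seq G) (e : R) (B : R -> set G) :=
  exists phi : G -> C, [/\ positive_definite phi, phi 1%g = 1,
    forall g, g \in S -> normc (phi g - 1) <= e &
    forall d g, 0 < d -> d <= normc (phi g) -> B d g].

Lemma positive_definiteP (G : groupType) (phi : G -> C) : positive_definite phi <->
  forall n (g : 'I_n -> G), psd (fun i j => phi ((g i)^-1 * g j)%g).
Proof. by split=> pd n; [move=> g c; apply: pd|move=> c g; apply: pd]. Qed.

(** Evaluate the form at the points 1, g with coefficients 1 and the opposite of
the conjugate of phi g. *)
Lemma positive_definite_le1 (G : groupType) (phi : G -> C) g :
  positive_definite phi -> phi 1%g = 1 -> normc (phi g) <= 1.
Proof.
move=> /positive_definiteP pd phi1.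
pose x (i : 'I_2) := if i == ord0 then 1%g else g.
have p := pd 2 x; have h := psd_hermitian ord0 ord_max p.
have := p (fun i => if i == ord0 then 1 else - (phi g)^*).
rewrite !big_ord_recl !big_ord0 /= /x /= invg1 !mulg1 mulVg mul1g phi1 !addr0.
rewrite /x /= invg1 mul1g mulg1 in h; rewrite -[phi g^-1%g]conjCK -h conjC1 rmorphN /= conjCK.
rewrite (_ : _ + _ = (1 - normc (phi g) ^+ 2)%:C%C); last first.
  by rewrite rmorphB /= -conj_mul; ring.
rewrite ler0c subr_ge0 -[X in _ <= X](expr1n _ 2).
by rewrite ler_pXn2r ?nnegrE ?normc_ge0.
Qed.

Lemma haagerup_approxP (G : groupType) : haagerup R G <->
  forall (S : seq G) (e : R), 0 < e -> exists2 B : R -> set G,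
    (forall d, 0 < d -> finite_set (B d)) & haagerup_approx S e B.
Proof.
split=> [[J [F [phi [PF phiP phi1]]]] S e e0|h].
  have nr : F [set j | forall g, g \in S -> normc (phi j g - 1) <= e].
    elim: S => [|g S IH]; first by apply: filterS filterT => j _ g.
    have /cvgrPdist_le/(_ (e%:C)%C) := phi1 g.
    rewrite ltcR => /(_ e0) h; apply: filterS2 IH h => j IH /= h k.
    rewrite in_cons => /predU1P[->|/IH//].
    by rewrite -normcN opprB -lecR.
  have [j jP] := filter_ex nr; have [pd p1 vi] := phiP j.
  by exists (fun d => [set g | d <= normc (phi j g)]) => //; exists (phi j); split.
have /choice[phi phiP] : forall sn : seq G * nat, exists phi : G -> C,
    [/\ positive_definite phi, phi 1%g = 1, vanishes_at_infinity phi &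
     forall g, g \in sn.1 -> normc (phi g - 1) <= sn.2.+1%:R^-1].
  move=> [s n]; have [|B fB [phi [pd p1 near van]]] := h s n.+1%:R^-1.
    by rewrite invr_gt0 ltr0n.
  exists phi; split=> // e e0; apply: sub_finite_set (fB e e0) => g /=; exact: van.
exists (seq G * nat)%type, (@fin_net G), phi; split.
- exact: fin_net_proper.
- by move=> j; case: (phiP j).
move=> g; apply/cvgrPdist_le => -[a b]; rewrite ltcE /= => /andP[/eqP -> a0].
apply: (@fin_net_near _ g (Num.truncn a^-1)) => s k gs nk /=.
have [_ _ _ /(_ g gs) le] := phiP (s, k).
rewrite -[leRHS]/(a%:C)%C -[leLHS]/(normc (1 - phi (s, k) g))%:C%C lecR -normcN opprB (le_trans le)//=.
rewrite invf_ple ?posrE ?ltr0n// (le_trans (ltW (truncnS_gt _)))//.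
by rewrite ler_nat.
Qed.

(** The product stays positive definite by [psd_schur]; it decays where either of
the factors does, both being bounded by 1. *)
Lemma haagerup_approx_mul (G : groupType) (S : seq G) e1 e2 B1 B2 :
  haagerup_approx S e1 B1 -> haagerup_approx S e2 B2 ->
  haagerup_approx S (e1 + e2) (fun d => B1 d `&` B2 d).
Proof.
move=> [f [pf f1 fS fB]] [h [ph h1 hS hB]].
exists (fun g => f g * h g); split; last first.
- move=> d g d0; rewrite normcM => dfh.
  have lf := positive_definite_le1 g pf f1; have lh := positive_definite_le1 g ph h1.
  split; [apply: fB|apply: hB] => //; apply: (le_trans dfh).
    by rewrite -[leRHS]mulr1 ler_wpM2l ?normc_ge0.
  by rewrite -[leRHS]mul1r ler_wpM2r ?normc_ge0.
- move=> g gS; rewrite (_ : _ - 1 = (f g - 1) * h g + (h g - 1)); last by ring.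
  rewrite (le_trans (le_normcD _ _))// lerD ?hS// normcM.
  rewrite (le_trans _ (fS g gS))// -[leRHS]mulr1 ler_wpM2l ?normc_ge0//.
  exact: positive_definite_le1.
- by rewrite f1 h1 mulr1.
- apply/positive_definiteP => n x; apply: psd_schur.
    exact: (positive_definiteP _).1.
  exact: (positive_definiteP _).1.
Qed.

Lemma haagerup_approx_pullback (G Q : groupType) (p : G -> Q) (S : seq G) e B :
  {morph p : x y / (x * y)%g} ->
  haagerup_approx [seq p s | s <- S] e B -> haagerup_approx S e (fun d => p @^-1` B d).
Proof.
move=> pM [f [/positive_definiteP pf f1 fS fB]].
have p1 := mul_morph1 pM; have pV := mul_morphV pM.
exists (f \o p); split=> [||g gS|d g d0 dg] /=; last exact: fB.
- apply/positive_definiteP => n x c; have := pf n (p \o x) c; congr (0 <= _).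
  by apply: eq_bigr => i _; apply: eq_bigr => j _; rewrite /= pM pV.
- by rewrite p1.
- by apply: fS; apply: map_f.
Qed.

(** The indicator of the subgroup of the g with r g = r 1, for r a parametrization
of its left cosets. *)
Lemma haagerup_approx_classes (G : groupType) (Z : Type) (r : G -> Z) (S : seq G) :
  (forall g x y, r x = r y -> r (g * x)%g = r (g * y)%g) ->
  (forall s, s \in S -> r s = r 1%g) ->
  haagerup_approx S 0 (fun _ => [set g | r g = r 1%g]).
Proof.
move=> rM rS; exists (fun g => if `[<r g = r 1%g>] then 1 else 0); split.
- apply/positive_definiteP => n x.
  rewrite (_ : (fun i j => _) = (fun i j => if `[<r (x i) = r (x j)>] then 1 else 0)).
    exact: (psd_same_class (fun i => r (x i))).
  apply/funext => i; apply/funext => j; congr (if _ then _ else _).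
  apply: asbool_equiv_eq; split=> [/(rM (x i))|/esym/(rM (x i)^-1%g)].
    by rewrite mulVKg mulg1.
  by rewrite mulVg.
- by case: asboolP.
- by move=> g /rS gS; case: asboolP => // _; rewrite subrr normc_zero.
- by move=> d g d0; case: asboolP => // _; rewrite normc_zero leNgt d0.
Qed.

(** Both sides count the points of gF and hF in common. *)
Lemma folner_overlap (G : groupType) (F : seq G) (g h : G) (U : seq G) :
  uniq F -> uniq U -> (forall x, x \in F -> (h * x)%g \in U) ->
  \sum_(u <- U) ((g^-1 * u \in F)%g%:R * (h^-1 * u \in F)%g%:R) =
  (count (fun x => (g^-1 * h * x)%g \in F) F)%:R :> R.
Proof.
move=> uF uU FU.
have -> : \sum_(u <- U) ((g^-1 * u \in F)%g%:R * (h^-1 * u \in F)%g%:R) =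
    (count (fun u => ((g^-1 * u)%g \in F) && ((h^-1 * u)%g \in F)) U)%:R :> R.
  elim: (U) => [|u V IH]; first by rewrite big_nil.
  by rewrite big_cons IH /= natrD -natrM mulnb.
congr (_%:R); rewrite -!size_filter -[RHS](size_map (fun x => (h * x)%g)).
apply/perm_size/uniq_perm; [exact: filter_uniq| |].
  by rewrite map_inj_uniq ?filter_uniq//; exact: mulgI.
move=> u; rewrite mem_filter; apply/idP/mapP => [/andP[/andP[gu hu] uU']|[x]].
  exists (h^-1 * u)%g; rewrite ?mulVKg// mem_filter hu andbT.
  by rewrite -mulgA mulVKg.
by rewrite mem_filter => /andP[gx xF] ->; rewrite mulKg xF andbT mulgA gx FU.
Qed.

(** The normalized correlation of the indicator of F with its translates. *)
Lemma haagerup_approx_folner (G : groupType) (S F : seq G) n : (0 < n)%N ->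
  uniq F -> (0 < size F)%N ->
  (forall g, g \in S -> (n * count (fun x => (g * x)%g \notin F) F <= size F)%N) ->
  haagerup_approx S n%:R^-1 (fun _ => [set g | exists x y, [/\ x \in F, y \in F & g = (x * y^-1)%g]]).
Proof.
move=> n0 uF F0 FS; set m : R := (size F)%:R.
have m0 : 0 < m by rewrite ltr0n.
exists (fun g => ((count (fun x => (g * x)%g \in F) F)%:R / m)%:C%C); split.
- apply/positive_definiteP => k x.
  set U := undup (flatten [seq [seq (x i * y)%g | y <- F] | i : 'I_k]).
  rewrite (_ : (fun i j => _) = (fun i j => (m^-1)%:C%C *
     \sum_(u <- U) (((x i)^-1 * u \in F)%g%:R : C)^* * ((x j)^-1 * u \in F)%g%:R)).
    apply: psd_scale; first by rewrite ler0c invr_ge0 ltW.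
    by apply: psd_sum => u; apply: psd_rank1.
  apply/funext => i; apply/funext => j.
  rewrite -(@folner_overlap _ F (x i) (x j) U) ?undup_uniq//; last first.
    move=> y yF; rewrite mem_undup; apply/flattenP; exists [seq (x j * y)%g | y <- F].
      by apply/mapP; exists j; rewrite ?mem_enum.
    exact: map_f.
  rewrite mulrC rmorphM rmorph_sum /=; congr (_ * _); apply: eq_bigr => u _.
  by rewrite conjC_nat rmorphM /= !rmorph_nat.
- rewrite (_ : count _ _ = size F) ?divff ?gt_eqF//.
  by apply/eqP; rewrite -all_count; apply/allP => x; rewrite mul1g.
- move=> g gS; rewrite (_ : normc _ = `|(count (fun x => (g * x)%g \in F) F)%:R / m - 1|); last first.
    by rewrite -normc_real rmorphB rmorph1.
  have cF : (count (fun x => (g * x)%g \in F) F)%:R =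
      m - (count (fun x => (g * x)%g \notin F) F)%:R :> R.
    by rewrite /m -(count_predC (fun x => (g * x)%g \in F)) natrD addrK.
  rewrite cF mulrBl divff ?gt_eqF// addrAC subrr add0r normrN ger0_norm; last first.
    by rewrite divr_ge0// ltW.
  rewrite ler_pdivrMr// mulrC ler_pdivlMr ?ltr0n// mulrC -natrM ler_nat.
  exact: FS.
- move=> d g d0; rewrite normc_real => dg.
  have : has (fun x => (g * x)%g \in F) F.
    rewrite has_count lt0n; apply/negP => /eqP c0; move: dg.
    by rewrite c0 mul0r normr0 leNgt d0.
  by move=> /hasP[x xF gxF]; exists (g * x)%g, x; rewrite gxF xF mulgK.
Qed.

(** The three functions multiplied here depend on the coordinates in J, on the
other coordinates and on the nilpotent quotient, where J carries all the
nontrivial coordinates of S; by [finite_in_product] their joint decay is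
decay at infinity. *)
Theorem haagerup_second_nilpotent_product (I : choiceType) (H : I -> groupType) :
  (forall i, haagerup R (H i)) -> haagerup R (second_nilpotent_product H).
Proof.
move=> hH; apply/haagerup_approxP => S e e0.
have [J JP] := common_support S.
have [B1 fB1 a1] : exists2 B, (forall d i, 0 < d -> i \in J -> finite_set (@proj I H i @` B d)) &
    haagerup_approx S (e / 2) B.
  have e20 : 0 < e / 2 by rewrite divr_gt0.
  elim: J (e / 2) e20 {JP} => [|i J IH] e' e'0.
    exists (fun=> setT) => //; exists (fun=> 1); split=> // [|g _].
      apply/positive_definiteP => n g c; have := psd_rank1 (fun _ : 'I_n => 1 : C) c.
      by under eq_bigr do under eq_bigr do rewrite conjC1 mulr1.
    by rewrite subrr normc_zero ltW.
  have e'2 : 0 < e' / 2 by rewrite divr_gt0.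
  have [B fB aB] := IH _ e'2.
  have [B' fB' /(haagerup_approx_pullback (projM i)) aB'] :=
    (haagerup_approxP _).1 (hH i) [seq proj i s | s <- S] _ e'2.
  exists (fun d => (@proj I H i @^-1` B' d) `&` B d); last first.
    by rewrite [e'](splitr); apply: haagerup_approx_mul.
  move=> d j d0; rewrite in_cons => /predU1P[->|jJ].
    by apply: sub_finite_set (fB' d d0) => _ [x [Bx _] <-].
  by apply: sub_finite_set (fB d j d0 jJ); apply: image_subset => x [].
pose r (x : second_nilpotent_product H) i := if i \in J then 1%g else proj i x.
have a2 : haagerup_approx S 0 (fun _ => [set g | r g = r 1%g]).
  apply: haagerup_approx_classes => [g x y xy|s sS]; apply/functional_extensionality_dep => i.
    have := congr1 (fun f => f i) xy; rewrite /r; case: ifP => // _ /= xyi.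
    by rewrite !projM xyi.
  by rewrite /r; case: ifPn => // iJ; rewrite (JP s sS i iJ) proj_one.
pose n := (Num.truncn (2 / e)).+1.
have [F [uF F0 FS]] := folner_quotient S (ltn0Sn _ : 0 < n)%N.
have FS' g : g \in [seq quotient_pi (@same_factor_commutators I H) s | s <- S] ->
    (n * count (fun x => (g * x)%g \notin F) F <= size F)%N.
  by move=> /mapP[s sS ->]; apply: FS.
have a3 := haagerup_approx_pullback (@quotient_piM _ _)
  (@haagerup_approx_folner _ _ F n isT uF F0 FS').
exists (fun d => (B1 d `&` [set g | r g = r 1%g]) `&` quotient_pi (@same_factor_commutators I H) @^-1`
  [set g | exists x y, [/\ x \in F, y \in F & g = (x * y^-1)%g]]).
  move=> d d0; apply: (@finite_in_product _ _ J).
  - move=> i iJ; apply: sub_finite_set (fB1 d i d0 iJ).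
    by apply: image_subset => x [[]].
  - apply: (@sub_finite_set _ _ [set` [seq (x * y^-1)%g | x <- F, y <- F]]); last exact: finite_seq.
    move=> _ [g [_ /= [x [y [xF yF gE]]]] <-] /=.
    by rewrite gE; apply: allpairs_f.
  - move=> x y [[_ /= rx] _] [[_ /= ry] _] i iJ.
    have := congr1 (fun f => f i) (etrans rx (esym ry)).
    by rewrite /r (negPf iJ).
have [phi [pd p1 pS pB]] := haagerup_approx_mul (haagerup_approx_mul a1 a2) a3.
exists phi; split=> // g gS; apply: le_trans (pS g gS) _.
rewrite addr0 [leRHS]splitr lerD2l.
rewrite -[leRHS]invf_div lef_pV2 ?posrE ?ltr0n ?divr_gt0//.
exact: ltW (truncnS_gt _).
Qed.

End Haagerup.

(** * Square-summable functions *)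

Section SubsetSums.
Local Open Scope ring_scope.

Lemma sum_subset (V : nmodType) (X : eqType) (A B : seq X) (F : X -> V) :
  uniq A -> uniq B -> {subset A <= B} ->
  \sum_(x <- B) F x = \sum_(x <- A) F x + \sum_(x <- B | x \notin A) F x.
Proof.
move=> uA uB AB; rewrite -[X in _ + X]big_filter -big_cat; apply: perm_big.
apply: uniq_perm => //.
  rewrite cat_uniq uA filter_uniq// andbT; apply/hasPn => x.
  by rewrite mem_filter => /andP[].
move=> x; rewrite mem_cat mem_filter; case: (boolP (x \in A)) => //= /AB ->//.
Qed.

Lemma sum_support (V : nmodType) (X : eqType) (A B : seq X) (F : X -> V) :
  uniq A -> uniq B -> (forall x, F x != 0 -> x \in A) ->
  (forall x, F x != 0 -> x \in B) -> \sum_(x <- A) F x = \sum_(x <- B) F x.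
Proof.
move=> uA uB FA FB; have red (L : seq X) : \sum_(x <- L) F x = \sum_(x <- L | F x != 0) F x.
  rewrite [LHS](bigID (fun x => F x != 0)) /= [X in _ + X]big1 ?addr0//.
  by move=> x /negPn/eqP.
rewrite (red A) (red B) -!(big_filter _ (fun x => F x != 0)); apply: perm_big;
  apply: uniq_perm; rewrite ?filter_uniq//.
move=> x; rewrite !mem_filter; case: (boolP (F x != 0)) => //= Fx.
by rewrite FA// FB.
Qed.

Lemma sum_fsetT (V : nmodType) n (F : 'I_n -> V) :
  \sum_(x <- [fset i | i : 'I_n]%fset) F x = \sum_i F i.
Proof.
apply: perm_big; apply: uniq_perm; rewrite ?fset_uniq ?index_enum_uniq// => i.
by rewrite mem_index_enum; apply/imfsetP; exists i.
Qed.

End SubsetSums.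

Section SquareSummable.
Local Open Scope ring_scope.
Variables (R : realType) (X : choiceType).
Notation C := R[i].

Definition sqsum (A : {fset X}) (f : X -> C) : R := \sum_(x <- A) normc (f x) ^+ 2.

Lemma sqsum_ge0 A f : 0 <= sqsum A f.
Proof. by apply: sumr_ge0 => x _; apply: sqr_ge0. Qed.

Lemma sqsum_subset A B f : (A `<=` B)%fset ->
  sqsum B f = sqsum A f + \sum_(x <- B | x \notin A) normc (f x) ^+ 2.
Proof. by move=> /fsubsetP; apply: sum_subset; apply: fset_uniq. Qed.

Lemma sqsum_le A B f : (A `<=` B)%fset -> sqsum A f <= sqsum B f.
Proof.
by move=> AB; rewrite (sqsum_subset _ AB) lerDl sumr_ge0// => x _; apply: sqr_ge0.
Qed.

Let esumf (f : X -> C) := (\esum_(x in [set: X]) (normc (f x) ^+ 2)%:E)%E.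

Lemma sqsum_esum A f : ((sqsum A f)%:E <= esumf f)%E.
Proof.
apply: esum_ge; exists [set` A]; first by split=> //; exact: finite_fset.
by rewrite fsbig_finite ?finite_fset//= set_fsetK sumEFin.
Qed.

Lemma esum_sqsum f (M : R) : (forall A, sqsum A f <= M) -> (esumf f <= M%:E)%E.
Proof.
move=> fM; apply: ge_ereal_sup => _ [A [fA _] <-].
by rewrite fsbig_finite//= sumEFin lee_fin; exact: fM.
Qed.

Lemma square_summableP f (M : R) : (forall A, sqsum A f <= M) ->
  f \in @square_summable R X.
Proof. by move=> /esum_sqsum/le_lt_trans h; apply/asboolP/h; exact: ltry. Qed.

Lemma l2_norm_ge0 (f : l2 R X) : 0 <= l2_norm f.
Proof. exact: sqrtr_ge0. Qed.

Lemma l2_norm_sq (f : l2 R X) : (esumf f = (l2_norm f ^+ 2)%:E)%E.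
Proof.
have /asboolP fin := l2P f.
have ge0 : (0 <= esumf f)%E by apply: esum_ge0 => x _; rewrite lee_fin sqr_ge0.
have fn : (esumf f \is a fin_num)%E by rewrite ge0_fin_numE.
rewrite /l2_norm sqr_sqrtr; last exact: fine_ge0.
by rewrite fineK.
Qed.

Lemma sqsum_l2_norm A (f : l2 R X) : sqsum A f <= l2_norm f ^+ 2.
Proof. by rewrite -lee_fin -l2_norm_sq sqsum_esum. Qed.

Lemma l2_norm_le (f : l2 R X) (M : R) : 0 <= M ->
  (forall A, sqsum A f <= M ^+ 2) -> l2_norm f <= M.
Proof.
move=> M0 /esum_sqsum; rewrite l2_norm_sq lee_fin.
by rewrite ler_pXn2r ?nnegrE ?l2_norm_ge0.
Qed.

Lemma l2_norm_approx (f : l2 R X) (e : R) : 0 < e ->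
  exists A, l2_norm f ^+ 2 - e < sqsum A f.
Proof.
move=> e0; apply/not_existsP => h.
have : (esumf f <= (l2_norm f ^+ 2 - e)%:E)%E.
  by apply: esum_sqsum => A; have /negP := h A; rewrite -leNgt.
by rewrite l2_norm_sq lee_fin; lra.
Qed.

Fact trunc_subproof (A : {fset X}) (h : X -> C) :
  (fun x => if x \in A then h x else 0) \in @square_summable R X.
Proof.
apply: (@square_summableP _ (sqsum A h)) => B.
rewrite (le_trans (sqsum_le _ (fsubsetUr A B)))// (sqsum_subset _ (fsubsetUl A B)).
rewrite big1 ?addr0; last by move=> x /negPf ->; rewrite normc_zero expr0n.
rewrite le_eqVlt; apply/orP; left; apply/eqP.
by rewrite /sqsum big_seq [RHS]big_seq; apply: eq_bigr => x ->.
Qed.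

Definition trunc A h : l2 R X := L2 (trunc_subproof A h).

Lemma l2_addE (f g : l2 R X) x : l2_fun (f + g) x = f x + g x.
Proof. by []. Qed.

Lemma l2_oppE (f : l2 R X) x : l2_fun (- f) x = - f x.
Proof. by []. Qed.

Lemma l2_scaleE a (f : l2 R X) x : l2_fun (a *: f) x = a * f x.
Proof. by []. Qed.

Lemma l2_eq (f g : l2 R X) : (forall x, f x = g x) -> f = g.
Proof. by move=> fg; apply/val_inj/funext. Qed.

Lemma l2_norm_trunc A h : l2_norm (trunc A h) ^+ 2 = sqsum A h.
Proof.
have e : sqsum A (trunc A h) = sqsum A h.
  by rewrite /sqsum big_seq [RHS]big_seq; apply: eq_bigr => x /= ->.
apply/eqP; rewrite eq_le -{2}e sqsum_l2_norm andbT.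
rewrite -[leRHS]sqr_sqrtr ?sqsum_ge0// ler_pXn2r ?nnegrE ?l2_norm_ge0 ?sqrtr_ge0//.
apply: l2_norm_le; rewrite ?sqrtr_ge0// => B; rewrite sqr_sqrtr ?sqsum_ge0//.
rewrite (le_trans (sqsum_le _ (fsubsetUr A B)))// (sqsum_subset _ (fsubsetUl A B)).
rewrite big1 ?addr0 ?e//; last by move=> x /= /negPf ->; rewrite normc_zero expr0n.
Qed.

(** Once the partial sum of the squares over A is within e ^ 2 of the total, what is
left outside any larger set has norm at most e. *)
Lemma trunc_approx (f : l2 R X) (e : R) : 0 < e ->
  exists A, forall B, (A `<=` B)%fset -> l2_norm (f - trunc B f) <= e.
Proof.
move=> e0; have [|A fA] := @l2_norm_approx f (e ^+ 2); first by rewrite exprn_gt0.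
exists A => B AB; apply: l2_norm_le => [|D]; first exact: ltW.
have := sqsum_l2_norm (B `|` D)%fset f; rewrite (sqsum_subset _ (fsubsetUl B D)).
have -> : sqsum D (f - trunc B f : l2 R X) = \sum_(x <- D | x \notin B) normc (f x) ^+ 2.
  rewrite /sqsum [RHS]big_mkcond /=; apply: eq_bigr => x _.
  rewrite [X in normc X](_ : _ = f x - (if x \in B then f x else 0))//.
  by case: ifP => _ /=; rewrite ?subr0// subrr normc_zero expr0n.
have : \sum_(x <- D | x \notin B) normc (f x) ^+ 2 <=
    \sum_(x <- (B `|` D)%fset | x \notin B) normc (f x) ^+ 2.
  rewrite -!(big_filter _ (fun x => x \notin B)).
  rewrite [leRHS](@sum_subset _ _ [seq x <- D | x \notin B]) ?filter_uniq ?fset_uniq//; last first.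
    by move=> x; rewrite !mem_filter in_fsetU => /andP[-> ->]; rewrite orbT.
  by rewrite lerDl sumr_ge0// => x _; apply: sqr_ge0.
have := sqsum_le f AB; lra.
Qed.

End SquareSummable.

Section InnerProduct.
Local Open Scope ring_scope.
Variables (R : realType) (X : choiceType).
Notation C := R[i].
Implicit Types f g h : l2 R X.

Lemma cvg_normc (T : Type) (F : set_system T) (u : T -> C) (l : C) : Filter F ->
  (forall e : R, 0 < e -> \forall t \near F, normc (l - u t) <= e) -> u @ F --> l.
Proof.
move=> FF h; apply/cvgrPdist_le => -[a b]; rewrite ltcE /= => /andP[/eqP -> a0].
apply: filterS (h a a0) => t.
by rewrite -[_ <= Complex _ _]/(`|l - u t| <= a%:C%C) -lecR.
Qed.

Lemma normc_cvg (T : Type) (F : set_system T) (u : T -> C) (l : C) : Filter F ->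
  u @ F --> l -> forall e : R, 0 < e -> \forall t \near F, normc (l - u t) <= e.
Proof.
move=> FF /cvgrPdist_le h e e0; have := h e%:C%C.
rewrite ltcR => /(_ e0); apply: filterS => t.
by rewrite -lecR.
Qed.

Definition pdot f g (A : {fset X}) : C := \sum_(x <- A) f x * (g x)^*.

Lemma pdotE f g : summability.partial_sum (fun x => f x * (g x)^*%C) = pdot f g.
Proof. by apply/funext => A; rewrite /pdot big_seq_fsetE. Qed.

#[local] Existing Instance summability.totally_filter.

Lemma pdot_self f A : pdot f f A = (sqsum A f)%:C%C.
Proof.
rewrite /pdot /sqsum rmorph_sum; apply: eq_bigr => x _.
by rewrite mulrC; exact: conj_mul.
Qed.

Lemma pdot_self_cvg f : pdot f f @ summability.totally --> ((l2_norm f ^+ 2)%:C%C : C).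
Proof.
apply: cvg_normc => e e0; have [A fA] := l2_norm_approx f e0.
exists A => // B /= AB; rewrite pdot_self -rmorphB normc_real.
rewrite ger0_norm ?subr_ge0 ?sqsum_l2_norm//.
have := sqsum_le f AB; lra.
Qed.

(** Reduces the convergence of inner products to that of sums of squares, where
it is monotone convergence. *)
Lemma pdot_polarization f g A : pdot f g A = (4^-1 : R)%:C%C *
  (pdot (f + g) (f + g) A - pdot (f - g) (f - g) A
   + 'i%C * pdot (f + 'i%C *: g) (f + 'i%C *: g) A
   - 'i%C * pdot (f - 'i%C *: g) (f - 'i%C *: g) A).
Proof.
rewrite /pdot !mulr_sumr -!sumrN -!big_split mulr_sumr; apply: eq_bigr => x _; cbv beta.
rewrite !l2_addE !l2_oppE !l2_scaleE.
case: (f x) => a b; case: (g x) => c d.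
by apply/eqP; rewrite eq_complex /=; apply/andP; split; apply/eqP; field.
Qed.

Lemma dot_cvg f g : pdot f g @ summability.totally --> l2_dot f g.
Proof.
suff [z fz] : exists z : C, pdot f g @ summability.totally --> z.
  have fzl := cvg_lim (@norm_hausdorff _ _) fz.
  by rewrite /l2_dot /summability.sum pdotE fzl.
eexists; rewrite (funext (pdot_polarization f g)).
apply: cvgM; first exact: cvg_cst.
apply: cvgB; last by apply: cvgM; [exact: cvg_cst|exact: pdot_self_cvg].
apply: cvgD; last by apply: cvgM; [exact: cvg_cst|exact: pdot_self_cvg].
by apply: cvgB; exact: pdot_self_cvg.
Qed.

Lemma dot_unique f g z : pdot f g @ summability.totally --> (z : C) -> l2_dot f g = z.
Proof.
move=> h; have <- := cvg_lim (@norm_hausdorff _ _) (@dot_cvg f g).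
exact: (cvg_lim (@norm_hausdorff _ _) h).
Qed.

Lemma dot_self f : l2_dot f f = (l2_norm f ^+ 2)%:C%C.
Proof. exact/dot_unique/pdot_self_cvg. Qed.

Lemma dotDl a f f' g : l2_dot (a *: f + f') g = a * l2_dot f g + l2_dot f' g.
Proof.
apply: dot_unique; rewrite (_ : pdot _ g = fun A => a * pdot f g A + pdot f' g A).
  apply: cvgD; last exact: dot_cvg.
  by apply: cvgM; [exact: cvg_cst|exact: dot_cvg].
apply/funext => A; rewrite /pdot mulr_sumr -big_split; apply: eq_bigr => x _; cbv beta.
by rewrite l2_addE l2_scaleE mulrDl mulrA.
Qed.

Lemma dot_conj f g : l2_dot g f = (l2_dot f g)^*.
Proof.
apply: dot_unique; apply: cvg_normc => e e0.
apply: filterS (normc_cvg _ (@dot_cvg f g) e0) => A.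
rewrite -normc_conj rmorphB /= /pdot rmorph_sum /=.
rewrite (_ : \sum_(x <- A) (_)^* = \sum_(x <- A) g x * (f x)^*)//.
by apply: eq_bigr => x _; rewrite rmorphM /= conjCK mulrC.
Qed.

Lemma dot_fset f g (A : {fset X}) : (forall x, x \notin A -> f x * (g x)^* = 0) ->
  l2_dot f g = \sum_(x <- A) f x * (g x)^*.
Proof.
move=> fg; apply: dot_unique; apply: cvg_normc => e e0; exists A => // B /= /fsubsetP AB.
rewrite /pdot (sum_subset _ (fset_uniq A) (fset_uniq B) AB).
rewrite [X in _ - (_ + X)]big1; last by move=> x /fg.
by rewrite addr0 subrr normc_zero ltW.
Qed.

Lemma dot_trunc f A (h : X -> C) : l2_dot f (trunc A h) = \sum_(x <- A) f x * (h x)^*.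
Proof.
rewrite (@dot_fset _ _ A) => [|x /negPf xA /=]; last by rewrite xA conjC0 mulr0.
by rewrite big_seq [RHS]big_seq; apply: eq_bigr => x /= ->.
Qed.

Lemma dot0l g : l2_dot 0 g = 0.
Proof. by have := dotDl (-1) g g g; rewrite scaleN1r addNr mulN1r addNr. Qed.

Lemma dotZl a f g : l2_dot (a *: f) g = a * l2_dot f g.
Proof. by rewrite -[a *: f]addr0 dotDl dot0l addr0. Qed.

Lemma dotD f f' g : l2_dot (f + f') g = l2_dot f g + l2_dot f' g.
Proof. by rewrite -[f in LHS]scale1r dotDl mul1r. Qed.

Lemma dotNl f g : l2_dot (- f) g = - l2_dot f g.
Proof. by rewrite -scaleN1r dotZl mulN1r. Qed.

Lemma dotB f f' g : l2_dot (f - f') g = l2_dot f g - l2_dot f' g.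
Proof. by rewrite dotD dotNl. Qed.

Lemma dotZr a f g : l2_dot f (a *: g) = a^* * l2_dot f g.
Proof. by rewrite dot_conj dotZl rmorphM /= -dot_conj. Qed.

Lemma dotDr f g g' : l2_dot f (g + g') = l2_dot f g + l2_dot f g'.
Proof. by rewrite dot_conj dotD rmorphD /= -!dot_conj. Qed.

Lemma dotBr f g g' : l2_dot f (g - g') = l2_dot f g - l2_dot f g'.
Proof. by rewrite dot_conj dotB rmorphB /= -!dot_conj. Qed.

Lemma dot_suml I (r : seq I) (F : I -> l2 R X) g :
  l2_dot (\sum_(i <- r) F i) g = \sum_(i <- r) l2_dot (F i) g.
Proof.
by elim: r => [|i r IH]; rewrite ?big_nil ?dot0l// !big_cons dotD IH.
Qed.

Lemma normc_Re (z : C) : complex.Re z <= normc z.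
Proof.
case: z => a b; rewrite /= (le_trans (ler_norm _))// -sqrtr_sqr.
by rewrite ler_sqrt ?addr_ge0 ?sqr_ge0// lerDl sqr_ge0.
Qed.

Lemma normc_phase (z : C) : exists2 u : C, normc u = 1 & u * z = (normc z)%:C%C.
Proof.
have [->|z0] := eqVneq z 0.
  by exists 1; rewrite ?normc_one ?normc_zero ?mulr0 ?rmorph0.
have nz : normc z != 0 by apply: contraNneq z0 => /eq0_normc ->.
exists (z^* / (normc z)%:C%C).
  by rewrite normcM normcV normc_conj normc_real ger0_norm ?normc_ge0 ?divff.
rewrite mulrAC conj_mul -[_^-1]fmorphV -rmorphM /=; congr (_%:C%C).
by rewrite expr2 mulfK.
Qed.

Lemma l2_normZ a f : l2_norm (a *: f) = normc a * l2_norm f.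
Proof.
apply/eqP; rewrite -(@eqrXn2 _ 2)// ?mulr_ge0 ?l2_norm_ge0 ?normc_ge0//; apply/eqP.
apply: complexI; rewrite -dot_self dotZl dotZr dot_self exprMn.
by rewrite mulrA (mulrC a) conj_mul -rmorphM.
Qed.

(** From 2 Re <f, g> <= |f| ^ 2 + |g| ^ 2: multiply f by a phase that makes <f, g>
real, then rescale both vectors to norm |f| |g|, or let one of them grow when
the other one vanishes. *)
Lemma cauchy_schwarz f g : normc (l2_dot f g) <= l2_norm f * l2_norm g.
Proof.
have key f' g' : complex.Re (l2_dot f' g') * 2 <= l2_norm f' ^+ 2 + l2_norm g' ^+ 2.
  have := dot_self (f' - g'); rewrite dotB !dotBr !dot_self (dot_conj f' g').
  move: (l2_norm (f' - g')) => m.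
  case: (l2_dot f' g') => a b; move=> /(congr1 (@complex.Re R)) /=.
  by have := sqr_ge0 m; lra.
have [u u1 ud] := normc_phase (l2_dot f g).
have scal (a : R) h : 0 <= a -> l2_norm (a%:C%C *: h) = a * l2_norm h.
  by move=> a0; rewrite l2_normZ normc_real ger0_norm.
have nu h : l2_norm (u *: h) = l2_norm h by rewrite l2_normZ u1 mul1r.
have [f0|f0] := eqVneq (l2_norm f) 0; last first.
  have [g0|g0] := eqVneq (l2_norm g) 0; last first.
    have fp : 0 < l2_norm f by rewrite lt_def f0 l2_norm_ge0.
    have gp : 0 < l2_norm g by rewrite lt_def g0 l2_norm_ge0.
    have := key ((l2_norm g)%:C%C *: (u *: f)) ((l2_norm f)%:C%C *: g).
    rewrite !scal ?l2_norm_ge0// nu dotZl dotZr dotZl ud conjC_real -!rmorphM /=.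
    set N := normc _; set a := l2_norm f; set b := l2_norm g.
    rewrite (_ : b * (a * N) * 2 = (a * b * 2) * N); last by ring.
    rewrite (_ : _ + _ = (a * b * 2) * (a * b)); last by ring.
    by rewrite ler_pM2l ?mulr_gt0.
  rewrite g0 mulr0 leNgt; apply/negP => N0.
  pose t := (l2_norm f ^+ 2 + 1) / normc (l2_dot f g).
  have t0 : 0 <= t by rewrite divr_ge0 ?addr_ge0 ?sqr_ge0 ?ltW.
  have := key (u *: f) (t%:C%C *: g).
  rewrite scal// g0 mulr0 expr0n addr0 nu dotZl dotZr mulrCA ud conjC_real -rmorphM /=.
  rewrite /t mulfVK ?gt_eqF//; have := sqr_ge0 (l2_norm f); lra.
rewrite f0 mul0r leNgt; apply/negP => N0.
pose t := (l2_norm g ^+ 2 + 1) / normc (l2_dot f g).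
have t0 : 0 <= t by rewrite divr_ge0 ?addr_ge0 ?sqr_ge0 ?ltW.
have := key (t%:C%C *: (u *: f)) g.
rewrite scal// nu f0 mulr0 expr0n add0r dotZl dotZl ud -rmorphM /=.
rewrite /t mulfVK ?gt_eqF//; have := sqr_ge0 (l2_norm g); lra.
Qed.

Lemma l2_normD f g : l2_norm (f + g) <= l2_norm f + l2_norm g.
Proof.
rewrite -(@ler_pXn2r _ 2)// ?nnegrE ?addr_ge0 ?l2_norm_ge0//.
have := dot_self (f + g); rewrite dotD !dotDr !dot_self (dot_conj f g).
have := le_trans (normc_Re _) (cauchy_schwarz f g).
case: (l2_dot f g) => a b /= ab; move=> /(congr1 (@complex.Re R)) /= <-.
rewrite sqrrD mulr2n; lra.
Qed.

Lemma l2_norm0 : l2_norm (0 : l2 R X) = 0.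
Proof. by rewrite -(scale0r 0) l2_normZ normc_zero mul0r. Qed.

Lemma l2_normN f : l2_norm (- f) = l2_norm f.
Proof. by rewrite -scaleN1r l2_normZ normcN normc_one mul1r. Qed.

End InnerProduct.

(** * Operators on square-summable functions *)

Section OperatorNorm.
Local Open Scope ring_scope.
Variables (R : realType).
Notation C := R[i].

Section TwoSpaces.
Variables (X : choiceType).
Implicit Types T S : l2 R X -> l2 R X.

Lemma l2_norm_dominated (f : l2 R X) (Y : choiceType) (p : X -> Y) (h : l2 R Y) (c : R) :
  injective p -> 0 <= c -> (forall x, normc (f x) <= c * normc (h (p x))) ->
  l2_norm f <= c * l2_norm h.
Proof.
move=> pI c0 fh; apply: l2_norm_le => [|A]; first by rewrite mulr_ge0 ?l2_norm_ge0.
rewrite exprMn (le_trans _ (ler_wpM2l (sqr_ge0 c) (sqsum_l2_norm [fset p x | x in A]%fset h)))//.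
rewrite /sqsum mulr_sumr big_imfset /=; last by move=> x y _ _ /pI.
apply: ler_sum => x _; rewrite -exprMn ler_pXn2r ?nnegrE ?mulr_ge0 ?normc_ge0//.
Qed.

(** The infimum defining the operator norm is attained. *)
Lemma bounded_opP T : bounded_op T -> forall f, l2_norm (T f) <= op_norm T * l2_norm f.
Proof.
move=> [_ [M TM]] f; have [f0|f0] := eqVneq (l2_norm f) 0.
  by rewrite f0 mulr0; have := TM f; rewrite f0 mulr0.
have fp : 0 < l2_norm f by rewrite lt_def f0 l2_norm_ge0.
rewrite -ler_pdivrMr//; apply: lb_le_inf.
  exists `|M|; split=> // h; rewrite (le_trans (TM h))//.
  by rewrite ler_wpM2r ?l2_norm_ge0 ?ler_norm.
by move=> m [_ Tm]; rewrite ler_pdivrMr.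
Qed.

Lemma op_norm_le T (M : R) : 0 <= M ->
  (forall f, l2_norm (T f) <= M * l2_norm f) -> op_norm T <= M.
Proof. by move=> M0 TM; apply: ge_inf => //; exists 0 => m []. Qed.

Lemma op_norm_ge0 T : bounded_op T -> 0 <= op_norm T.
Proof.
move=> [_ [M TM]]; apply: lb_le_inf => [|m []//].
exists `|M|; split=> // h; rewrite (le_trans (TM h))//.
by rewrite ler_wpM2r ?l2_norm_ge0 ?ler_norm.
Qed.

Lemma bounded_op_lin a S T : bounded_op S -> bounded_op T -> bounded_op (a *: S + T).
Proof.
move=> bS bT; have [lS _] := bS; have [lT _] := bT; split.
  move=> c f g; rewrite -[LHS]/(a *: S (c *: f + g) + T (c *: f + g)) lS lT.
  rewrite -[(a *: S + T) f]/(a *: S f + T f) -[(a *: S + T) g]/(a *: S g + T g).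
  by rewrite !scalerDr !scalerA (mulrC a c) addrACA.
exists (normc a * op_norm S + op_norm T) => f.
rewrite -[(a *: S + T) f]/(a *: S f + T f) (le_trans (l2_normD _ _))// mulrDl.
rewrite lerD ?bounded_opP// l2_normZ -mulrA ler_wpM2l ?normc_ge0//.
exact: bounded_opP.
Qed.

Lemma bounded_op0 : bounded_op (0 : l2 R X -> l2 R X).
Proof.
split=> [c f g|]; first by rewrite -[LHS]/(0 : l2 R X) scaler0 addr0.
by exists 0 => f; rewrite mul0r -[0 f]/(0 : l2 R X) l2_norm0.
Qed.

Lemma bounded_op_sum I (r : seq I) (a : I -> C) (T : I -> l2 R X -> l2 R X) :
  (forall i, bounded_op (T i)) -> bounded_op (\sum_(i <- r) a i *: T i).
Proof.
move=> bT; elim: r => [|i r IH]; first by rewrite big_nil; exact: bounded_op0.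
by rewrite big_cons; apply: bounded_op_lin.
Qed.

Lemma sum_opE I (r : seq I) (T : I -> l2 R X -> l2 R X) f :
  (\sum_(i <- r) T i) f = \sum_(i <- r) T i f.
Proof. by elim: r => [|i r IH]; rewrite ?big_nil// !big_cons -IH. Qed.

Lemma linear_sum T I (r : seq I) (a : I -> C) (F : I -> l2 R X) : linear T ->
  T (\sum_(i <- r) a i *: F i) = \sum_(i <- r) a i *: T (F i).
Proof.
move=> lT; elim: r => [|i r IH]; last by rewrite !big_cons lT IH.
rewrite !big_nil; have := lT (-1) 0 0.
by rewrite scaler0 addr0 scaleN1r addNr.
Qed.

Lemma ge0_closed (z : C) :
  (forall e : R, 0 < e -> exists2 w : C, 0 <= w & normc (z - w) <= e) -> 0 <= z.
Proof.
move=> h; case: z h => a b h; rewrite lecE /=.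
have {}h e : 0 < e -> - e <= a /\ `|b| <= e.
  move=> /h[[c d]]; rewrite lecE /= => /andP[/eqP -> c0].
  rewrite oppr0 addr0 => le.
  have ge (x y : R) : `|x| <= Num.sqrt (x ^+ 2 + y ^+ 2).
    by rewrite -sqrtr_sqr ler_sqrt ?addr_ge0 ?sqr_ge0// lerDl sqr_ge0.
  have la := le_trans (ge _ _) le; rewrite addrC in le; have lb := le_trans (ge _ _) le.
  by split=> //; move: la; rewrite ler_norml => /andP[+ _]; lra.
apply/andP; split.
  by rewrite -normr_le0; apply/ler_addgt0Pr => e /h[_]; rewrite add0r.
by rewrite leNgt; apply/negP => a0; have [|+ _] := h (- a / 2); lra.
Qed.

(** The form of a matrix of bounded operators is continuous, and truncations to
finite sets approximate every vector. *)
Lemma positive_op_matrix_dense n (T : 'I_n -> 'I_n -> l2 R X -> l2 R X) :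
  (forall i j, bounded_op (T i j)) ->
  (forall (A : {fset X}) (h : 'I_n -> X -> C),
    0 <= \sum_i \sum_j l2_dot (T i j (trunc A (h j))) (trunc A (h i))) ->
  positive_op_matrix T.
Proof.
move=> bT pT f; apply: ge0_closed => e e0.
pose K := \sum_i \sum_j op_norm (T i j) * (l2_norm (f i) + (l2_norm (f j) + 1)).
have K0 : 0 <= K.
  apply: sumr_ge0 => i _; apply: sumr_ge0 => j _.
  by rewrite mulr_ge0 ?op_norm_ge0// !addr_ge0 ?l2_norm_ge0.
pose d := Num.min 1 (e / (K + 1)).
have K1 : 0 < K + 1 by rewrite ltr_wpDl.
have d0 : 0 < d by rewrite lt_min ltr01 divr_gt0.
have d1 : d <= 1 by rewrite ge_min lexx.
have dK : d * K <= e.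
  rewrite (le_trans (ler_wpM2r K0 (_ : d <= e / (K + 1))))//.
    by rewrite ge_min lexx orbT.
  by rewrite mulrAC ler_pdivrMr// ler_pM2l// lerDl.
have /choice[A fA] : forall i, exists A, forall B, (A `<=` B)%fset -> l2_norm (f i - trunc B (f i)) <= d.
  by move=> i; apply: trunc_approx.
pose B := [fset x | x in flatten [seq (A i : seq X) | i : 'I_n]]%fset.
have {}fA i : l2_norm (f i - trunc B (f i)) <= d.
  apply: fA; apply/fsubsetP => x xA; apply/imfsetP; exists x => //=.
  by apply/flattenP; exists (A i : seq X) => //; apply/mapP; exists i; rewrite ?mem_enum.
exists (\sum_i \sum_j l2_dot (T i j (trunc B (f j))) (trunc B (f i))) => //.
rewrite -sumrB (le_trans _ dK)// /K mulr_sumr.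
rewrite (le_trans (normc_sum _ _))//; apply: ler_sum => i _.
rewrite -sumrB mulr_sumr (le_trans (normc_sum _ _))//; apply: ler_sum => j _.
set fi := trunc B (f i); set fj := trunc B (f j).
have lT := (bT i j).1.
have -> : l2_dot (T i j (f j)) (f i) - l2_dot (T i j fj) fi =
    l2_dot (T i j (f j - fj)) (f i) + l2_dot (T i j fj) (f i - fi).
  rewrite dotBr; have -> : f j - fj = (-1) *: fj + f j by rewrite scaleN1r addrC.
  by rewrite lT scaleN1r dotD dotNl; ring.
have b0 := op_norm_ge0 (bT i j).
rewrite (le_trans (le_normcD _ _))//.
have e1 : normc (l2_dot (T i j (f j - fj)) (f i)) <= op_norm (T i j) * d * l2_norm (f i).
  rewrite (le_trans (cauchy_schwarz _ _))// ler_wpM2r ?l2_norm_ge0//.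
  by rewrite (le_trans (bounded_opP (bT i j) _))// ler_wpM2l// fA.
have e2 : normc (l2_dot (T i j fj) (f i - fi)) <= op_norm (T i j) * (l2_norm (f j) + 1) * d.
  apply: le_trans (cauchy_schwarz _ _) _.
  apply: ler_pM; [exact: l2_norm_ge0|exact: l2_norm_ge0| |exact: (fA i)].
  apply: le_trans (bounded_opP (bT i j) _) _; apply: ler_wpM2l => //.
  have -> : fj = f j - (f j - fj) by rewrite opprB addrC subrK.
  rewrite (le_trans (l2_normD _ _))// l2_normN lerD2l.
  exact: le_trans (fA j) d1.
by move: e1 e2; move: (op_norm _) (l2_norm (f i)) (l2_norm (f j)) => a b c; lra.
Qed.

End TwoSpaces.

Section LeftRegular.
Variable G : groupType.

Lemma left_regularE (g : G) (f : l2 R G) x : left_regular g f x = f (g^-1 * x)%g.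
Proof. by []. Qed.

Lemma left_regular_norm (g : G) (f : l2 R G) : l2_norm (left_regular g f) <= l2_norm f.
Proof.
rewrite -[leRHS]mul1r; apply: (l2_norm_dominated (p := fun x : G => (g^-1 * x)%g)) => //.
  exact: mulgI.
by move=> x; rewrite mul1r left_regularE.
Qed.

Lemma left_regular_bounded (g : G) : bounded_op (@left_regular R G g).
Proof.
split; first by move=> a f h; apply: l2_eq.
by exists 1 => f; rewrite mul1r left_regular_norm.
Qed.

(** Repeated translations are merged, since elements of the span are written over
sequences of group elements with one coefficient for each element. *)
Lemma reduced_cstar_span (I : eqType) (r : seq I) (a : I -> C) (g : I -> G) :
  reduced_cstar (\sum_(i <- r) a i *: @left_regular R G (g i)).
Proof.
split; first by apply: bounded_op_sum => i; exact: left_regular_bounded.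
move=> e e0; pose s := undup [seq g i | i <- r].
exists s, (fun x => \sum_(i <- r | g i == x) a i).
rewrite (_ : _ - _ = 0).
  rewrite (le_lt_trans (op_norm_le (lexx 0) _))// => f.
  by rewrite -[0 f]/(0 : l2 R G) l2_norm0 mul0r.
apply/eqP; rewrite subr_eq0; apply/eqP.
under [RHS]eq_bigr do rewrite scaler_suml.
rewrite (exchange_big_dep xpredT)//= big_seq [RHS]big_seq; apply: eq_bigr => i ir.
rewrite -big_filter (_ : [seq x <- s | g i == x] = [:: g i]) ?big_seq1//.
have gis : g i \in s by rewrite mem_undup map_f.
rewrite (eq_filter (a2 := pred1 (g i))); last by move=> x /=; rewrite eq_sym.
by rewrite filter_pred1_uniq ?undup_uniq.
Qed.

End LeftRegular.

End OperatorNorm.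

(** * Approximating vectors and exactness of the product *)

Section ExactApproximation.
Local Open Scope ring_scope.
Variable R : realType.

Definition overlap (Z : choiceType) (L : seq Z) (u v : Z -> R) : R := \sum_(z <- L) u z * v z.

(** The vectors zeta s lie in the unit ball of the square-summable functions on Z;
for S containing 1 they are nearly unit vectors, so that an overlap close to 1
means that two of them are close.  As for [haagerup_approx], the set B bounding
the differences of points with overlapping supports is recorded without being
assumed finite. *)
Definition exact_approx (G : groupType) (S : seq G) (e : R) (B : set G) : Prop :=
  exists (Z : choiceType) (zeta : G -> Z -> R) (supp : G -> seq Z),
  [/\ forall s z, 0 <= zeta s z,
      forall s, uniq (supp s) /\ forall z, zeta s z != 0 -> z \in supp s,
      forall s, overlap (supp s) (zeta s) (zeta s) <= 1,
      forall s t, (s * t^-1)%g \in S -> 1 - e <= overlap (supp s) (zeta s) (zeta t)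
    & forall s t z, zeta s z != 0 -> zeta t z != 0 -> B (s * t^-1)%g].

(** 2 u v <= u ^ 2 + v ^ 2, summed over the union of the supports. *)
Lemma overlap_le1 (Z : choiceType) (L L' : seq Z) (u v : Z -> R) : uniq L -> uniq L' ->
  (forall z, u z != 0 -> z \in L) -> (forall z, v z != 0 -> z \in L') ->
  overlap L u u <= 1 -> overlap L' v v <= 1 -> overlap L u v <= 1.
Proof.
move=> uL uL' uS vS u1 v1.
rewrite -(ler_pM2l (ltr0n _ 2)) mulr1 (_ : 2 = 1 + 1 :> R)//.
pose M := undup (L ++ L').
have LM z : z \in L -> z \in M by rewrite mem_undup mem_cat => ->.
have L'M z : z \in L' -> z \in M by rewrite mem_undup mem_cat orbC => ->.
have E (K : seq Z) (w w' : Z -> R) : uniq K -> (forall z, w z != 0 -> z \in K) ->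
    (forall z, z \in K -> z \in M) -> overlap K w w' = overlap M w w'.
  move=> uK wK KM; apply: sum_support; rewrite ?undup_uniq// => z.
    by rewrite mulf_eq0 negb_or => /andP[/wK].
  by rewrite mulf_eq0 negb_or => /andP[/wK/KM].
rewrite (E L)// in u1; rewrite (E L')// in v1; rewrite (E L)//.
apply: le_trans (lerD u1 v1); rewrite /overlap -big_split mulr_sumr; apply: ler_sum => z _ /=.
by have := sqr_ge0 (u z - v z); rewrite expr2; lra.
Qed.

(** Tensor products of vectors: overlaps multiply, and two numbers in [0, 1]
satisfy x y >= x + y - 1. *)
Lemma exact_approx_mul (G : groupType) (S : seq G) e1 e2 B1 B2 :
  exact_approx S e1 B1 -> exact_approx S e2 B2 -> exact_approx S (e1 + e2) (B1 `&` B2).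
Proof.
move=> [Z [u [su [u0 uP u1 uS uB]]]] [Y [v [sv [v0 vP v1 vS vB]]]].
exists (Z * Y)%type, (fun s p => u s p.1 * v s p.2), (fun s => [seq (z, y) | z <- su s, y <- sv s]).
have E s t : overlap [seq (z, y) | z <- su s, y <- sv s]
    (fun p => u s p.1 * v s p.2) (fun p => u t p.1 * v t p.2)
    = overlap (su s) (u s) (u t) * overlap (sv s) (v s) (v t).
  rewrite /overlap big_allpairs mulr_suml; apply: eq_bigr => z _.
  by rewrite mulr_sumr; apply: eq_bigr => y _ /=; ring.
have ov0 (W : choiceType) (L : seq W) (w w' : W -> R) : (forall z, 0 <= w z) ->
    (forall z, 0 <= w' z) -> 0 <= overlap L w w'.
  by move=> w0 w'0; apply: sumr_ge0 => z _; rewrite mulr_ge0.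
split=> [s p|s|s|s t sS|s t p]; first by rewrite mulr_ge0.
- have [us uz] := uP s; have [vs vy] := vP s; split.
    by apply: allpairs_uniq => // -[? ?] [? ?].
  move=> [z y]; rewrite mulf_eq0 negb_or => /andP[/uz zs /vy ys].
  by apply/allpairsP; exists (z, y).
- by rewrite E mulr_ile1 ?ov0.
- rewrite E; have := uS s t sS; have := vS s t sS.
  have [us uz] := uP s; have [vs vy] := vP s; have [ut uz'] := uP t; have [vt vy'] := vP t.
  have := overlap_le1 us ut uz uz' (u1 s) (u1 t).
  have := overlap_le1 vs vt vy vy' (v1 s) (v1 t).
  by move: (overlap _ _ _) (overlap _ _ _) => x y; nra.
- rewrite !mulf_eq0 !negb_or => /andP[us vs] /andP[ut vt].
  by split; [exact: uB us ut|exact: vB vs vt].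
Qed.

Lemma exact_approx_pullback (G Q : groupType) (p : G -> Q) (S : seq G) e B :
  {morph p : x y / (x * y)%g} ->
  exact_approx [seq p s | s <- S] e B -> exact_approx S e (p @^-1` B).
Proof.
move=> pM [Z [u [su [u0 uP u1 uS uB]]]].
have p1 := mul_morph1 pM; have pV := mul_morphV pM.
exists Z, (u \o p), (su \o p); split=> //= s t => [sS|z uz uz'].
  by apply: uS; rewrite -pV -pM map_f.
by rewrite pM pV; apply: uB uz uz'.
Qed.

(** The basis vectors indexed by the values of r. *)
Lemma exact_approx_classes (G : groupType) (Z : choiceType) (r : G -> Z) (S : seq G) (B : set G) :
  (forall s t, (s * t^-1)%g \in S -> r s = r t) ->
  (forall s t, r s = r t -> B (s * t^-1)%g) ->
  exact_approx S 0 B.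
Proof.
move=> rS rB; exists Z, (fun s z => (r s == z)%:R), (fun s => [:: r s]).
split=> [s z|s|s|s t /rS st|s t z]; first exact: ler0n.
- by split=> // z; rewrite pnatr_eq0 eqb0 negbK inE eq_sym.
- by rewrite /overlap big_seq1 eqxx mulr1.
- by rewrite /overlap big_seq1 st eqxx mulr1 subr0.
- rewrite !pnatr_eq0 !eqb0 !negbK => /eqP sz /eqP tz; apply: rB.
  by rewrite sz tz.
Qed.

(** The normalized indicators of the sets s^-1 F, for s in G. *)
Lemma exact_approx_folner (G : groupType) (S F : seq G) n : (0 < n)%N ->
  uniq F -> (0 < size F)%N ->
  (forall g, g \in S -> (n * count (fun x => (g * x)%g \notin F) F <= size F)%N) ->
  exact_approx S n%:R^-1 [set g | exists x y, [/\ x \in F, y \in F & g = (x * y^-1)%g]].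
Proof.
move=> n0 uF F0 FS; set m : R := (size F)%:R.
have m0 : 0 < m by rewrite ltr0n.
pose c := (Num.sqrt m)^-1.
have c0 : 0 <= c by rewrite invr_ge0 sqrtr_ge0.
have cc : c * c = m^-1 by rewrite -invfM -expr2 sqr_sqrtr// ltW.
have cn0 : c != 0 by rewrite invr_eq0 sqrtr_eq0 -ltNge.
pose u s z := (s * z \in F)%g%:R * c.
have uE s z : (u s z != 0) = (s * z \in F)%g.
  by rewrite mulf_eq0 negb_or cn0 andbT pnatr_eq0 eqb0 negbK.
pose su (s : G) := [seq (s^-1 * x)%g | x <- F].
have suP s z : (z \in su s) = (s * z \in F)%g.
  apply/mapP/idP => [[x xF ->]|sz]; first by rewrite mulVKg.
  by exists (s * z)%g; rewrite ?mulKg.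
have usu s : uniq (su s) by rewrite map_inj_uniq//; exact: mulgI.
have E s t : overlap (su s) (u s) (u t) =
    (count (fun x => (s * t^-1 * x)%g \in F) F)%:R / m.
  pose U := undup (su s ++ su t).
  have -> : overlap (su s) (u s) (u t) = overlap U (u s) (u t).
    apply: sum_support; rewrite ?undup_uniq// => z; rewrite mulf_eq0 negb_or uE => /andP[sz _].
      by rewrite suP.
    by rewrite mem_undup mem_cat suP sz.
  have := @folner_overlap R _ F s^-1%g t^-1%g U uF (undup_uniq _).
  rewrite !invgK => <-; last first.
    by move=> x xF; rewrite mem_undup mem_cat !suP mulVKg xF orbT.
  by rewrite mulr_suml; apply: eq_bigr => z _; rewrite /u -cc; ring.
exists G, u, su; split=> [s z|s|s|s t sS|s t z].
- by rewrite mulr_ge0.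
- by split=> // z; rewrite uE suP.
- rewrite E ler_pdivrMr// mul1r ler_nat; exact: count_size.
- have cF : (count (fun x => (s * t^-1 * x)%g \in F) F)%:R =
      m - (count (fun x => (s * t^-1 * x)%g \notin F) F)%:R :> R.
    by rewrite /m -(count_predC (fun x => (s * t^-1 * x)%g \in F)) natrD addrK.
  rewrite E cF mulrBl divff ?gt_eqF// lerD2l lerN2.
  rewrite ler_pdivrMr// mulrC ler_pdivlMr ?ltr0n// mulrC -natrM ler_nat.
  exact: FS.
- rewrite !uE => sz tz; exists (s * z)%g, (t * z)%g; split=> //.
  by rewrite invgM mulgA mulgK.
Qed.

Definition exact_approximable (G : groupType) : Prop :=
  forall (S : seq G) (e : R), 0 < e ->
    exists2 B : set G, finite_set B & exact_approx S e B.

(** The argument of [haagerup_second_nilpotent_product], with vectors in the place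
of functions. *)
Theorem exact_approximable_second_nilpotent_product (I : choiceType) (H : I -> groupType) :
  (forall i, exact_approximable (H i)) ->
  exact_approximable (second_nilpotent_product H).
Proof.
move=> hH S e e0.
have [J JP] := common_support S.
have [B1 fB1 a1] : exists2 B, (forall i, i \in J -> finite_set (@proj I H i @` B)) &
    exact_approx S (e / 2) B.
  have e20 : 0 < e / 2 by rewrite divr_gt0.
  elim: J (e / 2) e20 {JP} => [|i J IH] e' e'0.
    exists setT => //; have [Z [u [su [u0 uP u1 uS uB]]]] :=
      @exact_approx_classes (second_nilpotent_product H) unit (fun=> tt) S setT
        (fun _ _ _ => erefl) (fun _ _ _ => Logic.I).
    exists Z, u, su; split=> // s t /uS; apply: le_trans.
    by rewrite lerD2l lerN2 ltW.
  have e'2 : 0 < e' / 2 by rewrite divr_gt0.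
  have [B fB aB] := IH _ e'2.
  have [B' fB' /(exact_approx_pullback (projM i)) aB'] := hH i [seq proj i s | s <- S] _ e'2.
  exists ((@proj I H i @^-1` B') `&` B); last first.
    by rewrite [e'](splitr); apply: exact_approx_mul.
  move=> j; rewrite in_cons => /predU1P[->|jJ].
    by apply: sub_finite_set fB' => _ [x [Bx _] <-].
  by apply: sub_finite_set (fB j jJ); apply: image_subset => x [].
pose r (x : second_nilpotent_product H) : {classic (forall i, H i)} :=
  fun i => if i \in J then 1%g else proj i x.
have a2 : exact_approx S 0 [set g | forall i, i \notin J -> proj i g = 1%g].
  apply: (@exact_approx_classes _ _ r) => [s t st|s t st i iJ].
    apply/functional_extensionality_dep => i; rewrite /r; case: ifPn => // iJ.
    by have := JP _ st i iJ; rewrite projM projV => h; rewrite -[LHS](mulgVK (proj i t)) h mul1g.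
  have := congr1 (fun f : forall i, H i => f i) st; rewrite /r (negPf iJ) => h.
  by rewrite projM projV h mulgV.
pose n := (Num.truncn (2 / e)).+1.
have [F [uF F0 FS]] := folner_quotient S (ltn0Sn _ : 0 < n)%N.
have FS' g : g \in [seq quotient_pi (@same_factor_commutators I H) s | s <- S] ->
    (n * count (fun x => (g * x)%g \notin F) F <= size F)%N.
  by move=> /mapP[s sS ->]; apply: FS.
have a3 := exact_approx_pullback (@quotient_piM _ _)
  (@exact_approx_folner _ _ F n isT uF F0 FS').
exists (B1 `&` [set g | forall i, i \notin J -> proj i g = 1%g] `&`
    quotient_pi (@same_factor_commutators I H) @^-1`
  [set g | exists x y, [/\ x \in F, y \in F & g = (x * y^-1)%g]]).
  apply: (@finite_in_product _ _ J).
  - move=> i iJ; apply: sub_finite_set (fB1 i iJ).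
    by apply: image_subset => x [[]].
  - apply: (@sub_finite_set _ _ [set` [seq (x * y^-1)%g | x <- F, y <- F]]); last exact: finite_seq.
    move=> _ [g [_ /= [x [y [xF yF gE]]]] <-] /=.
    by rewrite gE; apply: allpairs_f.
  - by move=> x y [[_ /= rx] _] [[_ /= ry] _] i iJ; rewrite rx// ry.
have [Z [u [su [u0 uP u1 uS uB]]]] := exact_approx_mul (exact_approx_mul a1 a2) a3.
exists Z, u, su; split=> // s t /uS; apply: le_trans.
rewrite addr0 lerD2l lerN2 [leRHS]splitr lerD2l.
rewrite -[leRHS]invf_div lef_pV2 ?posrE ?ltr0n ?divr_gt0//.
exact: ltW (truncnS_gt _).
Qed.

End ExactApproximation.

(** * From vectors to nuclearity *)

Section FiniteVectors.
Local Open Scope ring_scope.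
Variables (R : realType) (k : nat).
Notation C := R[i].

Definition vec (h : 'I_k -> C) : l2 R 'I_k := trunc [fset i | i : 'I_k]%fset h.

Lemma vecE h i : vec h i = h i.
Proof. by rewrite /vec /= (_ : i \in _)//; apply/imfsetP; exists i. Qed.

Lemma dot_vec (f g : l2 R 'I_k) : l2_dot f g = \sum_i f i * (g i)^*.
Proof.
rewrite (@dot_fset _ _ _ _ [fset i | i : 'I_k]%fset) ?sum_fsetT// => i.
by case/imfsetP; exists i.
Qed.

Lemma l2_norm_vec (f : l2 R 'I_k) : l2_norm f ^+ 2 = \sum_i normc (f i) ^+ 2.
Proof.
apply: complexI; rewrite -dot_self dot_vec rmorph_sum; apply: eq_bigr => i _.
by rewrite mulrC; exact: conj_mul.
Qed.

End FiniteVectors.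

Section Compression.
Local Open Scope ring_scope.
Variables (R : realType) (G : choiceType) (k : nat) (en : 'I_k -> G).
Hypothesis en_inj : injective en.
Notation C := R[i].
Notation imgE := [fset en a | a : 'I_k]%fset.

Definition extend_vec (f : 'I_k -> C) (x : G) : C := \sum_a (en a == x)%:R * f a.

Lemma extend_vecE f a : extend_vec f (en a) = f a.
Proof.
rewrite /extend_vec (bigD1 a)//= eqxx mul1r big1 ?addr0// => b ba.
by rewrite (inj_eq en_inj) (negPf ba) mul0r.
Qed.

Lemma sum_imgE (V : nmodType) (F : G -> V) : \sum_(x <- imgE) F x = \sum_a F (en a).
Proof.
rewrite big_imfset /=; last by move=> a b _ _; exact: en_inj.
by apply: perm_big; apply: uniq_perm; rewrite ?enum_uniq ?index_enum_uniq// => i;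
    rewrite mem_index_enum mem_enum.
Qed.

Definition embed (f : l2 R 'I_k) : l2 R G := trunc imgE (extend_vec f).

Lemma embedE f a : embed f (en a) = f a.
Proof. by rewrite /embed /= (_ : en a \in _) ?extend_vecE//; apply/imfsetP; exists a. Qed.

Lemma embed_notin f x : (forall a, en a != x) -> embed f x = 0.
Proof.
move=> xE; rewrite /embed /=; case: ifP => // /imfsetP[a _ xa].
by have := xE a; rewrite -xa eqxx.
Qed.

Lemma embed_lin : linear embed.
Proof.
move=> c f g; apply: l2_eq => x; rewrite l2_addE l2_scaleE.
have [[a <-]|h] := pselect (exists a, en a = x).
  by rewrite !embedE.
have {}h a : en a != x by apply/eqP => ax; apply: h; exists a.
by rewrite !embed_notin// mulr0 addr0.
Qed.

Lemma dot_embed (h : l2 R G) f : l2_dot h (embed f) = \sum_a h (en a) * (f a)^*.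
Proof. by rewrite /embed dot_trunc sum_imgE; apply: eq_bigr => a _; rewrite extend_vecE. Qed.

Lemma l2_norm_embed f : l2_norm (embed f) = l2_norm f.
Proof.
apply/eqP; rewrite -(@eqrXn2 _ 2)// ?l2_norm_ge0// /embed l2_norm_trunc l2_norm_vec /sqsum sum_imgE.
by apply/eqP; apply: eq_bigr => a _; rewrite extend_vecE.
Qed.

(** The compression of T to the span of the basis vectors indexed by the image of
the injection en. *)
Definition compress (T : l2 R G -> l2 R G) (f : l2 R 'I_k) : l2 R 'I_k :=
  vec (fun a => T (embed f) (en a)).

Lemma dot_compress T f g : l2_dot (compress T f) g = l2_dot (T (embed f)) (embed g).
Proof. by rewrite dot_vec dot_embed; apply: eq_bigr => a _; rewrite vecE. Qed.

Lemma l2_norm_compress T f : bounded_op T ->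
  l2_norm (compress T f) <= op_norm T * l2_norm f.
Proof.
move=> bT; rewrite -(l2_norm_embed f); apply: le_trans (bounded_opP bT _).
rewrite -(@ler_pXn2r _ 2)// ?nnegrE ?l2_norm_ge0// l2_norm_vec.
apply: le_trans (sqsum_l2_norm imgE _); rewrite /sqsum sum_imgE.
by apply: ler_sum => a _; rewrite vecE.
Qed.

Lemma compress_cp : contractive_cp (@bounded_op R G) compress.
Proof.
split.
- move=> T bT; have [lT _] := bT; split.
    move=> c f g; apply: l2_eq => a; rewrite l2_addE l2_scaleE !vecE.
    by rewrite embed_lin lT.
  by exists (op_norm T) => f; apply: l2_norm_compress.
- by move=> c S T _ _; apply/funext => f; apply: l2_eq => a; rewrite [RHS]l2_addE l2_scaleE !vecE.
- move=> n T bT pT f; have := pT (fun i => embed (f i)); congr (0 <= _).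
  by apply: eq_bigr => i _; apply: eq_bigr => j _; rewrite dot_compress.
- move=> T bT; apply: op_norm_le; first exact: op_norm_ge0.
  by move=> f; apply: l2_norm_compress.
Qed.

End Compression.

Section AssembledMap.
Local Open Scope ring_scope.
Variables (R : realType) (G : groupType) (k : nat) (en : 'I_k -> G).
Hypothesis en_inj : injective en.
Notation C := R[i].
Variables (Z : choiceType) (zeta : G -> Z -> R) (supp : G -> seq Z) (y : Z -> G).
Hypothesis zeta0 : forall s z, 0 <= zeta s z.
Hypothesis supp_uniq : forall s, uniq (supp s).
Hypothesis suppP : forall s z, zeta s z != 0 -> z \in supp s.
Hypothesis zeta1 : forall s, overlap (supp s) (zeta s) (zeta s) <= 1.
Hypothesis local : forall s z, zeta s z != 0 -> exists a, s = (en a * y z)%g.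

Let pt (a : 'I_k) (z : Z) : G := (en a * y z)%g.

Let pt_inj z : injective (pt ^~ z).
Proof. by move=> a b /mulIg/en_inj. Qed.

(** The weighted restriction of f to the translate by y z of the finite set
enumerated by en, read as a vector of length k. *)
Definition window (z : Z) (f : G -> C) : l2 R 'I_k :=
  vec (fun a => (zeta (pt a z) z)%:C%C * f (pt a z)).

Lemma windowE z f a : window z f a = (zeta (pt a z) z)%:C%C * f (pt a z).
Proof. exact: vecE. Qed.

(** Makes [assemble] a total function of the matrix and the vector; the default 0
is never taken for bounded M, by [assemble_sqsum]. *)
Definition totalize (h : G -> C) : l2 R G :=
  if pselect (h \in @square_summable R G) is left p then L2 p else 0.

Lemma totalizeE h (M : R) : (forall A, sqsum A h <= M) -> totalize h =1 h.
Proof.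
move=> /square_summableP hs; rewrite /totalize; case: pselect => [p|np] x//.
Qed.

(** The sum over z of W_z^* M W_z f, where W_z is [window z]. *)
Definition assemble_fun (M : l2 R 'I_k -> l2 R 'I_k) (f : G -> C) (s : G) : C :=
  \sum_(z <- supp s) (zeta s z)%:C%C * \sum_a (pt a z == s)%:R * M (window z f) a.

Definition assemble (M : l2 R 'I_k -> l2 R 'I_k) (f : l2 R G) : l2 R G :=
  totalize (assemble_fun M f).

(** The operator f |-> (W_z f)_z is a contraction: the total weight of a point s is
the sum of zeta s z ^ 2, which is at most 1. *)
Lemma window_sum_le (L : seq Z) (f : G -> C) (K : R) : uniq L ->
  (forall A, sqsum A f <= K) -> \sum_(z <- L) l2_norm (window z f) ^+ 2 <= K.
Proof.
move=> uL fK; pose A : {fset G} := [fset x | x in [seq pt a z | a <- enum 'I_k, z <- L]]%fset.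
apply: le_trans (fK A).
have AP a z : z \in L -> pt a z \in A.
  by move=> zL; apply/imfsetP; exists (pt a z) => //=; apply: allpairs_f; rewrite ?mem_enum.
have E z : z \in L -> l2_norm (window z f) ^+ 2 =
    \sum_(s <- A) normc (f s) ^+ 2 * (zeta s z ^+ 2 * \sum_a (pt a z == s)%:R).
  move=> zL; rewrite l2_norm_vec.
  under [RHS]eq_bigr do rewrite !mulr_sumr.
  rewrite [RHS]exchange_big; apply: eq_bigr => a _; rewrite windowE.
  rewrite (bigD1_seq (pt a z)) ?AP ?fset_uniq//= big1 ?addr0.
    rewrite eqxx mulr1 normcM normc_real ger0_norm// exprMn mulrC //.
  by move=> s /negPf sn; rewrite eq_sym sn !mulr0.
rewrite big_seq (eq_bigr _ E) -big_seq exchange_big /=; apply: ler_sum => s _.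
rewrite -mulr_sumr -[leRHS]mulr1 ler_wpM2l ?sqr_ge0//.
apply: le_trans (zeta1 s); pose L' := undup (L ++ supp s).
have LL' : {subset L <= L'} by move=> z zL; rewrite mem_undup mem_cat zL.
have -> : overlap (supp s) (zeta s) (zeta s) = overlap L' (zeta s) (zeta s).
  apply: sum_support; rewrite ?undup_uniq// => z; rewrite mulf_eq0 negb_or => /andP[/suppP zs _] //.
  by rewrite mem_undup mem_cat zs orbT.
rewrite /overlap (sum_subset _ uL (undup_uniq _) LL') -[leLHS]addr0 lerD//; last first.
  by apply: sumr_ge0 => z _; rewrite mulr_ge0.
apply: ler_sum => z _; rewrite -expr2 -[leRHS]mulr1 ler_wpM2l ?sqr_ge0//.
have [/existsP[a /eqP as_]|/existsPn h] := boolP [exists a, pt a z == s].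
  rewrite (bigD1 a)//= as_ eqxx big1 ?addr0// => b ba.
  by rewrite -as_ (inj_eq (@pt_inj z)) (negPf ba).
by rewrite big1// => a _; rewrite (negPf (h a)).
Qed.

(** The adjunction that moves W_z^* to the other side of the inner product. *)
Lemma assemble_fun_dot M (f h : G -> C) (A : {fset G}) (L : seq Z) : uniq L ->
  (forall s, s \in A -> {subset supp s <= L}) ->
  \sum_(s <- A) assemble_fun M f s * (h s)^* =
  \sum_(z <- L) l2_dot (M (window z f)) (window z (trunc A h)).
Proof.
move=> uL AL; transitivity (\sum_(s <- A) \sum_(z <- L)
    ((zeta s z)%:C%C * \sum_a (pt a z == s)%:R * M (window z f) a) * (h s)^*).
  rewrite big_seq [RHS]big_seq; apply: eq_bigr => s sA.
  rewrite -mulr_suml; congr (_ * _); apply: sum_support => // z zn.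
    by apply: suppP; apply: contraNneq zn => ->; rewrite mul0r.
  by apply: AL sA _ _; apply: suppP; apply: contraNneq zn => ->; rewrite mul0r.
rewrite exchange_big /=; apply: eq_bigr => z _; rewrite dot_vec.
transitivity (\sum_(s <- A) \sum_a (pt a z == s)%:R *
    (M (window z f) a * ((zeta s z)%:C%C * (h s)^*))).
  apply: eq_bigr => s _; rewrite mulr_sumr mulr_suml; apply: eq_bigr => a _.
  by ring.
rewrite exchange_big; apply: eq_bigr => a _; rewrite windowE rmorphM /= conjC_real.
case: ifPn => ptA; last first.
  rewrite conjC0 !mulr0 big_seq big1// => s sA; case: eqP => [e|_]; last by rewrite mul0r.
  by move: ptA; rewrite e sA.
rewrite (bigD1_seq (pt a z)) ?fset_uniq//= eqxx mul1r big1 ?addr0// => s /negPf sn.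
by rewrite eq_sym sn mul0r.
Qed.

Lemma supports_cover (A : {fset G}) : exists2 L : seq Z, uniq L &
  forall s, s \in A -> {subset supp s <= L}.
Proof.
exists (undup (flatten [seq supp s | s <- A])); first exact: undup_uniq.
by move=> s sA z zs; rewrite mem_undup; apply/flattenP; exists (supp s) => //; apply: map_f.
Qed.

(** Test the assembled function h against its own truncation to A.  With Q the sum
of the squares of h over A, [assemble_fun_dot] and [window_sum_le] give
2 Q <= m ^ 2 |f| ^ 2 + Q. *)
Lemma assemble_sqsum M (f : l2 R G) (A : {fset G}) : bounded_op M ->
  sqsum A (assemble_fun M f) <= (op_norm M * l2_norm f) ^+ 2.
Proof.
move=> bM; have [L uL AL] := supports_cover A.
set h := assemble_fun M f; set Q := sqsum A h; set m := op_norm M.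
have QE : Q%:C%C = \sum_(z <- L) l2_dot (M (window z f)) (window z (trunc A h)) :> C.
  rewrite -(assemble_fun_dot M f h uL AL) rmorph_sum; apply: eq_bigr => s _.
  by rewrite mulrC -/(h s); symmetry; exact: conj_mul.
have Q0 : 0 <= Q by exact: sqsum_ge0.
have Qle : Q <= \sum_(z <- L) 2^-1 * ((m * l2_norm (window z f)) ^+ 2 + l2_norm (window z (trunc A h)) ^+ 2).
  rewrite -[leLHS](ger0_norm Q0) -normc_real QE (le_trans (normc_sum _ _))//.
  apply: ler_sum => z _; rewrite (le_trans (cauchy_schwarz _ _))//.
  have := bounded_opP bM (window z f); rewrite -/m.
  move: (l2_norm_ge0 (window z (trunc A h))); move: (l2_norm _) (l2_norm _) (m * _) => b a c a0 bc.
  by have := sqr_ge0 (c - a); nra.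
have : Q <= 2^-1 * (m ^+ 2 * l2_norm f ^+ 2 + Q).
  apply: (le_trans Qle); rewrite -mulr_sumr ler_wpM2l ?invr_ge0// big_split /= lerD//.
    under eq_bigr do rewrite exprMn.
    by rewrite -mulr_sumr ler_wpM2l ?sqr_ge0// window_sum_le// => D; apply: sqsum_l2_norm.
  apply: window_sum_le => // D; rewrite /Q -(l2_norm_trunc A h); exact: (sqsum_l2_norm D (trunc A h)).
rewrite exprMn; lra.
Qed.

Lemma assembleE M (f : l2 R G) : bounded_op M -> assemble M f =1 assemble_fun M f.
Proof. by move=> bM; apply: totalizeE => A; apply: assemble_sqsum. Qed.

Lemma l2_norm_assemble M (f : l2 R G) : bounded_op M ->
  l2_norm (assemble M f) <= op_norm M * l2_norm f.
Proof.
move=> bM; apply: l2_norm_le => [|A]; first by rewrite mulr_ge0 ?op_norm_ge0 ?l2_norm_ge0.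
rewrite (_ : sqsum A _ = sqsum A (assemble_fun M f)) ?assemble_sqsum//.
by apply: eq_bigr => s _; rewrite assembleE.
Qed.

Lemma window_lin z c (f g : l2 R G) :
  window z (c *: f + g : l2 R G) = c *: window z f + window z g.
Proof.
apply: l2_eq => a; rewrite [RHS]l2_addE l2_scaleE !windowE.
by rewrite -[l2_fun _ _]/(c * f (pt a z) + g (pt a z)); ring.
Qed.

Lemma assemble_bounded M : bounded_op M -> bounded_op (assemble M).
Proof.
move=> bM; have [lM _] := bM; split; last first.
  by exists (op_norm M) => f; apply: l2_norm_assemble.
move=> c f g; apply: l2_eq => s; rewrite l2_addE l2_scaleE !assembleE//.
rewrite /assemble_fun mulr_sumr -big_split; apply: eq_bigr => z _ /=.
rewrite window_lin lM.
rewrite !mulr_sumr -big_split; apply: eq_bigr => a _; cbv beta; rewrite l2_addE l2_scaleE [RHS]/=.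
by ring.
Qed.

Lemma assemble_cp : contractive_cp (@bounded_op R 'I_k) assemble.
Proof.
split.
- exact: assemble_bounded.
- move=> c S T bS bT; apply/funext => f; apply: l2_eq => s.
  rewrite [RHS]l2_addE l2_scaleE !assembleE//; last exact: bounded_op_lin.
  rewrite /assemble_fun mulr_sumr -big_split; apply: eq_bigr => z _ /=.
  rewrite !mulr_sumr -big_split; apply: eq_bigr => a _; cbv beta.
  rewrite [X in _ * (_ * X) = _](_ : _ = c * S (window z f) a + T (window z f) a)// [RHS]/=.
  by ring.
- move=> n T bT pT; apply: positive_op_matrix_dense => [i j|A h].
    exact: assemble_bounded.
  have [L uL AL] := supports_cover A.
  rewrite (_ : \sum_i _ = \sum_(z <- L) \sum_i \sum_j
      l2_dot (T i j (window z (trunc A (h j)))) (window z (trunc A (h i)))).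
    by apply: sumr_ge0 => z _; apply: pT.
  rewrite [RHS]exchange_big /=; apply: eq_bigr => i _.
  rewrite [RHS]exchange_big /=; apply: eq_bigr => j _.
  rewrite dot_trunc -(assemble_fun_dot _ _ _ uL AL).
  by apply: eq_bigr => s _; rewrite assembleE.
- move=> T bT; apply: op_norm_le; first exact: op_norm_ge0.
  by move=> f; apply: l2_norm_assemble.
Qed.

(** Composed with the compression, the map multiplies the matrix entry (s, t) of a
right-invariant operator by the overlap of zeta s and zeta t: right invariance
is what lets one compression to a finite set serve all its translates. *)
Lemma assemble_compress_left_regular (g : G) (f : l2 R G) s :
  assemble (compress en (@left_regular R G g)) f s =
  (overlap (supp s) (zeta s) (zeta (g^-1 * s)%g))%:C%C * f (g^-1 * s)%g.
Proof.
have [bc _ _ _] := @compress_cp R _ _ _ en_inj.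
rewrite assembleE; last exact: bc (left_regular_bounded _ _).
rewrite /assemble_fun /overlap rmorph_sum mulr_suml; apply: eq_bigr => z _.
rewrite [X in _ = X * _](_ : _ = (zeta s z)%:C%C * (zeta (g^-1 * s)%g z)%:C%C); last exact: rmorphM.
have c0 : (0 : R)%:C%C = 0 :> C by [].
have [->|zn] := eqVneq (zeta s z) 0; first by rewrite !mul0r.
have [a sa] := local zn.
rewrite (bigD1 a)// {1}/pt -sa eqxx mul1r big1; last first.
  move=> b ba; case: eqP => [bs|_]; last by rewrite mul0r.
  by case/eqP: ba; apply: (@pt_inj z); rewrite bs {1}sa.
rewrite -[X in _ * X = _]/(_ + 0) addr0 -mulrA; congr (_ * _).
rewrite vecE left_regularE.
have [[b be]|h] := pselect (exists b, en b = (g^-1 * en a)%g).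
  by rewrite -be embedE// windowE /pt be -mulgA -sa.
have {}h b : en b != (g^-1 * en a)%g by apply/eqP => bg; apply: h; exists b.
rewrite embed_notin//; have [->|zn'] := eqVneq (zeta (g^-1 * s)%g z) 0.
  by rewrite c0 mul0r.
have [b] := local zn'; rewrite [in LHS]sa mulgA => /mulIg be.
by have := h b; rewrite be eqxx.
Qed.

End AssembledMap.

Section ApproximableExact.
Local Open Scope ring_scope.
Variables (R : realType) (G : groupType).
Notation C := R[i].
Notation lam := (@left_regular R G).

(** Each z is given a center y z in the support of zeta in the first variable; by
locality the whole support lies in B times y z, and B is enumerated by en. *)
Lemma exact_approx_factor (S : seq G) (e : R) (B : set G) : 0 <= e -> finite_set B ->
  exact_approx S e B -> exists k (phi : (l2 R G -> l2 R G) -> (l2 R 'I_k -> l2 R 'I_k))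
    (psi : (l2 R 'I_k -> l2 R 'I_k) -> (l2 R G -> l2 R G)),
  [/\ contractive_cp (@bounded_op R G) phi, contractive_cp (@bounded_op R 'I_k) psi &
    forall g, g \in S -> op_norm (psi (phi (lam g)) - lam g) <= e].
Proof.
move=> e0 fB [Z [zeta [supp [z0 zP z1 zS zB]]]].
pose E : seq G := fset_set B; pose en (a : 'I_(size E)) := nth 1%g E a.
have en_inj : injective en.
  move=> a b /eqP; rewrite nth_uniq ?fset_uniq// => /eqP; exact: val_inj.
have BE g : B g -> exists a, en a = g.
  move=> Bg; have gE : g \in E by rewrite in_fset_set ?inE.
  by exists (Ordinal (etrans (index_mem _ _) gE)); rewrite /en /= nth_index.
have /choice[y yP] : forall z, exists y : G, forall s, zeta s z != 0 -> zeta y z != 0.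
  move=> z; have [[y yz]|h] := pselect (exists y, zeta y z != 0); first by exists y.
  by exists 1%g => s sz; case: h; exists s.
have local s z : zeta s z != 0 -> exists a, s = (en a * y z)%g.
  move=> sz; have /BE[a ae] := zB _ _ _ sz (yP _ _ sz).
  by exists a; rewrite ae mulgVK.
have su s : uniq (supp s) by case: (zP s).
have sP s z : zeta s z != 0 -> z \in supp s by case: (zP s) => _; apply.
exists (size E), (compress en), (assemble en zeta supp y); split.
- exact: compress_cp.
- exact: assemble_cp.
move=> g gS; apply: op_norm_le => // f.
apply: (l2_norm_dominated (p := fun x : G => (g^-1 * x)%g)) => //; first exact: mulgI.
move=> s; rewrite -[l2_fun _ _]/(assemble en zeta supp y (compress en (lam g)) f s - f (g^-1 * s)%g).
rewrite assemble_compress_left_regular//.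
set u := overlap _ _ _; rewrite (_ : _ - _ = (u - 1)%:C%C * f (g^-1 * s)%g); last first.
  by rewrite rmorphB rmorph1 mulrBl mul1r.
rewrite normcM normc_real ler_wpM2r ?normc_ge0// ler_norml.
have u1 : u <= 1 by exact: (overlap_le1 (su _) (su _) (sP _) (sP _) (z1 _) (z1 _)).
have : 1 - e <= u by apply: zS; rewrite invgM invgK mulgA mulgV mul1g.
by move=> ue; apply/andP; split; lra.
Qed.

Lemma contractive_cpB (X Y : choiceType) (A : set (l2 R X -> l2 R X))
    (theta : (l2 R X -> l2 R X) -> (l2 R Y -> l2 R Y)) S T :
  contractive_cp A theta -> A S -> A T -> theta (S - T) = theta S - theta T.
Proof.
move=> [_ lin _ _] AS AT; have := lin (-1) T S AT AS.
by rewrite !scaleN1r ![- _ + _]addrC.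
Qed.

Lemma contractive_cp_sum (X Y : choiceType)
    (theta : (l2 R X -> l2 R X) -> (l2 R Y -> l2 R Y)) (I : Type) (r : seq I)
    (a : I -> C) (T : I -> l2 R X -> l2 R X) :
  contractive_cp (@bounded_op R X) theta -> (forall i, bounded_op (T i)) ->
  theta (\sum_(i <- r) a i *: T i) = \sum_(i <- r) a i *: theta (T i).
Proof.
move=> [_ lin _ _] bT; elim: r => [|i r IH]; last first.
  by rewrite !big_cons lin ?IH//; apply: bounded_op_sum.
rewrite !big_nil; have := lin (-1) 0 0 (bounded_op0 _ _) (bounded_op0 _ _).
by rewrite scaler0 addr0 scaleN1r addNr.
Qed.

Lemma op_norm_sum (X : choiceType) (I : eqType) (r : seq I) (a : I -> C)
    (T : I -> l2 R X -> l2 R X) (e : R) : 0 <= e -> (forall i, bounded_op (T i)) ->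
  (forall i, i \in r -> op_norm (T i) <= e) ->
  op_norm (\sum_(i <- r) a i *: T i) <= (\sum_(i <- r) normc (a i)) * e.
Proof.
move=> e0 bT Te; apply: op_norm_le.
  by rewrite mulr_ge0// sumr_ge0// => i _; apply: normc_ge0.
move=> f; rewrite sum_opE; elim: r Te => [|i r IH] Te.
  by rewrite !big_nil !mul0r l2_norm0.
rewrite !big_cons !mulrDl (le_trans (l2_normD _ _))// lerD//; last first.
  by apply: IH => j jr; apply: Te; rewrite in_cons jr orbT.
rewrite -[(_ *: _) f]/(a i *: T i f) l2_normZ -mulrA ler_wpM2l ?normc_ge0//.
rewrite (le_trans (bounded_opP (bT i) _))// ler_wpM2r ?l2_norm_ge0//.
by apply: Te; apply: mem_head.
Qed.

(** On the span of the translations the factorizations converge by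
[exact_approx_factor]; as the maps are contractive, this extends to norm
limits. *)
Theorem exact_of_approximable : exact_approximable R G -> exact_group R G.
Proof.
move=> ea.
have /choice[D DP] : forall sn : seq G * nat, exists D : {k : nat &
    ((l2 R G -> l2 R G) -> (l2 R 'I_k -> l2 R 'I_k)) *
    ((l2 R 'I_k -> l2 R 'I_k) -> (l2 R G -> l2 R G))}%type,
    [/\ contractive_cp (@bounded_op R G) (tagged D).1,
        contractive_cp (@bounded_op R 'I_(tag D)) (tagged D).2 &
        forall g, g \in sn.1 ->
          op_norm ((tagged D).2 ((tagged D).1 (lam g)) - lam g) <= sn.2.+1%:R^-1].
  move=> [S n]; have n0 : 0 < n.+1%:R^-1 :> R by rewrite invr_gt0 ltr0n.
  have [B fB aB] := ea S _ n0; have [k [phi [psi [cphi cpsi h]]]] := exact_approx_factor (ltW n0) fB aB.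
  by exists (existT _ k (phi, psi)).
exists (seq G * nat)%type, (@fin_net G), (fun j => tag (D j)),
  (fun j => (tagged (D j)).1), (fun j => (tagged (D j)).2); split.
- exact: fin_net_proper.
- move=> j; have [[c1 c2 c3 c4] _ _] := DP j; split.
  + by move=> T [bT _]; apply: c1.
  + by move=> a S T [bS _] [bT _]; apply: c2.
  + by move=> n T bT; apply: c3 => i l; have [] := bT i l.
  + by move=> T [bT _]; apply: c4.
- by move=> j; have [_ ? _] := DP j.
move=> T [bT appr]; apply/cvgrPdist_le => e e0.
have e3 : 0 < e / 3 by rewrite divr_gt0.
have [s [a sa]] := appr _ e3; set T' := \sum_(g <- s) _ in sa.
have bT' : bounded_op T' by apply: bounded_op_sum => g; exact: left_regular_bounded.
pose K := \sum_(g <- s) normc (a g).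
have K0 : 0 <= K by apply: sumr_ge0 => g _; apply: normc_ge0.
exists (s, Num.truncn (K / (e / 3))) => // -[S n] /= [sS nK].
have [cphi cpsi near] := DP (S, n).
move: (D (S, n)) cphi cpsi near => -[k [phi psi]] /= cphi cpsi near.
have [bphi _ _ nphi] := cphi; have [bpsi _ _ npsi] := cpsi.
have bB (X : choiceType) (U V : l2 R X -> l2 R X) : bounded_op U -> bounded_op V -> bounded_op (U - V).
  by move=> bU bV; rewrite addrC -scaleN1r; apply: bounded_op_lin.
have bp U : bounded_op U -> bounded_op (psi (phi U)) by move=> /bphi/bpsi.
have e1 : op_norm (psi (phi (T - T'))) <= e / 3.
  rewrite (le_trans (npsi _ _))//; first exact/bphi/bB.
  by rewrite (le_trans (nphi _ _)) ?ltW//; exact: bB.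
have e2 : op_norm (psi (phi T') - T') <= e / 3.
  have -> : psi (phi T') - T' = \sum_(g <- s) a g *: (psi (phi (lam g)) - lam g).
    rewrite /T' (contractive_cp_sum _ _ cphi); last by move=> g; exact: left_regular_bounded.
    rewrite (contractive_cp_sum _ _ cpsi); last by move=> g; apply/bphi/left_regular_bounded.
    by rewrite -sumrB; apply: eq_bigr => g _; rewrite scalerBr.
  rewrite (le_trans (op_norm_sum _ (e := n.+1%:R^-1) _ _ _)) ?invr_ge0//.
  - by move=> g; apply: bB; [apply/bp|]; exact: left_regular_bounded.
  - by move=> g gs; apply: near; apply: sS.
  rewrite -/K ler_pdivrMr ?ltr0n// mulrC -ler_pdivrMr//.
  by rewrite (le_trans (ltW (truncnS_gt _)))// ler_nat ltnS.
have bd : bounded_op (psi (phi T) - T) by apply: bB => //; apply: bp.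
rewrite sub0r normrN ger0_norm ?op_norm_ge0//; apply: op_norm_le => [|f]; first exact: ltW.
have -> : (psi (phi T) - T) f = psi (phi (T - T')) f + (psi (phi T') - T') f - (T - T') f.
  rewrite (contractive_cpB cphi)// (contractive_cpB cpsi); [|exact: bphi|exact: bphi].
  rewrite -[(_ - _) f]/(psi (phi T) f - T f) -[(_ - _) f]/(psi (phi T) f - psi (phi T') f).
  rewrite -[(_ - _) f]/(psi (phi T') f - T' f) -[(T - T') f]/(T f - T' f).
  by rewrite opprB addrA subrKA subrK.
rewrite (le_trans (l2_normD _ _))// l2_normN.
have -> : e * l2_norm f = e / 3 * l2_norm f + e / 3 * l2_norm f + e / 3 * l2_norm f by field.
apply: lerD; [apply: le_trans (l2_normD _ _) _; apply: lerD|].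
- apply: le_trans (bounded_opP (bp _ (bB _ _ _ bT bT')) f) _.
  by apply: ler_wpM2r => //; apply: l2_norm_ge0.
- apply: le_trans (bounded_opP (bB _ _ _ (bp _ bT') bT') f) _.
  by apply: ler_wpM2r => //; apply: l2_norm_ge0.
- apply: le_trans (bounded_opP (bB _ _ _ bT bT') f) _.
  by apply: ler_wpM2r; [exact: l2_norm_ge0|exact: (ltW sa)].
Qed.

End ApproximableExact.

(** * Separation from a convex cone *)

Section ConeSeparation.
Local Open Scope ring_scope.
Variables (R : realType) (X : finType) (K : set (X -> R)).
Hypothesis K0 : K (fun=> 0).
Hypothesis KD : forall c c', K c -> K c' -> K (fun x => c x + c' x).
Hypothesis KZ : forall t c, 0 <= t -> K c -> K (fun x => t * c x).

(** The functional a is c - p for c a point of the cone whose distance to p is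
within tau ^ 2 of the minimum.  Moving from c in the direction of a vector of
the cone, or towards 0, cannot decrease the distance by more than that, which
gives the two estimates.  Allowing the error th avoids taking the closure of
the cone. *)
Lemma cone_separation (p : X -> R) (d th : R) : 0 < d -> 0 < th ->
  (forall c, K c -> exists x, d < `|p x - c x|) ->
  exists a : X -> R, (forall v, K v -> - th * \sum_x `|v x| <= \sum_x a x * v x) /\
    \sum_x a x * p x <= - d ^+ 2 + th.
Proof.
move=> d0 th0 far; pose Q (c : X -> R) := \sum_x (c x - p x) ^+ 2.
pose P0 := \sum_x p x ^+ 2.
have P0_ge0 : 0 <= P0 by apply: sumr_ge0 => x _; apply: sqr_ge0.
pose M := 2 * P0 + 2 * (P0 + 1).
have M0 : 0 <= M by rewrite /M; lra.
pose tau := Num.min 1 (th / (1 + M)).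
have M1 : 0 < 1 + M by rewrite ltr_pwDl.
have tau0 : 0 < tau by rewrite lt_min ltr01 divr_gt0.
have tau1 : tau <= 1 by rewrite ge_min lexx.
have tauM : tau * (1 + M) <= th by rewrite -ler_pdivlMr// ge_min lexx orbT.
have tauth : tau <= th by nra.
have QD c v t : Q (fun x => c x + t * v x) =
    Q c + 2 * t * (\sum_x (c x - p x) * v x) + t ^+ 2 * \sum_x v x ^+ 2.
  by rewrite /Q !mulr_sumr -!big_split /=; apply: eq_bigr => x _; ring.
pose D := [set Q c | c in K].
have Dinf : has_inf D.
  split; first by exists (Q (fun=> 0)); exists (fun=> 0).
  by exists 0 => _ [c _ <-]; apply: sumr_ge0 => x _; apply: sqr_ge0.
have infQ c : K c -> inf D <= Q c.
  by move=> Kc; apply: ge_inf; [exact: Dinf.2|exists c].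
have [_ [c Kc <-] cmin] := inf_adherent (exprn_gt0 2 tau0) Dinf.
have dP0 : inf D <= P0.
  apply: (le_trans (infQ _ K0)); rewrite /Q /P0; apply: ler_sum => x _.
  by rewrite sub0r sqrrN.
have cM : \sum_x c x ^+ 2 <= M.
  have : \sum_x c x ^+ 2 <= 2 * Q c + 2 * P0.
    rewrite /Q /P0 !mulr_sumr -big_split /=; apply: ler_sum => x _.
    by have := sqr_ge0 (c x - 2 * p x); rewrite !expr2; lra.
  have t2 : tau ^+ 2 <= 1 by rewrite expr_le1 ?(ltW tau0).
  by rewrite /M; lra.
exists (fun x => c x - p x); split.
- move=> v Kv; set n1 := \sum_x `|v x|.
  have v_le x : `|v x| <= n1.
    by rewrite /n1 (bigD1 x)//= lerDl sumr_ge0.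
  have n0 : 0 <= n1 by apply: sumr_ge0 => x _.
  have [n10|n10] := eqVneq n1 0.
    rewrite n10 mulr0 big1// => x _.
    by have := v_le x; rewrite n10 normr_le0 => /eqP ->; rewrite mulr0.
  have n1p : 0 < n1 by rewrite lt_def n10.
  have v2 : \sum_x v x ^+ 2 <= n1 ^+ 2.
    rewrite expr2 {1}/n1 mulr_suml; apply: ler_sum => x _.
    by rewrite -real_normK ?num_real// expr2 ler_wpM2l.
  pose t := tau / n1.
  have t0 : 0 < t by rewrite divr_gt0.
  have tn : t * n1 = tau by rewrite /t mulfVK.
  have := infQ _ (KD Kc (KZ (ltW t0) Kv)); rewrite QD.
  set A := \sum_x _ * v x; set B := \sum_x v x ^+ 2 => h.
  have tB : t ^+ 2 * B <= tau ^+ 2.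
    have -> : tau ^+ 2 = t ^+ 2 * n1 ^+ 2 by rewrite -exprMn tn.
    by apply: ler_wpM2l => //; apply: sqr_ge0.
  have tA : - tau ^+ 2 <= t * A by lra.
  have : - (tau * n1) <= A.
    rewrite -(ler_pM2l t0) mulrN mulrCA tn.
    by move: tA; rewrite expr2.
  by apply: le_trans; rewrite mulNr lerN2 ler_wpM2r.
- have := infQ _ (KZ (_ : 0 <= 1 - tau) Kc).
  rewrite subr_ge0 => /(_ tau1).
  rewrite (_ : (fun x => (1 - tau) * c x) = (fun x => c x + (- tau) * c x)); last first.
    by apply/funext => x; ring.
  rewrite QD; set A := \sum_x _ * c x => h.
  have Ath : A <= th.
    have : 2 * tau * A <= tau ^+ 2 * (1 + M).
      have : tau ^+ 2 * \sum_x c x ^+ 2 <= tau ^+ 2 * M by rewrite ler_wpM2l ?sqr_ge0.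
      by rewrite sqrrN in h; lra.
    rewrite expr2 -mulrA => h2.
    have : tau * A <= tau * th by nra.
    by rewrite ler_pM2l.
  have dQ : d ^+ 2 <= Q c.
    have [x dx] := far c Kc; rewrite /Q (bigD1 x)//=.
    have : d ^+ 2 <= (c x - p x) ^+ 2.
      by rewrite -[leRHS]real_normK ?num_real// ler_pXn2r ?nnegrE ?(ltW d0)// distrC ltW.
    move=> /le_trans; apply; rewrite lerDl; apply: sumr_ge0 => y _; exact: sqr_ge0.
  have -> : \sum_x (c x - p x) * p x = A - Q c.
    by rewrite /A /Q -sumrB; apply: eq_bigr => x _; ring.
  lra.
Qed.

End ConeSeparation.

(** * Completely positive maps on the reduced C*-algebra *)

Section LeftRegularUnitary.
Local Open Scope ring_scope.
Variables (R : realType) (G : groupType).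
Notation C := R[i].
Notation lam := (@left_regular R G).

#[local] Existing Instance summability.totally_filter.

Lemma left_regularM (g h : G) f : lam g (lam h f) = lam (g * h)%g f.
Proof. by apply: l2_eq => x; rewrite !left_regularE invgM mulgA. Qed.

Lemma left_regular1 f : lam 1%g f = f.
Proof. by apply: l2_eq => x; rewrite left_regularE invg1 mul1g. Qed.

Lemma dot_left_regular (g : G) (f h : l2 R G) : l2_dot (lam g f) (lam g h) = l2_dot f h.
Proof.
apply: dot_unique; apply: cvg_normc => e e0.
have [A _ AP] := normc_cvg _ (@dot_cvg _ _ f h) e0.
exists [fset (g * x)%g | x in A]%fset => // B /= /fsubsetP AB.
have -> : pdot (lam g f) (lam g h) B = pdot f h [fset (g^-1 * x)%g | x in B]%fset.
  rewrite /pdot big_imfset /=; last by move=> x y _ _; exact: mulgI.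
  by apply: eq_bigr => x _.
apply: AP => /=; apply/fsubsetP => x xA; apply/imfsetP; exists (g * x)%g; rewrite ?mulKg//.
by apply: AB; apply/imfsetP; exists x.
Qed.

Lemma dot_left_regularV (g : G) (f h : l2 R G) :
  l2_dot (lam g^-1%g f) h = l2_dot f (lam g h).
Proof. by rewrite -(dot_left_regular g) left_regularM mulgV left_regular1. Qed.

Lemma left_regular_cstar (g : G) : reduced_cstar (lam g).
Proof.
have := reduced_cstar_span [:: tt] (fun=> 1 : C) (fun=> g).
by rewrite big_seq1 scale1r.
Qed.

Definition delta (X : choiceType) (x : X) : l2 R X := trunc [fset x]%fset (fun=> 1).

Lemma deltaE (X : choiceType) (x y : X) : delta x y = (y == x)%:R.
Proof. by rewrite /delta /= in_fset1; case: eqP. Qed.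

Lemma dot_delta (X : choiceType) (f : l2 R X) x : l2_dot f (delta x) = f x.
Proof. by rewrite dot_trunc big_seq_fset1 conjC1 mulr1. Qed.

Lemma l2_norm_delta (X : choiceType) (x : X) : l2_norm (delta x) = 1.
Proof.
apply/eqP; rewrite -(@eqrXn2 _ 2)// ?l2_norm_ge0// l2_norm_trunc /sqsum big_seq_fset1.
by rewrite normc_one.
Qed.

Lemma normc_entry (X : choiceType) (T : l2 R X -> l2 R X) x y : bounded_op T ->
  normc (T (delta x) y) <= op_norm T.
Proof.
move=> bT; rewrite -dot_delta (le_trans (cauchy_schwarz _ _))// l2_norm_delta mulr1.
by rewrite (le_trans (bounded_opP bT _))// l2_norm_delta mulr1.
Qed.

End LeftRegularUnitary.

Section VectorApproximation.
Local Open Scope ring_scope.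
Variables (R : realType) (G : groupType) (k : nat).
Notation C := R[i].
Notation lam := (@left_regular R G).
Variable phi : (l2 R G -> l2 R G) -> (l2 R 'I_k -> l2 R 'I_k).
Hypothesis phi_cp : contractive_cp (@reduced_cstar R G) phi.

Lemma dot_sumr (X : choiceType) I (r : seq I) (F : I -> l2 R X) g :
  l2_dot g (\sum_(i <- r) F i) = \sum_(i <- r) l2_dot g (F i).
Proof.
rewrite dot_conj dot_suml rmorph_sum; apply: eq_bigr => i _; symmetry.
exact: dot_conj.
Qed.

(** The value of the form is the square of the norm of the sum of the vectors
lam (x j) (f j). *)
Lemma left_regular_positive n (x : 'I_n -> G) :
  positive_op_matrix (fun i j => lam ((x i)^-1 * x j)%g).
Proof.
move=> f; rewrite (_ : \sum_i _ = l2_dot (\sum_j lam (x j) (f j)) (\sum_i lam (x i) (f i))).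
  by rewrite dot_self ler0c sqr_ge0.
rewrite dot_suml exchange_big; apply: eq_bigr => j _ /=.
by rewrite dot_sumr; apply: eq_bigr => i _; rewrite -left_regularM dot_left_regularV.
Qed.

Definition coefficient (g : G) (a b : 'I_k) : C := phi (lam g) (delta R b) a.

Lemma phi_linear T : reduced_cstar T -> linear (phi T).
Proof. by case: phi_cp => + _ _ _ => /[apply] -[]. Qed.

(** Complete positivity on the 2 x 2 matrix of [left_regular_positive] for the
points 1 and g. *)
Lemma coefficient_hermitian g a b : coefficient g^-1%g a b = (coefficient g b a)^*.
Proof.
pose x (i : 'I_2) : G := if i == ord0 then 1%g else g.
pose u (i : 'I_2) : l2 R 'I_k := if i == ord0 then delta R b else delta R a.
pose T (i j : 'I_2) := lam ((x i)^-1 * x j)%g.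
have pw : psd (fun i j => l2_dot (phi (T i j) (u j)) (u i)).
  have [_ _ pos _] := phi_cp => c.
  have := pos 2 T (fun i j => left_regular_cstar _ _) (left_regular_positive x) (fun i => c i *: u i).
  congr (0 <= _); apply: eq_bigr => i _; apply: eq_bigr => j _.
  have lin := phi_linear (left_regular_cstar R ((x i)^-1 * x j)%g).
  have -> : phi (T i j) (c j *: u j) = c j *: phi (T i j) (u j).
    by have := linear_sum [:: tt] (fun=> c j) (fun=> u j) lin; rewrite !big_seq1.
  by rewrite dotZl dotZr -conjcE; ring.
have := psd_hermitian ord_max ord0 pw.
by rewrite /T /x /u /= invg1 mulg1 mul1g !dot_delta.
Qed.

Lemma phi_sum (Q : eqType) (r : seq Q) (c : Q -> C) (g : Q -> G) :
  phi (\sum_(q <- r) c q *: lam (g q)) = \sum_(q <- r) c q *: phi (lam (g q)).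
Proof.
have [_ lin _ _] := phi_cp; elim: r => [|q r IH]; last first.
  rewrite !big_cons lin ?IH//; first exact: left_regular_cstar.
  exact: reduced_cstar_span.
have A0 : @reduced_cstar R G 0.
  by have := reduced_cstar_span [::] (fun=> 1 : C) (fun _ : unit => 1%g : G); rewrite big_nil.
by rewrite !big_nil; have := lin (-1) 0 0 A0 A0; rewrite scaler0 addr0 scaleN1r addNr.
Qed.

Definition part (b : bool) (z : C) : R := if b then complex.Re z else complex.Im z.

Lemma partD b (z w : C) : part b (z + w) = part b z + part b w.
Proof. by case: z w => ? ? [? ?]; case: b. Qed.

Lemma part_sum b I (r : seq I) (F : I -> C) :
  part b (\sum_(i <- r) F i) = \sum_(i <- r) part b (F i).
Proof.
elim: r => [|i r IH]; first by rewrite !big_nil; case: b.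
by rewrite !big_cons partD IH.
Qed.

Lemma part_le b (z : C) : `|part b z| <= normc z.
Proof.
case: z => x y; rewrite -sqrtr_sqr; case: b; rewrite /= ler_sqrt ?addr_ge0 ?sqr_ge0//.
  by rewrite lerDl sqr_ge0.
by rewrite lerDr sqr_ge0.
Qed.

Lemma normc_le_part (z : C) (d : R) : (forall b, `|part b z| <= d) -> normc z <= d + d.
Proof.
move=> zd; have := zd true; have := zd false; case: z zd => x y _ /= yd xd.
have d0 : 0 <= d := le_trans (normr_ge0 _) xd.
rewrite -[leRHS]ger0_norm ?addr_ge0// -sqrtr_sqr ler_sqrt ?sqr_ge0//.
have sq (z : R) : `|z| <= d -> z ^+ 2 <= d ^+ 2.
  by move=> zd; rewrite -[leLHS]real_normK ?num_real// ler_pXn2r ?nnegrE.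
by have := sq _ xd; have := sq _ yd; have := sqr_ge0 d; rewrite sqrrD mulr2n; nra.
Qed.

Section Hermitian.
Variables (m : nat) (gs : 'I_m -> G).
Notation Y := ('I_m * 'I_k * 'I_k)%type.
Notation Q := (('I_m + 'I_m) + 'I_1)%type.
Variables (al : Y -> C) (th : R).

(** Coefficients of the matrix over the group algebra with entries
sum_i al_i,a,b g_i plus its adjoint plus th times the identity; the three
summands of the index type stand for these three terms, and [herm_elt] gives
the group elements. *)
Definition herm_coef (a b : 'I_k) (q : Q) : C :=
  match q with
  | inl (inl i) => al (i, a, b)
  | inl (inr i) => (al (i, b, a))^*
  | inr _ => (th * (a == b)%:R)%:C%C
  end.

Definition herm_elt (q : Q) : G :=
  match q with inl (inl i) => gs i | inl (inr i) => (gs i)^-1%g | inr _ => 1%g end.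

(** A functional E that is hermitian takes on that matrix twice the real part of
its value on the first term, plus the contribution of the identity. *)
Lemma herm_eval (E : G -> 'I_k -> 'I_k -> C) :
  (forall g a b, E g^-1%g a b = (E g b a)^*) ->
  \sum_a \sum_b \sum_(q : Q) herm_coef a b q * E (herm_elt q) a b =
  (part true (\sum_(y : Y) al y * E (gs y.1.1) y.1.2 y.2) * 2)%:C%C
   + th%:C%C * \sum_a E 1%g a a.
Proof.
move=> EV; set S := \sum_(y : Y) _.
have Re2 (z : C) : (part true z * 2)%:C%C = z + z^*.
  rewrite -conjcE; case: z => x y; apply/eqP; rewrite eq_complex /=; apply/andP.
  by split; apply/eqP; ring.
rewrite Re2; have SE : S = \sum_a \sum_b \sum_i al (i, a, b) * E (gs i) a b.
  transitivity (\sum_(p : 'I_m * 'I_k) \sum_b al (p, b) * E (gs p.1) p.2 b).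
    by rewrite /S pair_bigA; apply: eq_bigr => -[[i a] b] _.
  transitivity (\sum_i \sum_a \sum_b al (i, a, b) * E (gs i) a b).
    by rewrite [RHS]pair_bigA; apply: eq_bigr => -[i a] _.
  by rewrite exchange_big; apply: eq_bigr => a _; exact: exchange_big.
have SE' : S^* = \sum_a \sum_b \sum_i (al (i, b, a))^* * E (gs i)^-1%g a b.
  rewrite SE rmorph_sum; under eq_bigr do rewrite rmorph_sum.
  rewrite exchange_big; apply: eq_bigr => a _; apply: eq_bigr => b _.
  by rewrite rmorph_sum; apply: eq_bigr => i _; rewrite EV rmorphM.
rewrite SE' SE mulr_sumr -!big_split; apply: eq_bigr => a _ /=.
have -> : th%:C%C * E 1%g a a = \sum_b (th * (a == b)%:R)%:C%C * E 1%g a b.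
  rewrite (bigD1 a)//= eqxx mulr1 big1 ?addr0// => b ba.
  by rewrite eq_sym (negPf ba) mulr0 mul0r.
rewrite -!big_split; apply: eq_bigr => b _ /=.
by rewrite !big_sumType /= big_ord1.
Qed.

End Hermitian.

Local Notation idx m := ('I_m * 'I_k * 'I_k)%type.

(** The families of coefficients of sums of vector functionals with finitely
supported vectors form a convex cone.  If that of phi were at distance more
than d / 2, [cone_separation] would provide coefficients al such that the
associated hermitian matrix, corrected by a small multiple th' of the identity,
is positive on finitely supported vectors, hence positive, while the value of
phi on it is negative; this contradicts complete positivity. *)
Lemma vector_approximation m (gs : 'I_m -> G) (d : R) : 0 < d ->
  exists n (xi : 'I_n -> 'I_k -> l2 R G) (A : {fset G}),
    (forall r a x, x \notin A -> xi r a x = 0) /\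
    forall i a b, normc (coefficient (gs i) a b -
      \sum_r l2_dot (lam (gs i) (xi r b)) (xi r a)) <= d.
Proof.
move=> d0; apply: contrapT => none.
pose E n (xi : 'I_n -> 'I_k -> l2 R G) (y : (idx m)) : C :=
  \sum_r l2_dot (lam (gs y.1.1) (xi r y.2)) (xi r y.1.2).
pose K := [set v : (idx m) * bool -> R | exists n (xi : 'I_n -> 'I_k -> l2 R G) (A : {fset G}),
  (forall r a x, x \notin A -> xi r a x = 0) /\
  forall x, v x = part x.2 (E n xi x.1)].
have K0 : K (fun=> 0).
  exists 0%N, (fun _ _ => 0), fset0; split=> // x.
  by rewrite /E big_ord0; case: (x.2).
have KD c c' : K c -> K c' -> K (fun x => c x + c' x).
  move=> [n [xi [A [xiA cE]]]] [n' [xi' [A' [xiA' cE']]]].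
  exists (n + n')%N, (fun r : 'I_(n + n') => match fintype.split r with
    inl i => xi i | inr j => xi' j end), (A `|` A')%fset.
  split=> [r a x|x].
    rewrite in_fsetU negb_or => /andP[xA xA'].
    by case: (fintype.split r) => j; [apply: xiA|apply: xiA'].
  rewrite cE cE' /E big_split_ord /= partD; congr (part _ _ + part _ _).
    apply: eq_bigr => r _; case: splitP => j /= e; last by have := ltn_ord r; rewrite e ltnNge leq_addr.
    by have -> : r = j by apply: val_inj.
  apply: eq_bigr => r _; case: splitP => j /= e; first by have := ltn_ord j; rewrite -e ltnNge leq_addr.
  by have -> : r = j by apply: val_inj; exact: addnI e.
have KZ t c : 0 <= t -> K c -> K (fun x => t * c x).
  move=> t0 [n [xi [A [xiA cE]]]].
  exists n, (fun r a => (Num.sqrt t)%:C%C *: xi r a), A; split=> [r a x xA|x].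
    by rewrite l2_scaleE xiA// mulr0.
  rewrite cE; have -> : E n (fun r a => (Num.sqrt t)%:C%C *: xi r a) x.1 = t%:C%C * E n xi x.1.
    rewrite /E mulr_sumr; apply: eq_bigr => r _.
        have -> : lam (gs x.1.1.1) ((Num.sqrt t)%:C%C *: xi r x.1.2) =
          (Num.sqrt t)%:C%C *: lam (gs x.1.1.1) (xi r x.1.2).
      by apply: l2_eq.
    by rewrite dotZl dotZr conjC_real mulrA -rmorphM -expr2 sqr_sqrtr.
  by case: (E n xi x.1) => u w; case: (x.2); rewrite /= ?mul0r ?subr0 ?addr0//; ring.
pose p (x : (idx m) * bool) := part x.2 (coefficient (gs x.1.1.1) x.1.1.2 x.1.2).
have far c : K c -> exists x, d / 2 < `|p x - c x|.
  move=> [n [xi [A [xiA cE]]]]; apply: contrapT => near; apply: none.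
  exists n, xi, A; split=> // i a b; rewrite [leRHS]splitr; apply: normc_le_part => e.
  have := near; move=> /forallNP/(_ ((i, a, b), e)) /negP; rewrite -leNgt; apply: le_trans.
  rewrite cE /p /=; have -> : forall z w : C, part e (z - w) = part e z - part e w.
    by case=> [? ?] [? ?]; case: e.
  by [].
have d20 : 0 < d / 2 by rewrite divr_gt0.
(* The sum of the moduli of the coefficients of xi is at most kap times the sum
   of the squared norms of the vectors. *)
pose kap : R := 2 * (#|{: (idx m)}|)%:R.
have kap0 : 0 <= kap by rewrite mulr_ge0.
pose F1 := part true (\sum_a coefficient 1%g a a).
(* Small enough for the corrections, th itself and th * kap * F1, to add up to
   half the gap (d / 2) ^ 2. *)
pose th := (d / 2) ^+ 2 / (2 * (1 + kap * `|F1|)).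
have den : 0 < 1 + kap * `|F1| by rewrite ltr_pwDl// mulr_ge0.
have th0 : 0 < th by rewrite divr_gt0 ?exprn_gt0// mulr_gt0.
have [a [aK ap]] := cone_separation K0 KD KZ d20 th0 far.
pose al (y : (idx m)) : C := Complex (a (y, true)) (- a (y, false)).
have pair (F : (idx m) -> C) : \sum_x a x * part x.2 (F x.1) = part true (\sum_y al y * F y).
  rewrite part_sum; transitivity (\sum_y \sum_e a (y, e) * part e (F y)).
    by rewrite pair_bigA; apply: eq_bigr => -[y e] _.
  apply: eq_bigr => y _; rewrite big_bool /al; case: (F y) => u w /=; ring.
pose th' := 2 * th * kap.
pose B a b : l2 R G -> l2 R G :=
  \sum_(q <- index_enum (('I_m + 'I_m) + 'I_1)%type) herm_coef al th' a b q *: lam (herm_elt gs q).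
have BA i j : reduced_cstar (B i j) by exact: reduced_cstar_span.
have Bpos : positive_op_matrix B.
  apply: positive_op_matrix_dense => [i j|A h]; first by case: (BA i j).
  pose xi i : l2 R G := trunc A (h i).
  pose E1 g i j := l2_dot (lam g (xi j)) (xi i).
  have -> : \sum_i \sum_j l2_dot (B i j (trunc A (h j))) (trunc A (h i)) =
      \sum_i \sum_j \sum_(q : ('I_m + 'I_m) + 'I_1) herm_coef al th' i j q * E1 (herm_elt gs q) i j.
    apply: eq_bigr => i _; apply: eq_bigr => j _; rewrite /B sum_opE dot_suml.
    by apply: eq_bigr => q _; rewrite -dotZl.
  rewrite herm_eval; last by move=> g i j; rewrite /E1 dot_left_regularV dot_conj.
  set rho := part true _; pose N := \sum_i l2_norm (xi i) ^+ 2.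
  have -> : \sum_i E1 1%g i i = N%:C%C.
    by rewrite rmorph_sum; apply: eq_bigr => i _; rewrite /E1 left_regular1 dot_self.
  rewrite -rmorphM -rmorphD /= ler0c.
  pose v (x : (idx m) * bool) := part x.2 (E1 (gs x.1.1.1) x.1.1.2 x.1.2).
  have Kv : K v.
    exists 1%N, (fun _ => xi), A; split=> [_ i x xA|x]; first by rewrite /xi /= (negPf xA).
    by rewrite /E big_ord1.
  have rhoE : \sum_x a x * v x = rho.
    by rewrite /rho -pair.
  have xiN i : l2_norm (xi i) ^+ 2 <= N.
    by rewrite /N (bigD1 i)//= lerDl sumr_ge0// => j _; exact: sqr_ge0.
  have vN : \sum_x `|v x| <= kap * N.
    have -> : kap * N = \sum_(y : (idx m)) \sum_(e : bool) N.
      rewrite /kap; under eq_bigr do rewrite big_bool.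
      by rewrite sumr_const -mulr_natl /=; ring.
    rewrite (pair_bigA _ (fun _ _ => N)); apply: ler_sum => -[[[i j] l] e] _.
    rewrite /v (le_trans (part_le _ _))// (le_trans (cauchy_schwarz _ _))//=.
    have := left_regular_norm (gs i) (xi l).
    have := xiN j; have := xiN l.
    move: (l2_norm_ge0 (xi j)) (l2_norm_ge0 (xi l)) (l2_norm_ge0 (lam (gs i) (xi l))).
    move: (l2_norm (xi j)) (l2_norm (xi l)) (l2_norm (lam _ _)) => u w z u0 w0 z0 wN uN zw.
    have zu : z * u <= w * u by rewrite ler_wpM2r.
    by have := sqr_ge0 (w - u); rewrite sqrrB !expr2 in wN uN *; lra.
  have := aK v Kv; rewrite rhoE => rho_ge.
  have : th * (\sum_x `|v x|) <= th * (kap * N) by rewrite ler_wpM2l// ltW.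
  by rewrite /th'; lra.
have [_ _ /(_ k B BA Bpos) pos _] := phi_cp.
have := pos (fun i => delta R i).
have -> : \sum_i \sum_j l2_dot (phi (B i j) (delta R j)) (delta R i) =
    \sum_i \sum_j \sum_(q : ('I_m + 'I_m) + 'I_1) herm_coef al th' i j q * coefficient (herm_elt gs q) i j.
  apply: eq_bigr => i _; apply: eq_bigr => j _; rewrite /B phi_sum sum_opE dot_suml.
  by apply: eq_bigr => q _; rewrite dotZl dot_delta.
rewrite herm_eval; last by move=> g i j; exact: coefficient_hermitian.
have -> : part true (\sum_y al y * coefficient (gs y.1.1) y.1.2 y.2) = \sum_x a x * p x.
  by rewrite -pair.
have ReP (z : C) : 0 <= z -> 0 <= part true z by rewrite lecE => /andP[].
move=> /ReP; rewrite partD (_ : part true (th'%:C%C * _) = th' * F1); last first.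
  by rewrite /F1; case: (\sum_a _) => u w /=; ring.
rewrite -[part true _%:C%C]/((\sum_x a x * p x) * 2).
have thE : th * (1 + kap * `|F1|) = (d / 2) ^+ 2 / 2.
  by rewrite /th; field; rewrite gt_eqF.
have := exprn_gt0 2 d20.
have F1le : th * kap * F1 <= th * kap * `|F1|.
  by rewrite ler_wpM2l ?ler_norm// mulr_ge0// ltW.
move: ap thE F1le; rewrite /th'; set S := \sum_x _; lra.
Qed.

End VectorApproximation.

(** * From nuclearity to vectors *)

Section MatrixUnits.
Local Open Scope ring_scope.
Variables (R : realType) (k : nat).
Notation C := R[i].

Definition matrix_unit (a b : 'I_k) (f : l2 R 'I_k) : l2 R 'I_k := f b *: delta R a.

Lemma normc_le_l2_norm (X : choiceType) (f : l2 R X) x : normc (f x) <= l2_norm f.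
Proof.
by rewrite -dot_delta (le_trans (cauchy_schwarz _ _))// l2_norm_delta mulr1.
Qed.

Lemma matrix_unit_bounded a b : bounded_op (matrix_unit a b).
Proof.
split; last first.
  exists 1 => f; rewrite mul1r l2_normZ l2_norm_delta mulr1; exact: normc_le_l2_norm.
by move=> c f g; rewrite /matrix_unit l2_addE l2_scaleE scalerDl scalerA.
Qed.

Lemma matrix_unit_norm a b : op_norm (matrix_unit a b) <= 1.
Proof.
apply: op_norm_le => // f.
by rewrite mul1r l2_normZ l2_norm_delta mulr1; exact: normc_le_l2_norm.
Qed.

Lemma matrix_unit_positive : positive_op_matrix matrix_unit.
Proof.
move=> f; rewrite (_ : \sum_i _ = (\sum_a f a a)^* * \sum_a f a a).
  exact: conj_mul_ge0.
rewrite rmorph_sum mulr_suml; apply: eq_bigr => i _; rewrite mulr_sumr; apply: eq_bigr => j _.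
by rewrite dotZl dot_conj dot_delta mulrC.
Qed.

Lemma matrix_unit_decomposition (T : l2 R 'I_k -> l2 R 'I_k) : linear T ->
  T = \sum_(p : 'I_k * 'I_k) T (delta R p.2) p.1 *: matrix_unit p.1 p.2.
Proof.
move=> lT; apply/funext => f; rewrite sum_opE.
have fE : f = \sum_b f b *: delta R b.
  apply: l2_eq => i; rewrite -[RHS]dot_delta dot_suml (bigD1 i)//= dotZl dot_delta deltaE eqxx mulr1.
  rewrite big1 ?addr0// => b bi.
  by rewrite dotZl dot_delta deltaE eq_sym (negPf bi) mulr0.
apply: l2_eq => i; rewrite {1}fE linear_sum// -[LHS]dot_delta -[RHS]dot_delta !dot_suml.
transitivity (\sum_a \sum_b l2_dot ((T (delta R b) a *: matrix_unit a b) f) (delta R i)); last first.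
  by rewrite pair_bigA.
rewrite exchange_big; apply: eq_bigr => b _ /=; rewrite (bigD1 i)//=.
rewrite dotZl -[(_ *: _) f]/(T (delta R b) i *: (f b *: delta R i)) !dotZl !dot_delta deltaE eqxx mulr1.
rewrite big1 ?addr0 1?mulrC// => a ai.
rewrite -[(_ *: _) f]/(T (delta R b) a *: (f b *: delta R a)) !dotZl !dot_delta deltaE.
by rewrite eq_sym (negPf ai) !mulr0.
Qed.

End MatrixUnits.

Section ExactApproximable.
Local Open Scope ring_scope.
Variables (R : realType) (G : groupType).
Notation C := R[i].
Notation lam := (@left_regular R G).

Section Kernel.
Variables (k : nat) (psi : (l2 R 'I_k -> l2 R 'I_k) -> (l2 R G -> l2 R G)).
Hypothesis psi_cp : contractive_cp (@bounded_op R 'I_k) psi.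
Variables (n : nat) (xi : 'I_n -> 'I_k -> l2 R G) (A : {fset G}).
Hypothesis xiA : forall r a x, x \notin A -> xi r a x = 0.

Definition entry (p : 'I_k * 'I_k) (s t : G) : C := psi (matrix_unit p.1 p.2) (delta R t) s.

(** The entry (s, t) of psi (phi' (lam (s t^-1))), where phi' is the map with
coefficients sum_r <lam g xi_r,b, xi_r,a>. *)
Definition kernel (s t : G) : C :=
  \sum_p (\sum_r l2_dot (lam (s * t^-1)%g (xi r p.2)) (xi r p.1)) * entry p s t.

Lemma psi_bounded p : bounded_op (psi (matrix_unit p.1 p.2)).
Proof. by case: psi_cp => + _ _ _; apply; exact: matrix_unit_bounded. Qed.

Lemma entry_le1 p s t : normc (entry p s t) <= 1.
Proof.
have [_ _ _ np] := psi_cp.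
rewrite (le_trans (normc_entry _ _ (psi_bounded p)))//.
rewrite (le_trans (np _ (matrix_unit_bounded _ _ _)))//; exact: matrix_unit_norm.
Qed.

(** The part of the kernel coming from the point s z of the inner product that
defines phi'; it vanishes unless both s z and t z lie in A. *)
Definition summand (z : G) (r : 'I_n) (s t : G) : C :=
  \sum_p (xi r p.1 (s * z)%g)^* * xi r p.2 (t * z)%g * entry p s t.

Lemma kernel_summands s t :
  kernel s t = \sum_(z <- [seq (s^-1 * x)%g | x <- A]) \sum_r summand z r s t.
Proof.
rewrite /kernel big_map.
transitivity (\sum_p \sum_r \sum_(x <- A) (xi r p.1 x)^* * xi r p.2 (t * (s^-1 * x))%g * entry p s t).
  apply: eq_bigr => p _; rewrite mulr_suml; apply: eq_bigr => r _.
  rewrite (@dot_fset _ _ _ _ A) => [|x xA]; last by rewrite xiA// conjC0 mulr0.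
  rewrite mulr_suml; apply: eq_bigr => x _; rewrite left_regularE invgM invgK -mulgA.
  by congr (_ * _); rewrite mulrC.
transitivity (\sum_p \sum_(x <- A) \sum_r (xi r p.1 x)^* * xi r p.2 (t * (s^-1 * x))%g * entry p s t).
  by apply: eq_bigr => p _; exact: exchange_big.
rewrite exchange_big; apply: eq_bigr => x _; rewrite exchange_big; apply: eq_bigr => r _.
rewrite /summand.
by apply: eq_bigr => p _; rewrite mulVKg.
Qed.

Let en (i : 'I_(size (A : seq G))) : G := nth 1%g A i.

Let en_inj : injective en.
Proof. by move=> a b /eqP; rewrite nth_uniq ?fset_uniq// => /eqP; exact: val_inj. Qed.

Let enP x : x \in A -> exists i, en i = x.
Proof.
by move=> xA; exists (Ordinal (etrans (index_mem _ _) xA)); rewrite /en /= nth_index.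
Qed.

(** Complete positivity of psi, applied to the positive matrix of matrix units and
the vectors sum_j c_j xi_r,b (e_j) delta_(e_j z^-1), where the e_j enumerate
A. *)
Lemma summand_psd z r :
  psd (fun i j => summand z r (en i * z^-1)%g (en j * z^-1)%g).
Proof.
move=> c; have [_ _ pos _] := psi_cp.
have := pos k (@matrix_unit R k) (fun a b => matrix_unit_bounded R a b) (@matrix_unit_positive R k)
  (fun b => \sum_j (c j * xi r b (en j)) *: delta R (en j * z^-1)%g).
congr (0 <= _).
pose F (p : 'I_k * 'I_k) i j := (c i)^* * c j *
  ((xi r p.1 (en i))^* * xi r p.2 (en j) * entry p (en i * z^-1)%g (en j * z^-1)%g).
transitivity (\sum_p \sum_i \sum_j F p i j).
  transitivity (\sum_a \sum_b \sum_i \sum_j F (a, b) i j); last by rewrite pair_bigA; apply: eq_bigr => -[].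
  apply: eq_bigr => a _; apply: eq_bigr => b _.
  rewrite linear_sum; last by case: (psi_bounded (a, b)).
  rewrite dot_sumr; apply: eq_bigr => i _; rewrite dot_suml; apply: eq_bigr => j _.
  by rewrite dotZl dotZr dot_delta rmorphM /= /F /entry /=; ring.
rewrite exchange_big; apply: eq_bigr => i _ /=; rewrite exchange_big; apply: eq_bigr => j _ /=.
by rewrite /summand mulr_sumr; apply: eq_bigr => p _; rewrite /F !mulgVK.
Qed.

(** The Gram vectors of the summands, indexed by z, r and the position in the Gram
decomposition; zeta s is supported at the z with s z in A. *)
Lemma kernel_gram : exists (Z : choiceType) (zeta : G -> Z -> C) (supp : G -> seq Z),
  [/\ forall s, uniq (supp s) /\ forall x, zeta s x != 0 -> x \in supp s,
      forall s t, kernel s t = \sum_(x <- supp s) zeta s x * (zeta t x)^* &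
      forall s t x, zeta s x != 0 -> zeta t x != 0 ->
        exists y z, [/\ y \in A, z \in A & (s * t^-1)%g = (y * z^-1)%g]].
Proof.
have /choice[v vP] : forall zr : G * 'I_n, exists v : 'I_(size (A : seq G)) -> 'I_(size (A : seq G)) -> C,
    forall i j, summand zr.1 zr.2 (en i * zr.1^-1)%g (en j * zr.1^-1)%g = \sum_l (v l i)^* * v l j.
  by move=> [z r]; apply: psd_gram; exact: summand_psd.
pose m := size (A : seq G).
pose zeta (s : G) (x : G * 'I_n * 'I_m) : C :=
  \sum_i (en i == s * x.1.1)%g%:R * (v x.1 x.2 i)^*.
have zeta_en s z r l i : en i = (s * z)%g -> zeta s (z, r, l) = (v (z, r) l i)^*.
  move=> ei; rewrite /zeta (bigD1 i)//= ei eqxx mul1r big1 ?addr0// => j ji.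
  by rewrite -ei (inj_eq en_inj) (negPf ji) mul0r.
have zeta_notin s x : (s * x.1.1)%g \notin A -> zeta s x = 0.
  move=> sA; rewrite /zeta big1// => i _; case: eqP => [ei|_]; last by rewrite mul0r.
  by move: sA; rewrite -ei mem_nth.
have zeta_in s x : zeta s x != 0 -> (s * x.1.1)%g \in A.
  by apply: contraNT => /zeta_notin ->.
pose supp s := [seq (zr, l) | zr <- [seq (z, r) | z <- [seq (s^-1 * x)%g | x <- (A : seq G)], r <- enum 'I_n],
    l <- enum 'I_m].
exists (G * 'I_n * 'I_m)%type, zeta, supp; split.
- move=> s; split.
    apply: allpairs_uniq; rewrite ?enum_uniq//; last by move=> [? ?] [? ?].
    apply: allpairs_uniq; rewrite ?enum_uniq//; last by move=> [? ?] [? ?].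
    by rewrite map_inj_uniq ?fset_uniq//; exact: mulgI.
  move=> [[z r] l] /zeta_in /= szA; apply: allpairs_f; last by rewrite mem_enum.
  apply: allpairs_f; last by rewrite mem_enum.
  by apply/mapP; exists (s * z)%g; rewrite ?mulKg.
- move=> s t; rewrite kernel_summands /supp big_allpairs_dep big_allpairs_dep.
  apply: eq_bigr => z _; rewrite big_enum; apply: eq_bigr => r _; rewrite big_enum /=.
  have [szA|szA] := boolP ((s * z)%g \in A); last first.
    rewrite /summand big1 => [|p _]; last by rewrite xiA// conjC0 !mul0r.
    by rewrite big1// => l _; rewrite zeta_notin ?mul0r.
  have [tzA|tzA] := boolP ((t * z)%g \in A); last first.
    rewrite /summand big1 => [|p _]; last by rewrite (xiA _ _ tzA) mulr0 mul0r.
    by rewrite big1// => l _; rewrite (zeta_notin t) ?conjC0 ?mulr0.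
  have [i ei] := enP szA; have [j ej] := enP tzA.
  have := vP (z, r) i j; rewrite /= ei ej !mulgK => ->; apply: eq_bigr => l _.
  by rewrite (zeta_en _ _ _ _ _ ei) (zeta_en _ _ _ _ _ ej) conjCK.
- move=> s t x /zeta_in sA /zeta_in tA; exists (s * x.1.1)%g, (t * x.1.1)%g; split=> //.
  by rewrite invgM mulgA mulgK.
Qed.

End Kernel.

(** By nuclearity the kernel is close to 1 at the (s, t) with s t^-1 in S or s = t.
Replacing the Gram vectors by the moduli of their coordinates only increases the
overlaps, and dividing by the square root of 1 + e / 2 makes them contractions
at the cost of another e / 2. *)
Theorem approximable_of_exact : exact_group R G -> exact_approximable R G.
Proof.
move=> [J [F [K [phi [psi [PF cphi cpsi cvg]]]]]] S e e0.
pose S1 := 1%g :: S.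
have e4 : 0 < e / 4 by rewrite divr_gt0.
have nr : F [set j | forall g, g \in S1 -> op_norm (psi j (phi j (lam g)) - lam g) <= e / 4].
  elim: S1 => [|g s IH]; first by apply: filterS filterT => j _ g.
  have /cvgrPdist_le/(_ _ e4) h := cvg _ (left_regular_cstar R g).
  apply: filterS2 IH h => j IH h g'; rewrite in_cons => /predU1P[->|/IH//].
  by apply: le_trans h; rewrite /= sub0r normrN ler_norm.
have [j {}nr] := filter_ex nr.
have jP g : g \in S1 -> op_norm (psi j (phi j (lam g)) - lam g) <= e / 4 by exact: nr.
move: {nr} (K j) (phi j) (psi j) (cphi j) (cpsi j) jP => k f h cf ch near.
pose gs (i : 'I_(size S1)) : G := nth 1%g S1 i.
pose k2 : R := (#|{: 'I_k * 'I_k}|)%:R.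
have k20 : 0 <= k2 by rewrite ler0n.
pose d := e / 4 / (k2 + 1).
have d0 : 0 < d by rewrite divr_gt0// ltr_wpDl.
have [n [xi [A [xiA appr]]]] := vector_approximation cf gs d0.
pose u := kernel h xi.
have unear s t : (s * t^-1)%g \in S1 -> normc (u s t - 1) <= e / 2.
  move=> stS; set g := (s * t^-1)%g in stS *.
  have [i gi] : exists i, gs i = g.
    by exists (Ordinal (etrans (index_mem _ _) stS)); rewrite /gs /= nth_index.
  have hf : h (f (lam g)) (delta R t) s = \sum_p coefficient f g p.1 p.2 * entry h p s t.
    have lf : linear (f (lam g)) by exact: (phi_linear cf (left_regular_cstar R g)).
    rewrite {1}(matrix_unit_decomposition lf) (contractive_cp_sum _ _ ch); last first.
      by move=> p; exact: matrix_unit_bounded.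
    rewrite sum_opE -dot_delta dot_suml; apply: eq_bigr => p _.
    by rewrite -[(_ *: _) _]/(_ *: h (matrix_unit p.1 p.2) (delta R t)) dotZl dot_delta.
  have lst : lam g (delta R t) s = 1.
    by rewrite left_regularE deltaE /g invgM invgK -mulgA mulVg mulg1 eqxx.
  have -> : u s t - 1 = (u s t - h (f (lam g)) (delta R t) s)
      + (h (f (lam g)) (delta R t) s - lam g (delta R t) s) by rewrite lst; ring.
  rewrite (le_trans (le_normcD _ _))//.
  have bh : bounded_op (h (f (lam g)) - lam g).
    rewrite addrC -scaleN1r; apply: bounded_op_lin; first exact: left_regular_bounded.
    by case: ch => + _ _ _; apply; case: cf => + _ _ _; apply; exact: left_regular_cstar.
  have le2 : normc (h (f (lam g)) (delta R t) s - lam g (delta R t) s) <=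
      op_norm (h (f (lam g)) - lam g) by exact: normc_entry t s bh.
  have le1 : normc (u s t - h (f (lam g)) (delta R t) s) <= k2 * d.
    rewrite hf /u /kernel -sumrB /k2 mulr_natl -sumr_const.
    rewrite (le_trans (normc_sum _ _))//; apply: ler_sum => p _.
    rewrite -mulrBl normcM -[leRHS]mulr1 ler_pM ?normc_ge0 ?(entry_le1 ch)//.
    by rewrite -normcN opprB -/g -gi.
  have k2d : k2 * d <= e / 4.
    rewrite /d mulrCA; apply: ler_piMr; first exact: ltW.
    by rewrite ler_pdivrMr ?ltr_wpDl// mul1r lerDl.
  have nearg : op_norm (h (f (lam g)) - lam g) <= e / 4 by exact: near g stS.
  have -> : e / 2 = e / 4 + e / 4 by field.
  by apply: lerD; [exact: le_trans le1 k2d|exact: le_trans le2 nearg].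
have [Z [zeta [supp [zP uE zB]]]] := kernel_gram ch xiA.
pose c := 1 + e / 2.
have c0 : 0 < c by rewrite /c; lra.
pose sc := (Num.sqrt c)^-1.
have sc0 : 0 <= sc by rewrite invr_ge0 sqrtr_ge0.
have scc : sc * sc = c^-1 by rewrite -invfM -expr2 sqr_sqrtr// ltW.
exists [set g | exists y z, [/\ y \in A, z \in A & g = (y * z^-1)%g]].
  apply: (@sub_finite_set _ _ [set` [seq (y * z^-1)%g | y <- (A : seq G), z <- (A : seq G)]]);
    last exact: finite_seq.
  by move=> _ [y [z [yA zA ->]]] /=; apply: allpairs_f.
pose ze s z := normc (zeta s z) * sc.
have ze_nz s z : ze s z != 0 -> zeta s z != 0.
  by apply: contraNneq => zz; rewrite /ze zz normc_zero mul0r.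
exists Z, ze, supp; split.
- by move=> s z; rewrite mulr_ge0 ?normc_ge0.
- by move=> s; have [us sP] := zP s; split=> // z /ze_nz; apply: sP.
- move=> s; have := unear s s; rewrite mulgV => /(_ (mem_head _ _)) us.
  have uss : u s s = (\sum_(z <- supp s) normc (zeta s z) ^+ 2)%:C%C.
    rewrite /u uE rmorph_sum; apply: eq_bigr => z _.
    by rewrite mulrC; exact: conj_mul.
  have -> : overlap (supp s) (ze s) (ze s) = (\sum_(z <- supp s) normc (zeta s z) ^+ 2) * c^-1.
    by rewrite -scc mulr_suml; apply: eq_bigr => z _; rewrite /ze; ring.
  rewrite ler_pdivrMr// mul1r /c.
  move: us; rewrite uss; set q := \sum_(z <- _) _.
  have -> : normc (q%:C%C - 1) = `|q - 1| by rewrite -normc_real rmorphB rmorph1.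
  by move=> /(le_trans (ler_norm _)); lra.
- move=> s t sS; have us := unear s t (mem_behead (s := S1) sS).
  have -> : overlap (supp s) (ze s) (ze t) = (\sum_(z <- supp s) normc (zeta s z) * normc (zeta t z)) * c^-1.
    by rewrite -scc mulr_suml; apply: eq_bigr => z _; rewrite /ze; ring.
  rewrite ler_pdivlMr//.
  have ule : normc (u s t) <= \sum_(z <- supp s) normc (zeta s z) * normc (zeta t z).
    rewrite /u uE (le_trans (normc_sum _ _))//; apply: ler_sum => z _.
    by rewrite normcM normc_conj.
  apply: le_trans ule.
  have : 1 <= normc (u s t - 1) + normc (u s t).
    rewrite -[leLHS](normc_one R) -[in leRHS]normcN opprB.
    by apply: le_trans (le_normcD _ _); rewrite subrK.
  by rewrite /c; nra.
- by move=> s t z /ze_nz sz /ze_nz tz; exact: zB sz tz.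
Qed.

End ExactApproximable.

Theorem exact_second_nilpotent_product (R : realType) (I : choiceType) (H : I -> groupType) :
  (forall i, exact_group R (H i)) -> exact_group R (second_nilpotent_product H).
Proof.
move=> eH; apply: exact_of_approximable.
by apply: exact_approximable_second_nilpotent_product => i; apply: approximable_of_exact.
Qed.

Theorem mainTheorem2 (R : realType) (I : countType) (H : I -> groupType) :
  [/\ (forall i, amenable R (H i)) -> amenable R (second_nilpotent_product H),
      (forall i, haagerup R (H i)) -> haagerup R (second_nilpotent_product H)
    & (forall i, exact_group R (H i)) ->
        exact_group R (second_nilpotent_product H)].
Proof.
split; [exact: amenable_second_nilpotent_product
  |exact: haagerup_second_nilpotent_product|exact: exact_second_nilpotent_product].
Qed.
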